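(* Let $\Gamma$ be a quasi-finite, free EI-category satisfying condition (I). Then $(S,E)$, with $S\colon K_0(\mathbb{Q}\Gamma)\to\mathrm{Split}K_0(\mathbb{Q}\Gamma)$; $(\mathrm{Res},I)$, with $\mathrm{Res}\colon K_0(\mathbb{Q}\Gamma)\to\mathrm{Split}K_0(\mathbb{Q}\Gamma)$; $(\omega,\mu)$, endomorphisms of $\mathrm{Split}K_0(\mathbb{Q}\Gamma)$; and $(\overline{\omega}^{(2)},\overline{\mu}^{(2)})$, endomorphisms of $U(\Gamma)\otimes_{\mathbb{Z}}\mathbb{Q}$, are pairs of isomorphisms inverse to one another. The $L^2$-rank defines a homomorphism $\mathrm{rk}^{(2)}_\Gamma\colon\mathrm{Split}K_0(\mathbb{Q}\Gamma)\to U(\Gamma)\otimes_{\mathbb{Z}}\mathbb{Q}$, and the diagram formed by these maps commutes, i.e. $$\omega\circ S=\mathrm{Res},\qquad \mu\circ\mathrm{Res}=S,\qquad \mathrm{rk}^{(2)}_\Gamma\circ\omega=\overline{\omega}^{(2)}\circ\mathrm{rk}^{(2)}_\Gamma,\qquad \mathrm{rk}^{(2)}_\Gamma\circ\mu=\overline{\mu}^{(2)}\circ\mathrm{rk}^{(2)}_\Gamma .$$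
   Context: An EI-category is a small category in which every endomorphism is an isomorphism. $\mathrm{iso}(\Gamma)$ is the set of isomorphism classes $\overline{x}$ of objects, with fixed representatives $x$; $\overline{x}\le\overline{y}$ iff $\mathrm{mor}(x,y)\ne\emptyset$. $\Gamma$ is quasi-finite if each set $\{\overline{y}\mid\overline{y}\le\overline{x}\}$ is finite and each right $\mathrm{aut}(x)$-set $\mathrm{mor}(x,y)$ is proper (finite isotropy groups) and cofinite (finitely many orbits). $\Gamma$ is free if for all $x,y$ the left $\mathrm{aut}(y)$-action on $\mathrm{mor}(x,y)$ is free. A group $G$ satisfies condition (I) if the map $\bigoplus_{H\subseteq G,|H|<\infty}K_0(\mathbb{Q}H)\otimes_{\mathbb{Z}}\mathbb{Q}\to K_0(\mathbb{Q}G)\otimes_{\mathbb{Z}}\mathbb{Q}$ induced by the inclusions of finite subgroups is surjective; $\Gamma$ satisfies condition (I) if every $\mathrm{aut}(x)$ does. $U(\Gamma)$ is the free abelian group on $\mathrm{iso}(\Gamma)$. A $\mathbb{Q}\Gamma$-module is a functor $\Gamma^{op}\to\mathbb{Q}\text{-Mod}$ (exactness objectwise). $\mathbb{Q}\,\mathrm{mor}(?,x)$ sends $y$ to the free $\mathbb{Q}$-module on $\mathrm{mor}(y,x)$. Finitely generated (f.g.) free means a finite direct sum of these; f.g. projective means a direct summand of a f.g. free one. $K_0(\mathbb{Q}\Gamma)$ is generated by isomorphism classes of f.g. projective modules modulo short exact sequences. A module $M$ with a finite projective resolution $P_*$ has class $[M]=\sum_n(-1)^n[P_n]$. $\mathbb{Q}[x]:=\mathbb{Q}[\mathrm{aut}(x)]$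 (right modules). $\mathrm{Split}K_0(\mathbb{Q}\Gamma):=\bigoplus_{\overline{x}}K_0(\mathbb{Q}[x])$. $S_xM$ is the quotient of $M(x)$ by the submodule generated by the images of $M(u)$, $u\colon x\to y$ a non-isomorphism; $E_xN:=N\otimes_{\mathbb{Q}[x]}\mathbb{Q}\,\mathrm{mor}(?,x)$; $\mathrm{Res}_xM:=M(x)$; $I_xN(y):=N\otimes_{\mathbb{Q}[x]}\mathbb{Q}\,\mathrm{mor}(y,x)$ if $\overline{y}=\overline{x}$ and $0$ otherwise. $S[P]=([S_xP])_{\overline{x}}$, $E(([Q_x])_{\overline{x}})=\sum[E_xQ_x]$, $\mathrm{Res}[P]=([\mathrm{Res}_xP])_{\overline{x}}$, $I(([Q_x])_{\overline{x}})=\sum[I_xQ_x]$. For $l\ge1$, $\mathrm{ch}_l(y,x)$ is the set of chains $c=(\overline{x_0}<\cdots<\overline{x_l})$ with $\overline{x_0}=\overline{y}$, $\overline{x_l}=\overline{x}$, and $S(c)$ is the $\mathrm{aut}(x)$-$\mathrm{aut}(y)$-biset $\mathrm{mor}(x_{l-1},x)\times_{\mathrm{aut}(x_{l-1})}\cdots\times_{\mathrm{aut}(x_1)}\mathrm{mor}(y,x_1)$; $\mathrm{ch}_0(y,x)$ has one element $c$, with $S(c)=\mathrm{mor}(x,x)$, if $\overline{x}=\overline{y}$, and is empty otherwise. $\omega$ is given by the matrix of maps $K_0(\mathbb{Q}[x])\to K_0(\mathbb{Q}[y])$, $[P]\mapsto[P\otimes_{\mathbb{Q}[x]}\mathbb{Q}\,\mathrm{mor}(y,x)]$;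 $\mu$ by the matrix of maps $[P]\mapsto\sum_{l\ge0}(-1)^l\sum_{c\in\mathrm{ch}_l(y,x)}[P\otimes_{\mathbb{Q}[x]}\mathbb{Q}S(c)]$. $\mathcal{N}(y)$ is the group von Neumann algebra of $\mathrm{aut}(y)$, and $\dim_{\mathcal{N}(y)}$ is L\''uck's dimension function (on f.g. projective modules: the sum of the traces $\mathrm{tr}(a)=\langle a(e),e\rangle$ of the diagonal entries of a representing idempotent matrix). $\overline{\omega}^{(2)}$ is given by the matrix with entry, from the $\overline{x}$-summand to the $\overline{y}$-summand, $\dim_{\mathcal{N}(y)}(\mathbb{Q}\,\mathrm{mor}(y,x)\otimes_{\mathbb{Q}[y]}\mathcal{N}(y))$; $\overline{\mu}^{(2)}$ by the matrix with entry $\sum_{l\ge0}(-1)^l\sum_{c\in\mathrm{ch}_l(y,x)}\dim_{\mathcal{N}(y)}(\mathbb{Q}S(c)\otimes_{\mathbb{Q}[y]}\mathcal{N}(y))$. (For a right $\mathrm{aut}(y)$-set $\coprod_{i=1}^rL_i\backslash\mathrm{aut}(y)$ with $L_i$ finite the corresponding dimension is $\sum_i1/|L_i|$.) $\mathrm{rk}^{(2)}_\Gamma$ is the direct sum over $\overline{x}$ of the maps $[P]\mapsto\dim_{\mathcal{N}(x)}(P\otimes_{\mathbb{Q}[x]}\mathcal{N}(x))$. *)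

(* Defs.v *)
From HB Require Import structures.
From mathcomp Require Import all_boot all_order all_algebra.
From mathcomp Require Import boolp classical_sets functions cardinality fsbigop.
From mathcomp Require Import reals ereal esum.
From mathcomp Require Import complex ring lra.

Set Implicit Arguments.
Unset Strict Implicit.
Unset Printing Implicit Defensive.

Import Order.TTheory GRing.Theory Num.Theory.

Local Open Scope classical_set_scope.
Local Open Scope quotient_scope.
Local Open Scope ring_scope.

Section DirectSum.
Variables (R : pzRingType) (I : Type) (M : I -> lmodType R).

Record dsum := DSum {
  dsum_fun :> forall i, M i;
  dsum_finite : finite_set [set i | dsum_fun i != 0] }.

HB.instance Definition _ := gen_eqMixin dsum.
HB.instance Definition _ := gen_choiceMixin dsum.

Lemma dsumP (f g : dsum) : (forall i, f i = g i) -> f = g.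
Proof.
case: f g => [f Pf] [g Pg] /= fg.
have {}fg : f = g by apply: functional_extensionality_dep.
by rewrite fg in Pf *; congr DSum; apply: Prop_irrelevance.
Qed.

Lemma dsum0_subproof : finite_set [set i | (0 : M i) != 0].
Proof.
by apply: sub_finite_set (finite_set0 I) => i /=; rewrite eqxx.
Qed.
Definition dsum0 := DSum dsum0_subproof.

Lemma dsumN_subproof (f : dsum) : finite_set [set i | - f i != 0].
Proof.
by apply: sub_finite_set (dsum_finite f) => i /=; rewrite oppr_eq0.
Qed.
Definition dsumN f := DSum (dsumN_subproof f).

Lemma dsumD_subproof (f g : dsum) : finite_set [set i | f i + g i != 0].
Proof.
have fin : finite_set ([set i | f i != 0] `|` [set i | g i != 0]).
  by rewrite finite_setU; split; apply: dsum_finite.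
apply: sub_finite_set fin => i /= fg0.
have [f0|] := eqVneq (f i) 0; last by left.
by right; move: fg0; rewrite /= f0 add0r.
Qed.
Definition dsumD f g := DSum (dsumD_subproof f g).

Lemma dsumZ_subproof a (f : dsum) : finite_set [set i | a *: f i != 0].
Proof.
apply: sub_finite_set (dsum_finite f) => i /=.
by apply: contraNN => /eqP ->; rewrite scaler0.
Qed.
Definition dsumZ a f := DSum (dsumZ_subproof a f).

Lemma dsum_addA : associative dsumD.
Proof. by move=> f g h; apply: dsumP => i /=; rewrite addrA. Qed.
Lemma dsum_addC : commutative dsumD.
Proof. by move=> f g; apply: dsumP => i /=; rewrite addrC. Qed.
Lemma dsum_add0 : left_id dsum0 dsumD.
Proof. by move=> f; apply: dsumP => i /=; rewrite add0r. Qed.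
Lemma dsum_addN : left_inverse dsum0 dsumN dsumD.
Proof. by move=> f; apply: dsumP => i /=; rewrite addNr. Qed.
HB.instance Definition _ :=
  GRing.isZmodule.Build dsum dsum_addA dsum_addC dsum_add0 dsum_addN.

Lemma dsum_scaleA a b f : dsumZ a (dsumZ b f) = dsumZ (a * b) f.
Proof. by apply: dsumP => i /=; rewrite scalerA. Qed.
Lemma dsum_scale1 : left_id 1 dsumZ.
Proof. by move=> f; apply: dsumP => i /=; rewrite scale1r. Qed.
Lemma dsum_scaleDr : right_distributive dsumZ +%R.
Proof. by move=> a f g; apply: dsumP => i /=; rewrite scalerDr. Qed.
Lemma dsum_scaleDl f : {morph dsumZ^~ f : a b / a + b}.
Proof. by move=> a b; apply: dsumP => i /=; rewrite scalerDl. Qed.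
HB.instance Definition _ := GRing.Zmodule_isLmodule.Build R dsum
  dsum_scaleA dsum_scale1 dsum_scaleDr dsum_scaleDl.

Lemma dsumDE (f g : dsum) i : (f + g) i = f i + g i. Proof. by []. Qed.
Lemma dsumZE a (f : dsum) i : (a *: f) i = a *: f i. Proof. by []. Qed.

Definition dcoord i (f : dsum) : M i := f i.
Lemma dcoord_is_linear i : linear (dcoord i).
Proof. by []. Qed.
HB.instance Definition _ i :=
  GRing.isLinear.Build R dsum (M i) _ (dcoord i) (@dcoord_is_linear i).

Definition din_fun i (m : M i) : forall j, M j :=
  @eqtype.dfwith {classic I} M (fun=> 0) i m.

Lemma din_subproof i (m : M i) : finite_set [set j | din_fun m j != 0].
Proof.
apply: sub_finite_set (finite_set1 i) => j /= mj.
apply: contrapT => ij; move: mj; rewrite /din_fun (@eqtype.dfwith_out {classic I}) ?eqxx//.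
by apply/eqP => ji; apply: ij.
Qed.

Definition din i (m : M i) : dsum := DSum (din_subproof m).

Lemma dinE i (m : M i) : din m i = m.
Proof. exact: (@eqtype.dfwith_in {classic I}). Qed.

Lemma dinN i j (m : M i) : i <> j -> din m j = 0.
Proof.
move=> ij; apply: (@eqtype.dfwith_out {classic I}).
by apply/eqP => ji; apply: ij.
Qed.

Lemma din_is_linear i : linear (@din i).
Proof.
move=> a m m'; apply: dsumP => j.
have [ij|ij] := pselect (i = j); last first.
  by rewrite dsumDE dsumZE !dinN// scaler0 addr0.
by case: j / ij; rewrite dsumDE dsumZE !dinE.
Qed.
HB.instance Definition _ i :=
  GRing.isLinear.Build R (M i) dsum _ (@din i) (@din_is_linear i).

Lemma dsum_eq0 (f : dsum) : (forall i, f i = 0) -> f = 0.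
Proof. by move=> f0; apply: dsumP => i; rewrite f0. Qed.

Variables (N : lmodType R) (g : forall i, {linear M i -> N}).

(* fsbigop sums need a choiceType of indices, hence {classic I}. *)
Definition dlift (f : dsum) : N := \sum_(i \in [set: {classic I}]) g i (f i).

Lemma dliftE (f : dsum) (A : set {classic I}) :
  finite_set A -> [set i | f i != 0] `<=` A ->
  dlift f = \sum_(i \in A) g i (f i).
Proof.
move=> finA fA; rewrite /dlift; apply/esym/fsbig_widen => // i [_ nAi] /=.
apply/eqP/negPn/negP => gi; apply: nAi; apply: fA => /=.
by apply: contraNN gi => /eqP ->; rewrite linear0.
Qed.

Lemma dlift_is_linear : linear dlift.
Proof.
move=> a f h; pose A := [set i | f i != 0] `|` [set i | h i != 0].
have finA : finite_set (A : set {classic I}).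
  by rewrite finite_setU; split; apply: dsum_finite.
have Af : [set i | f i != 0] `<=` A by move=> i fi; left.
have Ah : [set i | h i != 0] `<=` A by move=> i hi; right.
have Afh : [set i | (a *: f + h) i != 0] `<=` A.
  move=> i; rewrite /mkset dsumDE dsumZE => fhi.
  have [fi|fi] := eqVneq (f i) 0; last by left.
  by right; move: fhi; rewrite fi scaler0 add0r.
rewrite (dliftE finA Af) (dliftE finA Ah) (dliftE finA Afh).
rewrite !fsbig_finite//= scaler_sumr -big_split/=.
by apply: eq_bigr => i _; rewrite linearD linearZ.
Qed.
HB.instance Definition _ :=
  GRing.isLinear.Build R dsum N _ dlift dlift_is_linear.

Lemma dlift_in i (m : M i) : dlift (din m) = g i m.
Proof.
rewrite (@dliftE _ [set i]) ?fsbig_set1 ?dinE //.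
move=> j; rewrite /mkset => mj; apply: contrapT => /nesym ij.
by move: mj; rewrite dinN ?eqxx.
Qed.

End DirectSum.

Arguments din {R I} M i m.
Arguments dcoord {R I M} i f.

Lemma dsum_sum (R : pzRingType) (I : Type) (M : I -> lmodType R) (f : dsum M) :
  f = \sum_(i \in [set i : {classic I} | f i != 0]) din M i (f i).
Proof.
have fin : finite_set [set i : {classic I} | f i != 0] by exact: dsum_finite.
apply: dsumP => i; rewrite -[RHS]/(dcoord i _) fsbig_finite//= linear_sum.
rewrite -(fsbig_finite _ (fun j : {classic I} => dcoord i (din M j (f j))) fin).
have [fi|fi] := eqVneq (f i) 0.
  rewrite fi fsbig1// => j _; have [ji|ji] := pselect (j = i).
    by rewrite ji fi linear0.
  by rewrite /dcoord dinN.
rewrite (fsbigD1 (i : {classic I})) // fsbig1 /dcoord ?dinE/= ?addr0//.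
by move=> j [_ ji]; apply: dinN.
Qed.

Lemma dsum_ext (R : pzRingType) (I : Type) (M : I -> lmodType R) (N : lmodType R)
    (g h : {linear dsum M -> N}) :
  (forall i m, g (din M i m) = h (din M i m)) -> g =1 h.
Proof.
move=> gh f; rewrite (dsum_sum f).
have fin : finite_set [set i : {classic I} | f i != 0] by exact: dsum_finite.
by rewrite fsbig_finite//= !linear_sum; apply: eq_bigr => i _; apply: gh.
Qed.

Definition freemod (R : pzRingType) (T : Type) : lmodType R :=
  dsum (fun _ : T => R^o : lmodType R).

Definition fbasis (R : pzRingType) (T : Type) (t : T) : freemod R T :=
  din (fun _ : T => R^o : lmodType R) t 1.

Section FreeMap.
Variables (R : comPzRingType) (T : Type) (N : lmodType R).

Section Scale.
Variable n : N.
Definition fscale (a : R^o) : N := a *: n.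
Lemma fscale_is_linear : linear fscale.
Proof. by move=> a b c; rewrite /fscale scalerDl scalerA. Qed.
HB.instance Definition _ :=
  GRing.isLinear.Build R R^o N _ fscale fscale_is_linear.
End Scale.

Definition flift (f : T -> N) : {linear freemod R T -> N} :=
  dlift (fun t => fscale (f t) : {linear R^o -> N}).

Lemma flift_basis f t : flift f (fbasis R t) = f t.
Proof. by rewrite [LHS]dlift_in /= /fscale scale1r. Qed.

Lemma freemod_ext (g h : {linear freemod R T -> N}) :
  (forall t, g (fbasis R t) = h (fbasis R t)) -> g =1 h.
Proof.
move=> gh; apply: dsum_ext => t a.
suff -> : din (fun _ : T => R^o : lmodType R) t a = a *: fbasis R t.
  by rewrite !linearZ gh.
by rewrite -linearZ; congr din; rewrite /*:%R /= mulr1.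
Qed.
End FreeMap.

Definition freemap (R : comPzRingType) (S T : Type) (f : S -> T) :
  {linear freemod R S -> freemod R T} := flift (fun s => fbasis R (f s)).

Lemma freemap_basis (R : comPzRingType) (S T : Type) (f : S -> T) s :
  freemap R f (fbasis R s) = fbasis R (f s).
Proof. exact: flift_basis. Qed.

Lemma freemap_id (R : comPzRingType) (T : Type) (f : T -> T) : f =1 id ->
  freemap R f =1 id.
Proof.
move=> f1; apply: (@freemod_ext R T _ (freemap R f) idfun) => t.
by rewrite freemap_basis f1.
Qed.

Lemma freemap_comp (R : comPzRingType) (S T U : Type) (f : S -> T) (g : T -> U) h :
  h =1 g \o f -> freemap R h =1 freemap R g \o freemap R f.
Proof.
move=> hgf; apply: (@freemod_ext R S _ _ (freemap R g \o freemap R f)) => t /=.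
by rewrite !freemap_basis hgf.
Qed.

Section LinearQuotient.
Variables (R : pzRingType) (M : lmodType R) (K : set M).

(* The submodule generated by K. *)
Definition lspan : {pred M} := [pred m | `[< forall S : set M,
  [/\ K `<=` S, S 0 & forall a u v, S u -> S v -> S (a *: u + v)] -> S m >]].

Lemma lspan_sub k : K k -> k \in lspan.
Proof. by move=> Kk; apply/asboolP => S [KS _ _]; apply: KS. Qed.

Lemma lspan_submod_closed : submod_closed lspan.
Proof.
split=> [|a u v /asboolP hu /asboolP hv]; apply/asboolP => S hS.
  by case: hS.
by have [_ _ H] := hS; apply: H; [apply: hu|apply: hv].
Qed.
HB.instance Definition _ :=
  GRing.isSubmodClosed.Build R M lspan lspan_submod_closed.

(* M modulo the submodule generated by K. *)
Definition lquot := Quotient.quot lspan.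
HB.instance Definition _ := GRing.Zmodule.on lquot.

Definition lpi : M -> lquot := \pi_(Quotient.quot lspan).

Lemma lpiP u v : lpi u = lpi v <-> u - v \in lspan.
Proof.
rewrite /lpi; split=> [uv|uv]; last by apply/eqP; rewrite -Quotient.idealrBE.
by rewrite Quotient.idealrBE; apply/eqP.
Qed.

Lemma lpi_repr (x : lquot) : lpi (repr x) = x.
Proof. by rewrite /lpi reprK. Qed.

Lemma lpiD u v : lpi (u + v) = lpi u + lpi v.
Proof. by rewrite /lpi; apply: (raddfD \pi_(Quotient.quot lspan)). Qed.

Definition lquot_scale (a : R) (x : lquot) : lquot := lpi (a *: repr x).

Lemma lpiZ a u : lpi (a *: u) = lquot_scale a (lpi u).
Proof. by apply/lpiP; rewrite -scalerBr rpredZ//; apply/lpiP; rewrite lpi_repr. Qed.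

Lemma lquot_scaleA a b x :
  lquot_scale a (lquot_scale b x) = lquot_scale (a * b) x.
Proof. by rewrite -[x]lpi_repr -!lpiZ scalerA. Qed.
Lemma lquot_scale1 : left_id 1 lquot_scale.
Proof. by move=> x; rewrite -[x]lpi_repr -!lpiZ scale1r. Qed.
Lemma lquot_scaleDr : right_distributive lquot_scale +%R.
Proof.
move=> a x y; rewrite -[x]lpi_repr -[y]lpi_repr.
by rewrite -lpiD -!lpiZ scalerDr lpiD.
Qed.
Lemma lquot_scaleDl x : {morph lquot_scale^~ x : a b / a + b}.
Proof. by move=> a b; rewrite -[x]lpi_repr -!lpiZ -lpiD scalerDl. Qed.
HB.instance Definition _ := GRing.Zmodule_isLmodule.Build R lquot
  lquot_scaleA lquot_scale1 lquot_scaleDr lquot_scaleDl.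

Lemma lpi_is_linear : linear lpi.
Proof. by move=> a u v; rewrite lpiD lpiZ. Qed.
HB.instance Definition _ := GRing.isLinear.Build R M lquot _ lpi lpi_is_linear.

Lemma lquot_ext (N : lmodType R) (f g : {linear lquot -> N}) :
  (forall m, f (lpi m) = g (lpi m)) -> f =1 g.
Proof. by move=> fg x; rewrite -[x]lpi_repr fg. Qed.

Section Lift.
Variables (N : lmodType R) (f : {linear M -> N}).
Hypothesis fK : forall k, K k -> f k = 0.

Definition lqlift of (forall k, K k -> f k = 0) := fun x : lquot => f (repr x).

Lemma lqlift_pi m : lqlift fK (lpi m) = f m.
Proof.
apply/eqP; rewrite -subr_eq0 -linearB; apply/eqP.
have /lpiP/asboolP : lpi (repr (lpi m)) = lpi m by rewrite lpi_repr.
move/(_ [set k | f k = 0]); apply; split=> [k /fK//||a u v /= fu fv].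
  exact: linear0.
by rewrite linearD linearZ /= fu fv scaler0 addr0.
Qed.

Lemma lqlift_is_linear : linear (lqlift fK).
Proof.
move=> a x y; rewrite -[x]lpi_repr -[y]lpi_repr -linearP.
by rewrite !lqlift_pi linearP.
Qed.
HB.instance Definition _ :=
  GRing.isLinear.Build R lquot N _ (lqlift fK) lqlift_is_linear.
End Lift.
End LinearQuotient.

Arguments lpi {R M} K m.

(* The R-linear tensor product of A and B balanced over a set S that acts on
   A from the right and on B from the left. With S = G a group and R = rat it is
   the tensor product over QG; with S = void it is the tensor product over R. *)
Section Tensor.
Variables (R : comPzRingType) (S : Type) (A B : lmodType R).
Variables (ra : A -> S -> A) (lb : S -> B -> B).

Local Notation e a b := (fbasis R ((a, b) : A * B)).

Inductive tens_rel : freemod R (A * B) -> Prop :=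
| TensDl a a' b : tens_rel (e (a + a') b - (e a b + e a' b))
| TensDr a b b' : tens_rel (e a (b + b') - (e a b + e a b'))
| TensZl r a b : tens_rel (e (r *: a) b - r *: e a b)
| TensZr r a b : tens_rel (e a (r *: b) - r *: e a b)
| TensS a s b : tens_rel (e (ra a s) b - e a (lb s b)).

Definition tens : lmodType R := lquot tens_rel.
Definition ten (a : A) (b : B) : tens := lpi tens_rel (e a b).

Lemma tens_rel0 k : tens_rel k -> lpi tens_rel k = 0.
Proof. by move=> /lspan_sub Kk; rewrite -(linear0 (lpi _)); apply/lpiP; rewrite subr0. Qed.

Lemma tenP r a a' b : ten (r *: a + a') b = r *: ten a b + ten a' b.
Proof.
have := tens_rel0 (TensDl (r *: a) a' b); rewrite linearB linearD => /subr0_eq.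
rewrite /ten => ->; congr (_ + _).
by have := tens_rel0 (TensZl r a b); rewrite linearB linearZ => /subr0_eq.
Qed.

Lemma tenPr r a b b' : ten a (r *: b + b') = r *: ten a b + ten a b'.
Proof.
have := tens_rel0 (TensDr a (r *: b) b'); rewrite linearB linearD => /subr0_eq.
rewrite /ten => ->; congr (_ + _).
by have := tens_rel0 (TensZr r a b); rewrite linearB linearZ => /subr0_eq.
Qed.

Lemma tenS a s b : ten (ra a s) b = ten a (lb s b).
Proof. by have := tens_rel0 (TensS a s b); rewrite linearB => /subr0_eq. Qed.

Lemma tens_ext (N : lmodType R) (f g : {linear tens -> N}) :
  (forall a b, f (ten a b) = g (ten a b)) -> f =1 g.
Proof.
move=> fg; apply: lquot_ext.
by apply: (@freemod_ext R _ N (f \o lpi tens_rel) (g \o lpi tens_rel)) => -[a b]; apply: fg.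
Qed.

Section Lift.
Variables (N : lmodType R) (f : A -> B -> N).
Hypothesis fl : forall r a a' b, f (r *: a + a') b = r *: f a b + f a' b.
Hypothesis fr : forall r a b b', f a (r *: b + b') = r *: f a b + f a b'.
Hypothesis fS : forall a s b, f (ra a s) b = f a (lb s b).

Definition tlift_free : {linear freemod R (A * B) -> N} :=
  flift (fun ab => f ab.1 ab.2).

Lemma tlift_rel k : tens_rel k -> tlift_free k = 0.
Proof.
have f0l b : f 0 b = 0.
  by have := fl (-1) 0 0 b; rewrite !scaleN1r oppr0 addr0 addNr.
have f0r a : f a 0 = 0.
  by have := fr (-1) a 0 0; rewrite !scaleN1r oppr0 addr0 addNr.
have fe a b : tlift_free (e a b) = f a b by rewrite /tlift_free flift_basis.
have fD x y : tlift_free (x + y) = tlift_free x + tlift_free y.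
  exact: linearD.
have fZ r x : tlift_free (r *: x) = r *: tlift_free x by exact: linearZ.
case=> [a a' b|a b b'|r a b|r a b|a s b];
  rewrite linearB ?fD ?fZ !fe.
- by rewrite -[a]scale1r fl !scale1r subrr.
- by rewrite -[b]scale1r fr !scale1r subrr.
- by rewrite -[r *: a]addr0 fl f0l addr0 subrr.
- by rewrite -[r *: b]addr0 fr f0r addr0 subrr.
- by rewrite fS subrr.
Qed.

Definition tlift : {linear tens -> N} := lqlift tlift_rel.

Lemma tlift_ten a b : tlift (ten a b) = f a b.
Proof. by rewrite [LHS]lqlift_pi [LHS]flift_basis. Qed.
End Lift.
End Tensor.

Section TensorMap.
Variables (R : comPzRingType) (S : Type) (A B A' B' : lmodType R).
Variables (ra : A -> S -> A) (lb : S -> B -> B).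
Variables (ra' : A' -> S -> A') (lb' : S -> B' -> B').
Variables (f : {linear A -> A'}) (g : {linear B -> B'}).
Hypothesis fS : forall a s, f (ra a s) = ra' (f a) s.
Hypothesis gS : forall s b, g (lb s b) = lb' s (g b).

Lemma tmap_subproof :
  [/\ forall r a a' b, ten ra' lb' (f (r *: a + a')) (g b) =
        r *: ten ra' lb' (f a) (g b) + ten ra' lb' (f a') (g b),
      forall r a b b', ten ra' lb' (f a) (g (r *: b + b')) =
        r *: ten ra' lb' (f a) (g b) + ten ra' lb' (f a) (g b') &
      forall a s b, ten ra' lb' (f (ra a s)) (g b) =
        ten ra' lb' (f a) (g (lb s b))].
Proof.
split=> [r a a' b|r a b b'|a s b]; first by rewrite linearP tenP.
  by rewrite linearP tenPr.
by rewrite fS gS tenS.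
Qed.

Definition tmap : {linear tens ra lb -> tens ra' lb'} :=
  let: And3 fl fr fS := tmap_subproof in tlift fl fr fS.

Lemma tmap_ten a b : tmap (ten ra lb a b) = ten ra' lb' (f a) (g b).
Proof. by rewrite /tmap; case: tmap_subproof => *; rewrite tlift_ten. Qed.
End TensorMap.

Section DirectSumMap.
Variables (R : pzRingType) (I : Type) (M N : I -> lmodType R).
Variable f : forall i, {linear M i -> N i}.
Definition dmap : {linear dsum M -> dsum N} :=
  dlift (fun i => din N i \o f i : {linear M i -> dsum N}).
Lemma dmap_in i m : dmap (din M i m) = din N i (f i m).
Proof. by rewrite [LHS]dlift_in. Qed.
End DirectSumMap.

Record category := Category {
  cob :> Type;
  hom : cob -> cob -> Type;
  idm : forall x, hom x x;
  ccomp : forall x y z, hom y z -> hom x y -> hom x z;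
  compm1 : forall x y (f : hom x y), ccomp f (idm x) = f;
  comp1m : forall x y (f : hom x y), ccomp (idm y) f = f;
  compA : forall w x y z (h : hom y z) (g : hom x y) (f : hom w x),
    ccomp h (ccomp g f) = ccomp (ccomp h g) f }.

Arguments hom {c} x y.
Arguments idm {c} x.
Arguments ccomp {c x y z} g f.

Declare Scope cat_scope.
Delimit Scope cat_scope with cat.
Notation "g \oc f" := (ccomp g f) (at level 50, left associativity) : cat_scope.
Local Open Scope cat_scope.

Section Isomorphisms.
Variable C : category.
Implicit Types x y z : C.

Definition is_iso x y (f : hom x y) :=
  exists g : hom y x, g \oc f = idm x /\ f \oc g = idm y.

Definition isomorphic x y := exists f : hom x y, is_iso f.

Lemma is_iso_id x : is_iso (idm x).
Proof. by exists (idm x); rewrite compm1. Qed.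

Lemma is_iso_comp x y z (f : hom x y) (g : hom y z) :
  is_iso f -> is_iso g -> is_iso (g \oc f).
Proof.
move=> [f' [f'f ff']] [g' [g'g gg']]; exists (f' \oc g').
rewrite -compA [g' \oc (g \oc f)]compA g'g comp1m f'f; split=> //.
by rewrite -compA [f \oc (f' \oc g')]compA ff' comp1m gg'.
Qed.

Lemma isomorphic_refl x : isomorphic x x.
Proof. by exists (idm x); apply: is_iso_id. Qed.

Lemma isomorphic_sym x y : isomorphic x y -> isomorphic y x.
Proof. by move=> [f [g [gf fg]]]; exists g, f. Qed.

Lemma isomorphic_trans x y z :
  isomorphic x y -> isomorphic y z -> isomorphic x z.
Proof.
by move=> [f isof] [g isog]; exists (g \oc f); apply: is_iso_comp.
Qed.

Definition isomb : rel {classic C} := fun x y => `[< isomorphic x y >].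
Lemma isomb_equiv : equiv_class_of isomb.
Proof.
split=> [x|x y|y x z]; first by apply/asboolP; apply: isomorphic_refl.
  by apply/asboolP/asboolP; apply: isomorphic_sym.
move=> /asboolP xy /asboolP yz; apply/asboolP.
exact: isomorphic_trans xy yz.
Qed.
Canonical isomb_equivRel := EquivRelPack isomb_equiv.
Canonical isomb_encModRel := defaultEncModRel isomb.

Definition isoc := {eq_quot isomb}.
HB.instance Definition _ := EqQuotient.on isoc.
HB.instance Definition _ := Choice.on isoc.
Definition iclass (x : C) : isoc := \pi_isoc (x : {classic C}).

Lemma iclassP x y : iclass x = iclass y <-> isomorphic x y.
Proof.
rewrite /iclass; split=> [/eqP|xy].
  by rewrite piE => /asboolP.
by apply/eqP; rewrite piE; apply/asboolP.
Qed.

Definition le_isoc (c d : isoc) :=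
  exists x y, [/\ iclass x = c, iclass y = d & inhabited (hom x y)].
Definition lt_isoc c d := le_isoc c d /\ c <> d.

Definition EI_category := forall x (f : hom x x), is_iso f.

Record aut x := AutElt { aut_hom :> hom x x; aut_iso : is_iso aut_hom }.
End Isomorphisms.

Section AutGroup.
Variables (C : category) (x : C).
Implicit Types a b : aut x.

HB.instance Definition _ := gen_eqMixin (aut x).
HB.instance Definition _ := gen_choiceMixin (aut x).

Lemma aut_inj a b : aut_hom a = aut_hom b -> a = b.
Proof.
case: a b => [a ha] [b hb] /= ab.
by rewrite ab in ha *; congr AutElt; apply: Prop_irrelevance.
Qed.

Definition aut_one : aut x := AutElt (is_iso_id x).
Definition aut_mul a b : aut x := AutElt (is_iso_comp (aut_iso b) (aut_iso a)).
Definition aut_inv a : aut x :=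
  let: exist g (conj ga ag) := cid (aut_iso a) in
  AutElt (ex_intro _ (a : hom x x) (conj ag ga)).

Lemma aut_mulA : associative aut_mul.
Proof. by move=> a b c; apply: aut_inj; rewrite /= compA. Qed.
Lemma aut_mul1 : left_id aut_one aut_mul.
Proof. by move=> a; apply: aut_inj; rewrite /= comp1m. Qed.
Lemma aut_1mul : right_id aut_one aut_mul.
Proof. by move=> a; apply: aut_inj; rewrite /= compm1. Qed.
Lemma aut_mulV : left_inverse aut_one aut_inv aut_mul.
Proof.
by move=> a; apply: aut_inj; rewrite /aut_inv; case: cid => g [].
Qed.
Lemma aut_Vmul : right_inverse aut_one aut_inv aut_mul.
Proof.
by move=> a; apply: aut_inj; rewrite /aut_inv; case: cid => g [].
Qed.
HB.instance Definition _ :=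
  isGroup.Build (aut x) aut_mulA aut_mul1 aut_1mul aut_mulV aut_Vmul.
End AutGroup.

(* G as a category with one object: modules over BG G are right QG-modules. *)
Definition BG (G : groupType) : category :=
  @Category unit (fun _ _ => G) (fun _ => 1%g) (fun _ _ _ g h => (g * h)%g)
    (fun _ _ => @mulg1 G) (fun _ _ => @mul1g G) (fun _ _ _ _ => @mulgA G).

Section Modules.
Variable C : category.

(* Contravariant functors from C to Q-vector spaces. *)
Record qmodule := QModule {
  qob :> C -> lmodType rat;
  qact : forall x y, hom x y -> {linear qob y -> qob x};
  qact1 : forall x m, qact (idm x) m = m;
  qactM : forall x y z (f : hom x y) (g : hom y z) m,
    qact (g \oc f) m = qact f (qact g m) }.
Implicit Types M N P : qmodule.

Record qhom M N := QHom {
  qfun :> forall x, {linear M x -> N x};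
  qnat : forall x y (f : hom x y) m, qfun x (qact M f m) = qact N f (qfun y m) }.

Definition qiso M N := exists f : qhom M N, forall x, bijective (f x).

Definition qexact M N P (f : qhom M N) (g : qhom N P) :=
  forall x n, g x n = 0 <-> exists m, f x m = n.

Definition qinjective M N (f : qhom M N) := forall x, injective (f x).
Definition qsurjective M N (f : qhom M N) :=
  forall x n, exists m, f x m = n.

Definition short_exact M N P (f : qhom M N) (g : qhom N P) :=
  [/\ qinjective f, qexact f g & qsurjective g].

Section Sum.
Variables M N : qmodule.
Definition qpair_act x y (f : hom x y) (m : M y * N y) : M x * N x :=
  (qact M f m.1, qact N f m.2).
Lemma qpair_act_linear x y (f : hom x y) : linear (qpair_act f).
Proof. by move=> a [m n] [m' n']; rewrite /qpair_act /= !linearP. Qed.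
HB.instance Definition _ x y (f : hom x y) := GRing.isLinear.Build rat
  (M y * N y)%type (M x * N x)%type _ (qpair_act f) (qpair_act_linear f).
Lemma qpair_act1 x (m : M x * N x) : qpair_act (idm x) m = m.
Proof. by case: m => m n; rewrite /qpair_act !qact1. Qed.
Lemma qpair_actM x y z (f : hom x y) (g : hom y z) (m : M z * N z) :
  qpair_act (g \oc f) m = qpair_act f (qpair_act g m).
Proof. by rewrite /qpair_act !qactM. Qed.
Definition qpair : qmodule := @QModule (fun x => (M x * N x)%type)
  (fun x y f => qpair_act f) qpair_act1 qpair_actM.
End Sum.

Section BigSum.
Variables (I : Type) (M : I -> qmodule).
Definition qsum_act x y (f : hom x y) :
    {linear dsum (fun i => M i y) -> dsum (fun i => M i x)} :=
  dmap (fun i => qact (M i) f).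
Lemma qsum_act1 x m : qsum_act (idm x) m = m.
Proof.
apply: (@dsum_ext _ _ _ _ (qsum_act (idm x)) idfun) => i {}m.
by rewrite dmap_in qact1.
Qed.
Lemma qsum_actM x y z (f : hom x y) (g : hom y z) m :
  qsum_act (g \oc f) m = qsum_act f (qsum_act g m).
Proof.
apply: (@dsum_ext _ _ _ _ _ (qsum_act f \o qsum_act g)) => i {}m /=.
by rewrite !dmap_in qactM.
Qed.
Definition qsum : qmodule := QModule qsum_act1 qsum_actM.
End BigSum.
End Modules.

Section Bisets.
Variables (G : groupType) (C : category).

(* Contravariant functors from C to left G-sets. For C = BG H these are the
   G-H-bisets. *)
Record biset := Biset {
  bset :> C -> Type;
  blact : forall x, G -> bset x -> bset x;
  bract : forall x y, hom x y -> bset y -> bset x;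
  blact1 : forall x b, @blact x 1%g b = b;
  blactM : forall x g h b, @blact x (g * h)%g b = blact g (blact h b);
  bract1 : forall x b, bract (idm x) b = b;
  bractM : forall x y z (f : hom x y) (g : hom y z) b,
    bract (g \oc f) b = bract f (bract g b);
  blractC : forall x y (f : hom x y) g b,
    bract f (blact g b) = blact g (bract f b) }.

Arguments blact _ {x} _ _.
Arguments bract _ {x y} _ _.

Variable X : biset.

(* blin X is the right QC-module Q[X]; tensb X N is its tensor product
   N (x)_{QG} Q[X], for N a right QG-module. *)
Definition blin_act x y (f : hom x y) :
  {linear freemod rat (X y) -> freemod rat (X x)} := freemap rat (bract X f).
Lemma blin_act1 x m : blin_act (idm x) m = m.
Proof. by rewrite /blin_act freemap_id// => b; rewrite bract1. Qed.
Lemma blin_actM x y z (f : hom x y) (g : hom y z) m :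
  blin_act (g \oc f) m = blin_act f (blin_act g m).
Proof.
rewrite /blin_act (@freemap_comp _ _ _ _ (bract X g) (bract X f))// => b.
by rewrite bractM.
Qed.
Definition blin : qmodule C := QModule blin_act1 blin_actM.

Variable N : qmodule (BG G).
Definition gact (n : N tt) (g : G) : N tt := @qact _ N tt tt g n.
Definition btens x : lmodType rat :=
  tens gact (fun g => freemap rat (@blact X x g)).

Lemma btens_subproof x y (f : hom x y) g (b : freemod rat (X y)) :
  blin_act f (freemap rat (@blact X y g) b) = freemap rat (@blact X x g) (blin_act f b).
Proof.
rewrite /blin_act -[LHS]/((_ \o _) b) -[RHS]/((_ \o _) b).
pose h := fun b => bract X f (blact X g b).
by rewrite -!(@freemap_comp _ _ _ _ _ _ h)// => b'; rewrite /h /= blractC.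
Qed.
Definition btens_act x y (f : hom x y) : {linear btens y -> btens x} :=
  @tmap rat G (N tt) _ (N tt) _ _ _ _ _ idfun (blin_act f)
    (fun _ _ => erefl) (btens_subproof f).
Lemma btens_act1 x m : btens_act (idm x) m = m.
Proof.
apply: (@tens_ext _ _ _ _ _ _ _ (btens_act (idm x)) idfun) => a b.
by rewrite [LHS]tmap_ten blin_act1.
Qed.
Lemma btens_actM x y z (f : hom x y) (g : hom y z) m :
  btens_act (g \oc f) m = btens_act f (btens_act g m).
Proof.
apply: (@tens_ext _ _ _ _ _ _ _ _ (btens_act f \o btens_act g)) => a b /=.
by rewrite /btens_act !tmap_ten blin_actM.
Qed.
Definition tensb : qmodule C := QModule btens_act1 btens_actM.
End Bisets.

Arguments tensb {G C} X N.
Arguments blact {G C} _ {x} _ _.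
Arguments bract {G C} _ {x y} _ _.

Section BisetProduct.
Variables (A G : groupType) (C : category).
Variables (X : biset A (BG G)) (Y : biset G C).

Definition rgact (a : X tt) (g : G) : X tt := @bract A (BG G) X tt tt g a.

(* X x_G Y, the quotient of X x Y by (x g, y) ~ (x, g y). *)
Definition bp_rel (z : C) : rel {classic X tt * Y z} := fun p q =>
  `[< exists g : G, p.1 = rgact q.1 g /\ q.2 = blact Y g p.2 >].

Lemma bp_rel_equiv z : equiv_class_of (@bp_rel z).
Proof.
have rgactM a g h : rgact a (g * h)%g = rgact (rgact a g) h.
  exact: (@bractM _ _ X tt tt tt).
have rgact1 a : rgact a 1%g = a by exact: (@bract1 _ _ X tt).
have sym (p q : {classic X tt * Y z}) : bp_rel p q -> bp_rel q p.
  move=> /asboolP [g [p1 q2]]; apply/asboolP; exists g^-1%g.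
  by rewrite p1 -rgactM mulgV rgact1 q2 -blactM mulVg blact1.
split=> [p|p q|q p r].
- by apply/asboolP; exists 1%g; rewrite rgact1 blact1.
- by apply/idP/idP; apply: sym.
move=> /asboolP [g [p1 q2]] /asboolP [h [q1 r2]]; apply/asboolP.
by exists (h * g)%g; rewrite rgactM -q1 -p1 blactM -q2 -r2.
Qed.
Canonical bp_equivRel z := EquivRelPack (bp_rel_equiv z).
Canonical bp_encModRel z := defaultEncModRel (@bp_rel z).

Definition bp_set (z : C) : Type := {eq_quot (@bp_rel z)}.
Definition bp_pair z (a : X tt) (b : Y z) : bp_set z :=
  \pi_({eq_quot (@bp_rel z)}) ((a, b) : {classic X tt * Y z}).

Lemma bp_pairP z a b a' b' : @bp_pair z a b = bp_pair a' b' <->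
  exists g : G, a = rgact a' g /\ b' = blact Y g b.
Proof.
split=> [/eqP|h]; first by rewrite /bp_pair piE => /asboolP.
by apply/eqP; rewrite /bp_pair piE; apply/asboolP.
Qed.

Lemma bp_ind z (P : bp_set z -> Prop) :
  (forall a b, P (bp_pair a b)) -> forall p, P p.
Proof. by move=> H p; rewrite -[p]reprK; case: (repr p) => a b; apply: H. Qed.

Definition bp_lact z (h : A) (p : bp_set z) : bp_set z :=
  bp_pair (blact X h (repr p).1) (repr p).2.
Definition bp_ract z w (f : hom z w) (p : bp_set w) : bp_set z :=
  bp_pair (repr p).1 (bract Y f (repr p).2).

Lemma bp_repr z (p : bp_set z) : p = bp_pair (repr p).1 (repr p).2.
Proof. by rewrite -[LHS]reprK; case: (repr p). Qed.

Lemma bp_lactE z h a b : bp_lact h (@bp_pair z a b) = bp_pair (blact X h a) b.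
Proof.
rewrite /bp_lact; apply/bp_pairP.
have /bp_pairP [g [e1 e2]] := esym (bp_repr (bp_pair a b)).
by exists g; rewrite e1 [RHS](@blractC A (BG G) X tt tt g h).
Qed.

Lemma bp_ractE z w (f : hom z w) a b :
  bp_ract f (bp_pair a b) = bp_pair a (bract Y f b).
Proof.
rewrite /bp_ract; apply/bp_pairP.
have /bp_pairP [g [e1 e2]] := esym (bp_repr (bp_pair a b)).
exists g; split; first exact: e1.
by rewrite -blractC -e2.
Qed.

Lemma bp_lact1 z p : @bp_lact z 1%g p = p.
Proof. by elim/bp_ind: p => a b; rewrite bp_lactE blact1. Qed.
Lemma bp_lactM z g h p : @bp_lact z (g * h)%g p = bp_lact g (bp_lact h p).
Proof. by elim/bp_ind: p => a b; rewrite !bp_lactE blactM. Qed.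
Lemma bp_ract1 z p : bp_ract (idm z) p = p.
Proof. by elim/bp_ind: p => a b; rewrite bp_ractE bract1. Qed.
Lemma bp_ractM x y z (f : hom x y) (g : hom y z) p :
  bp_ract (g \oc f) p = bp_ract f (bp_ract g p).
Proof. by elim/bp_ind: p => a b; rewrite !bp_ractE bractM. Qed.
Lemma bp_lractC z w (f : hom z w) h p :
  bp_ract f (bp_lact h p) = bp_lact h (bp_ract f p).
Proof. by elim/bp_ind: p => a b; rewrite !(bp_lactE, bp_ractE). Qed.

Definition bprod : biset A C :=
  Biset bp_lact1 bp_lactM bp_ract1 bp_ractM bp_lractC.
End BisetProduct.

Section RepresentableModules.
Variable C : category.

(* brep x is mor(?, x), with its left aut(x)-action. *)
Definition brep_lact (x y : C) (a : aut x) (f : hom y x) : hom y x := a \oc f.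
Definition brep (x : C) : biset (aut x) C :=
  @Biset (aut x) C (fun y => hom y x) (@brep_lact x)
    (fun _ _ u f => f \oc u)
    (fun _ f => comp1m f) (fun _ a b f => esym (compA a b f))
    (fun _ f => compm1 f) (fun _ _ _ u v f => compA f v u)
    (fun _ _ u a f => esym (compA a f u)).

Definition qrep (x : C) : qmodule C := blin (brep x).

Definition qres (M : qmodule C) (x : C) : qmodule (BG (aut x)) :=
  @QModule (BG (aut x)) (fun=> M x) (fun _ _ (a : aut x) => qact M a)
    (fun=> @qact1 C M x) (fun _ _ _ (a b : aut x) => @qactM C M x x x a b).

Definition bres (G : groupType) (X : biset G C) (y : C) : biset G (BG (aut y)) :=
  @Biset G (BG (aut y)) (fun=> X y) (fun=> @blact G C X y)
    (fun _ _ (a : aut y) => bract X a)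
    (fun=> @blact1 G C X y) (fun=> @blactM G C X y) (fun=> @bract1 G C X y)
    (fun _ _ _ (a b : aut y) => @bractM G C X y y y a b)
    (fun _ _ (a : aut y) => @blractC G C X y y a).

Definition bmor (y x : C) : biset (aut x) (BG (aut y)) := bres (brep x) y.

Definition fgfree n (s : 'I_n -> C) : qmodule C := qsum (fun i => qrep (s i)).

Definition fgproj (P : qmodule C) :=
  exists n (s : 'I_n -> C) (Q : qmodule C), qiso (qpair P Q) (fgfree s).
End RepresentableModules.

Section GrothendieckGroup.
Variable C : category.

(* The f.g. projective modules form a proper class. Up to isomorphism they are
   the images of the idempotent endomorphisms of the modules fgfree s, which
   form a set; these are the generators of K0. Isomorphic modules have the same
   class because isomorphisms are short exact sequences with one zero term. *)
Record projector := Projector {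
  pr_rank : nat;
  pr_obj : 'I_pr_rank -> C;
  pr_map : qhom (fgfree pr_obj) (fgfree pr_obj);
  pr_idem : forall x m, pr_map x (pr_map x m) = pr_map x m }.

Definition image_of (e : projector) (P : qmodule C) :=
  exists (i : qhom P (fgfree (@pr_obj e))) (r : qhom (fgfree (@pr_obj e)) P),
    forall x, (forall p, r x (i x p) = p) /\ (forall m, i x (r x m) = pr_map e x m).

Inductive K0_rel : freemod int projector -> Prop :=
| K0Rel e' e e'' P' P P'' (f : qhom P' P) (g : qhom P P'') of
    image_of e' P' & image_of e P & image_of e'' P'' & short_exact f g :
    K0_rel (fbasis int e - (fbasis int e' + fbasis int e'')).

Definition K0 : lmodType int := lquot K0_rel.

(* The class [P] of a f.g. projective module P (0 if P is not such). *)
Definition K0cl (P : qmodule C) : K0 := xget 0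
  [set k | exists2 e, image_of e P & k = lpi K0_rel (fbasis int e)].

(* M has a finite resolution by f.g. projective modules, and k is the
   alternating sum of the classes of one such resolution. *)
Definition resolution_class (M : qmodule C) (k : K0) :=
  exists d (P : nat -> qmodule C) (del : forall n, qhom (P n.+1) (P n))
      (eps : qhom (P 0%N) M),
    [/\ [/\ forall n, fgproj (P n),
            forall n, (d < n)%N -> forall x (p : P n x), p = 0,
            qsurjective eps,
            qexact (del 0%N) eps &
            forall n, qexact (del n.+1) (del n)] &
        k = \sum_(n < d.+1) (-1) ^+ n *: K0cl (P n)].
End GrothendieckGroup.

Section SplittingFunctors.
Variable C : category.

Section S.
Variables (M : qmodule C) (x : C).

Definition Sgen : set (M x) :=
  [set m | exists y (u : hom x y) (m' : M y), ~ is_iso u /\ m = qact M u m'].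

Definition Sact_free (a : aut x) : {linear M x -> lquot Sgen} :=
  lpi Sgen \o qact M a.

Lemma Sact_subproof (a : aut x) m : Sgen m -> Sact_free a m = 0.
Proof.
move=> [y [u [m' [nu ->]]]]; rewrite -(linear0 (lpi Sgen)); apply/lpiP.
rewrite subr0; apply: lspan_sub; exists y, (u \oc a), m'; split; last by rewrite qactM.
move=> ua; apply: nu; have [b [ba ab]] := aut_iso a.
have -> : u = (u \oc a) \oc b by rewrite -compA ab compm1.
by apply: is_iso_comp => //; exists a.
Qed.

Definition Sact (a : aut x) : {linear lquot Sgen -> lquot Sgen} :=
  lqlift (@Sact_subproof a).

Lemma Sact_pi a m : Sact a (lpi Sgen m) = lpi Sgen (qact M a m).
Proof. exact: lqlift_pi. Qed.
Lemma Sact1 m : Sact 1%g m = m.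
Proof.
apply: (@lquot_ext _ _ _ _ (Sact 1%g) idfun) => {}m.
by rewrite Sact_pi qact1.
Qed.
Lemma SactM (a b : aut x) m : Sact (b * a)%g m = Sact a (Sact b m).
Proof.
apply: (@lquot_ext _ _ _ _ _ (Sact a \o Sact b)) => {}m.
by rewrite -[RHS]/(Sact a (Sact b _)) !Sact_pi qactM.
Qed.

Definition Smod : qmodule (BG (aut x)) :=
  @QModule (BG (aut x)) (fun=> lquot Sgen) (fun _ _ => Sact)
    (fun=> Sact1) (fun _ _ _ => SactM).
End S.

Definition Emod (x : C) (N : qmodule (BG (aut x))) : qmodule C :=
  tensb (brep x) N.

Section I.
Hypothesis EI : EI_category C.
Variables (x : C) (N : qmodule (BG (aut x))).

(* The functoriality of I_x N (lemma IactM) uses that C is an EI-category. *)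
Definition Iob (y : C) : lmodType rat :=
  if pselect (isomorphic y x) then Emod N y else 'rV[rat]_0.

Definition Iact y z (f : hom y z) : {linear Iob z -> Iob y} :=
  match pselect (isomorphic y x) as yx, pselect (isomorphic z x) as zx
    return {linear (if zx then Emod N z else 'rV[rat]_0 : lmodType rat) ->
                   (if yx then Emod N y else 'rV[rat]_0 : lmodType rat)}
  with
  | left _, left _ => qact (Emod N) f
  | _, _ => \0
  end.

Lemma Iact1 y m : Iact (idm y) m = m.
Proof.
rewrite /Iact; move: m; rewrite /Iob; case: pselect => yx m; first exact: qact1.
by apply/rowP => -[].
Qed.

Lemma Iact_iso y z w (f : hom y z) (g : hom z w) :
  isomorphic y x -> isomorphic w x -> isomorphic z x.
Proof.
move=> yx wx; apply: (isomorphic_trans _ wx).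
have [h _] := isomorphic_trans wx (isomorphic_sym yx).
have [k [_ gk]] := EI (g \oc (f \oc h)).
have [l [lg _]] := EI ((f \oc h) \oc g).
rewrite -compA in gk; rewrite compA in lg.
have e : (f \oc h) \oc k = l \oc (f \oc h).
  by rewrite -[LHS]comp1m -{1}lg -compA gk compm1.
by exists g, ((f \oc h) \oc k); rewrite gk e lg.
Qed.

Lemma IactM y z w (f : hom y z) (g : hom z w) m :
  Iact (g \oc f) m = Iact f (Iact g m).
Proof.
have H := @Iact_iso y z w f g.
rewrite /Iact; move: m; rewrite /Iob.
case: (pselect (isomorphic w x)) => wx m; last first.
  by case: (pselect (isomorphic y x)) => yx; case: (pselect (isomorphic z x)) => zx;
    rewrite /= ?linear0.
case: (pselect (isomorphic y x)) => yx; last by case: pselect.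
case: (pselect (isomorphic z x)) => [zx|[]]; first exact: qactM.
exact: H.
Qed.

Definition Imod : qmodule C := QModule Iact1 IactM.
End I.
End SplittingFunctors.

(* A (x)_Z Q. *)
Definition tensZQ (A : lmodType int) : lmodType int :=
  @tens int void A (zmodule rat) (fun a _ => a) (fun _ q => q).
Definition tenQ (A : lmodType int) (a : A) (q : rat) : tensZQ A :=
  @ten int void A (zmodule rat) (fun a _ => a) (fun _ q => q) a q.

Section ConditionI.
Variable G : groupType.

Record finsubgrp := FinSubgrp {
  fsg_set : set G;
  fsg_one : fsg_set 1%g;
  fsg_mul : forall g h, fsg_set g -> fsg_set h -> fsg_set (g * h)%g;
  fsg_inv : forall g, fsg_set g -> fsg_set g^-1%g;
  fsg_finite : finite_set fsg_set }.

Section SubgroupGroup.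
Variable H : finsubgrp.

Record fsg_elt := FsgElt { fsg_val :> G; fsg_valP : fsg_set H fsg_val }.
HB.instance Definition _ := gen_eqMixin fsg_elt.
HB.instance Definition _ := gen_choiceMixin fsg_elt.

Lemma fsg_val_inj (a b : fsg_elt) : fsg_val a = fsg_val b -> a = b.
Proof.
case: a b => [a ha] [b hb] /= ab.
by rewrite ab in ha *; congr FsgElt; apply: Prop_irrelevance.
Qed.

Definition fsg_elt1 := FsgElt (fsg_one H).
Definition fsg_eltM a b := FsgElt (fsg_mul (fsg_valP a) (fsg_valP b)).
Definition fsg_eltV a := FsgElt (fsg_inv (fsg_valP a)).

Lemma fsg_mulA : associative fsg_eltM.
Proof. by move=> a b c; apply: fsg_val_inj; rewrite /= mulgA. Qed.
Lemma fsg_mul1g : left_id fsg_elt1 fsg_eltM.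
Proof. by move=> a; apply: fsg_val_inj; rewrite /= mul1g. Qed.
Lemma fsg_mulg1 : right_id fsg_elt1 fsg_eltM.
Proof. by move=> a; apply: fsg_val_inj; rewrite /= mulg1. Qed.
Lemma fsg_mulVg : left_inverse fsg_elt1 fsg_eltV fsg_eltM.
Proof. by move=> a; apply: fsg_val_inj; rewrite /= mulVg. Qed.
Lemma fsg_mulgV : right_inverse fsg_elt1 fsg_eltV fsg_eltM.
Proof. by move=> a; apply: fsg_val_inj; rewrite /= mulgV. Qed.
HB.instance Definition _ := isGroup.Build fsg_elt
  fsg_mulA fsg_mul1g fsg_mulg1 fsg_mulVg fsg_mulgV.

(* G as an H-G-biset: tensb bincl P is P (x)_{QH} QG. *)
Definition bincl : biset fsg_elt (BG G) :=
  @Biset fsg_elt (BG G) (fun=> G) (fun _ h g => (fsg_val h * g)%g)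
    (fun _ _ k g => (g * k)%g)
    (fun=> @mul1g G) (fun _ h k g => esym (mulgA (h : G) (k : G) g))
    (fun=> @mulg1 G) (fun _ _ _ k l g => mulgA g l k)
    (fun _ _ k h g => esym (mulgA (h : G) g k)).
End SubgroupGroup.

(* phi is determined by its values on the elements [P] (x) q of the summands,
   and it always exists; only its surjectivity is a condition on G. *)
Definition condition_I :=
  exists phi : {additive dsum (fun H : finsubgrp => tensZQ (K0 (BG (fsg_elt H))))
                         -> tensZQ (K0 (BG G))},
    (forall (H : finsubgrp) (P : qmodule (BG (fsg_elt H))) (q : rat), fgproj P ->
       phi (din (fun H : finsubgrp => tensZQ (K0 (BG (fsg_elt H)))) H
              (tenQ (K0cl P) q))
       = tenQ (K0cl (tensb (bincl H) P)) q) /\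
    (forall k, exists t, phi t = k).
End ConditionI.

Section Conditions.
Variable C : category.

Definition quasi_finite :=
  [/\ forall d : isoc C, finite_set [set c | le_isoc c d],
      forall (x y : C) (f : hom x y), finite_set [set a : aut x | f \oc a = f] &
      forall x y : C, finite_set
        [set [set f \oc (a : aut x) | a in [set: aut x]] | f in [set: hom x y]]].

Definition free_category :=
  forall (x y : C) (a : aut y) (f : hom x y), a \oc f = f -> a = 1%g.

Definition category_condition_I := forall x : C, condition_I (aut x).
End Conditions.

Section Chains.
Variables (C : category) (rep : isoc C -> C).

(* ichain l y x is the set ch_l(y, x) of chains y = x_0 < ... < x_l = x. *)
Inductive ichain : nat -> isoc C -> isoc C -> Type :=
| ChainNil x : ichain 0 x x
| ChainCons l y z x of lt_isoc y z & ichain l z x : ichain l.+1 y x.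

Fixpoint chain_biset l y x (c : ichain l y x) :
    biset (aut (rep x)) (BG (aut (rep y))) :=
  match c in ichain _ y x return biset (aut (rep x)) (BG (aut (rep y))) with
  | ChainNil x => bmor (rep x) (rep x)
  | ChainCons l y z x _ c' =>
    match c' in ichain _ z x return
      biset (aut (rep x)) (BG (aut (rep z))) ->
      biset (aut (rep x)) (BG (aut (rep y)))
    with
    | ChainNil z => fun=> bmor (rep y) (rep z)
    | ChainCons _ z _ _ _ _ => fun X => bprod X (bmor (rep y) (rep z))
    end (chain_biset c')
  end.

Definition splitK0 : lmodType int := dsum (fun x : isoc C => K0 (BG (aut (rep x)))).
(* The inclusion of the summand indexed by x. *)
Definition Kin (x : isoc C) (k : K0 (BG (aut (rep x)))) : splitK0 :=
  din (fun x : isoc C => K0 (BG (aut (rep x)))) x k.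
End Chains.

Section SquareNorm.
Variable R : realType.
Implicit Types z w : R[i].

Definition sqnorm z : R := complex.Re z ^+ 2 + complex.Im z ^+ 2.

Lemma sqnorm_ge0 z : 0 <= sqnorm z.
Proof. by rewrite addr_ge0 ?sqr_ge0. Qed.

Lemma sqnormN z : sqnorm (- z) = sqnorm z.
Proof. by case: z => a b; rewrite /sqnorm /= !sqrrN. Qed.

Lemma sqnormD z w : sqnorm (z + w) <= sqnorm z + sqnorm z + (sqnorm w + sqnorm w).
Proof.
case: z w => [a b] [c d]; rewrite /sqnorm /=.
have := sqr_ge0 (a - c); have := sqr_ge0 (b - d); nra.
Qed.

Lemma sqnormM z w : sqnorm (z * w) = sqnorm z * sqnorm w.
Proof. by case: z w => [a b] [c d]; rewrite /sqnorm /=; ring. Qed.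
End SquareNorm.

Section EllTwo.
Variables (R : realType) (G : groupType).
Implicit Types f : G -> R[i].

Definition l2sq f : \bar R := (\esum_(g in [set: G]) (sqnorm (f g))%:E)%E.

Lemma l2sq_ge0 f : (0 <= l2sq f)%E.
Proof. by apply: esum_ge0 => g _; rewrite lee_fin sqnorm_ge0. Qed.

Lemma l2sqN f : l2sq (- f) = l2sq f.
Proof. by apply: eq_esum => g _; rewrite -sqnormN opprK. Qed.

Lemma l2sqD f (h : G -> R[i]) : (l2sq (f + h)%R <= l2sq f + l2sq f + (l2sq h + l2sq h))%E.
Proof.
have ge0 k (g : G) : [set: G] g -> (0 <= (sqnorm (k g : R[i]))%:E)%E.
  by rewrite lee_fin sqnorm_ge0.
rewrite -!esumD//; [|by move=> g _; rewrite ?adde_ge0 ?ge0..].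
by apply: le_esum => g _; rewrite -!EFinD lee_fin sqnormD.
Qed.

Lemma l2sqZ (c : R[i]) f : (l2sq (fun g => c * f g)%R <= (sqnorm c)%:E * l2sq f)%E.
Proof.
rewrite /l2sq; apply: ub_ereal_sup => _ [X [finX _] <-].
have -> : (\sum_(g \in X) (sqnorm (c * f g)%R)%:E =
    (sqnorm c)%:E * \sum_(g \in X) (sqnorm (f g))%:E)%E.
  rewrite !fsbig_finite//= !sumEFin -EFinM mulr_sumr; congr _%:E.
  by apply: eq_bigr => g _; rewrite sqnormM.
apply: lee_wpmul2l; first by rewrite lee_fin sqnorm_ge0.
by apply: esum_ge; exists X.
Qed.

(* The Hilbert space of square-summable functions on G. *)
Definition l2 : {pred G -> R[i]} := [pred f | (l2sq f < +oo)%E].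

Lemma l2_submod_closed : submod_closed l2.
Proof.
split=> [|a u v].
  rewrite inE /l2sq esum1 ?ltry// => g _.
  by rewrite /sqnorm /= expr0n /= addr0.
rewrite !inE => u2 v2; apply: (le_lt_trans (l2sqD _ _)).
have au2 : (l2sq (a *: u)%R < +oo)%E.
  apply: (le_lt_trans (l2sqZ _ _)).
  have fu : l2sq u \is a fin_num by rewrite ge0_fin_numE ?l2sq_ge0.
  by rewrite -(fineK fu) -EFinM ltry.
by rewrite !lte_add_pinfty.
Qed.
HB.instance Definition _ :=
  GRing.isSubmodClosed.Build R[i] (G -> R[i]) l2 l2_submod_closed.

Record ell2 := Ell2 { ell2_fun :> G -> R[i]; _ : ell2_fun \in l2 }.
HB.instance Definition _ := [isSub for ell2_fun].
HB.instance Definition _ := [Choice of ell2 by <:].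
HB.instance Definition _ := [SubChoice_isSubLmodule of ell2 by <:].

Lemma ell2P (u v : ell2) : u =1 v -> u = v.
Proof. by move=> uv; apply/val_inj/funext. Qed.

Lemma l2sq_reindex (e : G -> G) f : bijective e -> l2sq (f \o e) = l2sq f.
Proof.
by move=> be; apply/esym/reindex_esum; rewrite setTT_bijective.
Qed.

Lemma mulgr_bij (g : G) : bijective (fun h : G => (h * g)%g).
Proof. by exists (fun h => (h * g^-1)%g) => h; rewrite -mulgA ?mulgV ?mulVg mulg1. Qed.
Lemma mulgl_bij (g : G) : bijective (fun h : G => (g * h)%g).
Proof. by exists (fun h => (g^-1 * h)%g) => h; rewrite mulgA ?mulgV ?mulVg mul1g. Qed.

Lemma ltrans_subproof (g : G) (u : ell2) : u \o (fun h => (g^-1 * h)%g) \in l2.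
Proof. by rewrite inE (l2sq_reindex _ (mulgl_bij _)); apply: (valP u). Qed.
Definition ltrans (g : G) (u : ell2) : ell2 := Ell2 (ltrans_subproof g u).

Lemma rtrans_subproof (g : G) (u : ell2) : u \o (fun h => (h * g)%g) \in l2.
Proof. by rewrite inE (l2sq_reindex _ (mulgr_bij _)); apply: (valP u). Qed.
Definition rtrans (g : G) (u : ell2) : ell2 := Ell2 (rtrans_subproof g u).

Lemma l2_unit_subproof : (fun g : G => (g == 1%g)%:R : R[i]) \in l2.
Proof.
rewrite inE.
have -> : l2sq (fun g : G => (g == 1%g)%:R : R[i]) = (\esum_(g in [set 1%g : G]) 1%:E)%E.
  rewrite [RHS]esum_mkcond; apply: eq_esum => g _.
  rewrite (_ : (g \in [set 1%g]) = (g == 1%g)); last first.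
    by apply/idP/idP; rewrite inE => /eqP.
  case: (g == 1%g); rewrite /sqnorm /= ?expr0n ?expr1n ?addr0//.
by rewrite esum_set1// ltry.
Qed.
Definition l2_unit : ell2 := Ell2 l2_unit_subproof.

(* The group von Neumann algebra: the bounded operators on l^2(G) that commute
   with the left translations by elements of G. *)
Record vN := VN {
  vN_op :> ell2 -> ell2;
  vN_linear : linear vN_op;
  vN_bounded : exists2 c : R, 0 <= c &
    forall u, (l2sq (vN_op u) <= c%:E * l2sq u)%E;
  vN_equivariant : forall g u, vN_op (ltrans g u) = ltrans g (vN_op u) }.

HB.instance Definition _ := gen_eqMixin vN.
HB.instance Definition _ := gen_choiceMixin vN.

Implicit Types (a b c : vN) (u : ell2).

Lemma vNP a b : a =1 b -> a = b.
Proof.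
case: a b => [a la ba ea] [b lb bb eb] /= /funext ab.
by rewrite ab in la ba ea *; congr VN; apply: Prop_irrelevance.
Qed.

Lemma ltrans_linear g : linear (ltrans g).
Proof. by move=> z u v; apply: ell2P. Qed.

Lemma vN0_subproof : [/\ linear (fun _ : ell2 => 0 : ell2),
  exists2 c : R, 0 <= c & forall u : ell2, (l2sq (0%R : ell2) <= c%:E * l2sq u)%E &
  forall g (u : ell2), 0 = ltrans g (0 : ell2)].
Proof.
split=> [z u v||g u]; first by rewrite scaler0 addr0.
- exists 0 => // u; rewrite mul0e /l2sq esum1// => g _.
  by rewrite /sqnorm /= expr0n /= addr0.
- exact: ell2P.
Qed.
Definition vN0 := let: And3 l b e := vN0_subproof in VN l b e.

Lemma vN1_subproof : [/\ linear (@id ell2),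
  exists2 c : R, 0 <= c & forall u : ell2, (l2sq u <= c%:E * l2sq u)%E &
  forall g (u : ell2), ltrans g u = ltrans g u].
Proof. by split=> //; exists 1 => // u; rewrite mul1e. Qed.
Definition vN1 := let: And3 l b e := vN1_subproof in VN l b e.

Lemma vNN_subproof a : [/\ linear (fun u => - a u),
  exists2 c : R, 0 <= c & forall u : ell2, (l2sq (- a u)%R <= c%:E * l2sq u)%E &
  forall g (u : ell2), - a (ltrans g u) = ltrans g (- a u)].
Proof.
split=> [z u v||g u].
- by rewrite vN_linear opprD scalerN.
- by have [c c0 ac] := vN_bounded a; exists c => // u; rewrite l2sqN.
- by rewrite vN_equivariant; apply: ell2P.
Qed.
Definition vNN a := let: And3 l b e := vNN_subproof a in VN l b e.

Lemma vND_subproof a b : [/\ linear (fun u => a u + b u),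
  exists2 c : R, 0 <= c & forall u : ell2, (l2sq (a u + b u)%R <= c%:E * l2sq u)%E &
  forall g (u : ell2), a (ltrans g u) + b (ltrans g u) = ltrans g (a u + b u)].
Proof.
split=> [z u v||g u].
- by rewrite !vN_linear scalerDr addrACA.
- have [c c0 ac] := vN_bounded a; have [d d0 bd] := vN_bounded b.
  exists (c + c + (d + d)) => [|u]; first by rewrite !addr_ge0.
  apply: (le_trans (l2sqD _ _)).
  by rewrite !EFinD !ge0_muleDl ?lee_fin ?addr_ge0// !leeD.
- by rewrite !vN_equivariant; apply: ell2P.
Qed.
Definition vND a b := let: And3 l bd e := vND_subproof a b in VN l bd e.

Lemma vNM_subproof a b : [/\ linear (fun u => a (b u)),
  exists2 c : R, 0 <= c & forall u : ell2, (l2sq (a (b u)) <= c%:E * l2sq u)%E &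
  forall g (u : ell2), a (b (ltrans g u)) = ltrans g (a (b u))].
Proof.
split=> [z u v||g u].
- by rewrite !vN_linear.
- have [c c0 ac] := vN_bounded a; have [d d0 bd] := vN_bounded b.
  exists (c * d) => [|u]; first by rewrite mulr_ge0.
  apply: (le_trans (ac _)); rewrite EFinM -muleA.
  by apply: lee_wpmul2l; rewrite ?lee_fin.
- by rewrite !vN_equivariant.
Qed.
Definition vNM a b := let: And3 l bd e := vNM_subproof a b in VN l bd e.

Lemma vNZ_subproof (q : rat) a : [/\ linear (fun u => (ratr q : R[i]) *: a u),
  exists2 c : R, 0 <= c &
    forall u : ell2, (l2sq ((ratr q : R[i]) *: a u)%R <= c%:E * l2sq u)%E &
  forall g (u : ell2), (ratr q : R[i]) *: a (ltrans g u) =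
    ltrans g ((ratr q : R[i]) *: a u)].
Proof.
split=> [z u v||g u].
- by rewrite vN_linear scalerDr !scalerA mulrC.
- have [c c0 ac] := vN_bounded a.
  exists (sqnorm (ratr q : R[i]) * c) => [|u]; first by rewrite mulr_ge0 ?sqnorm_ge0.
  apply: (le_trans (l2sqZ _ _)); rewrite EFinM -muleA.
  by apply: lee_wpmul2l; rewrite ?lee_fin ?sqnorm_ge0.
- by rewrite vN_equivariant; apply: ell2P.
Qed.
Definition vNZ q a := let: And3 l bd e := vNZ_subproof q a in VN l bd e.

Lemma vN0E u : vN0 u = 0. Proof. by rewrite /vN0; case: vN0_subproof. Qed.
Lemma vN1E u : vN1 u = u. Proof. by rewrite /vN1; case: vN1_subproof. Qed.
Lemma vNNE a u : vNN a u = - a u.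
Proof. by rewrite /vNN; case: vNN_subproof. Qed.
Lemma vNDE a b u : vND a b u = a u + b u.
Proof. by rewrite /vND; case: vND_subproof. Qed.
Lemma vNME a b u : vNM a b u = a (b u).
Proof. by rewrite /vNM; case: vNM_subproof. Qed.
Lemma vNZE q a u : vNZ q a u = (ratr q : R[i]) *: a u.
Proof. by rewrite /vNZ; case: vNZ_subproof. Qed.

Lemma vN_addA : associative vND.
Proof. by move=> a b c; apply: vNP => u; rewrite !vNDE addrA. Qed.
Lemma vN_addC : commutative vND.
Proof. by move=> a b; apply: vNP => u; rewrite !vNDE addrC. Qed.
Lemma vN_add0 : left_id vN0 vND.
Proof. by move=> a; apply: vNP => u; rewrite !vNDE vN0E add0r. Qed.
Lemma vN_addN : left_inverse vN0 vNN vND.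
Proof. by move=> a; apply: vNP => u; rewrite vNDE vNNE vN0E addNr. Qed.
HB.instance Definition _ :=
  GRing.isZmodule.Build vN vN_addA vN_addC vN_add0 vN_addN.

Lemma vN_mulA : associative vNM.
Proof. by move=> a b c; apply: vNP => u; rewrite !vNME. Qed.
Lemma vN_mul1 : left_id vN1 vNM.
Proof. by move=> a; apply: vNP => u; rewrite !vNME vN1E. Qed.
Lemma vN_1mul : right_id vN1 vNM.
Proof. by move=> a; apply: vNP => u; rewrite !vNME vN1E. Qed.
Lemma vN_mulDl : left_distributive vNM +%R.
Proof. by move=> a b c; apply: vNP => u; rewrite !vNME /+%R /= !vNDE !vNME. Qed.
Lemma vN_mulDr : right_distributive vNM +%R.
Proof.
move=> a b c; apply: vNP => u; rewrite vNME /+%R /= !vNDE !vNME.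
by rewrite -[b u]scale1r vN_linear !scale1r.
Qed.
HB.instance Definition _ := GRing.Zmodule_isPzRing.Build vN
  vN_mulA vN_mul1 vN_1mul vN_mulDl vN_mulDr.

Lemma vN_scaleA p q a : vNZ p (vNZ q a) = vNZ (p * q) a.
Proof. by apply: vNP => u; rewrite !vNZE scalerA rmorphM. Qed.
Lemma vN_scale1 : left_id 1 vNZ.
Proof. by move=> a; apply: vNP => u; rewrite vNZE rmorph1 scale1r. Qed.
Lemma vN_scaleDr : right_distributive vNZ +%R.
Proof. by move=> q a b; apply: vNP => u; rewrite vNZE /+%R /= !vNDE !vNZE scalerDr. Qed.
Lemma vN_scaleDl a : {morph vNZ^~ a : p q / p + q}.
Proof. by move=> p q; apply: vNP => u; rewrite vNZE rmorphD scalerDl [RHS]vNDE !vNZE. Qed.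
HB.instance Definition _ := GRing.Zmodule_isLmodule.Build rat vN
  vN_scaleA vN_scale1 vN_scaleDr vN_scaleDl.

(* <a(e), e>, where e is the basis vector at the unit of G. *)
Definition vN_trace a : R[i] := a l2_unit 1%g.

Lemma vN_of_subproof (g : G) : [/\ linear (rtrans g),
  exists2 c : R, 0 <= c & forall u : ell2, (l2sq (rtrans g u) <= c%:E * l2sq u)%E &
  forall (h : G) (u : ell2), rtrans g (ltrans h u) = ltrans h (rtrans g u)].
Proof.
split=> [z u v||h u]; first exact: ell2P.
- exists 1 => // u; rewrite mul1e [leLHS](_ : _ = l2sq u)//.
  exact: l2sq_reindex (mulgr_bij _).
- by apply: ell2P => k; rewrite /= mulgA.
Qed.
(* The embedding of G into its von Neumann algebra: g acts on l^2(G) by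
   u |-> u g^-1, whose value at h is u (h g). *)
Definition vN_of g := let: And3 l bd e := vN_of_subproof g in VN l bd e.
Lemma vN_ofE g u : vN_of g u = rtrans g u.
Proof. by rewrite /vN_of; case: vN_of_subproof. Qed.

Definition vN_rmul a b := b * a.
Lemma vN_rmul_linear a : linear (vN_rmul a).
Proof.
move=> q b c; rewrite /vN_rmul mulrDl; congr (_ + _).
by apply: vNP => u; rewrite [LHS]vNME !vNZE [in RHS]vNME.
Qed.
HB.instance Definition _ a :=
  GRing.isLinear.Build rat vN vN _ (vN_rmul a) (vN_rmul_linear a).

(* P (x)_{QG} N(G) as a right N(G)-module, that is, as a left module over the
   opposite ring. *)
Section Induction.
Variable P : qmodule (BG G).

Let lN (g : G) (a : vN) : vN := vN_of g * a.
Definition vNind : Type := tens (@gact G P) lN.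
HB.instance Definition _ := GRing.Zmodule.on vNind.

Lemma vN_rmul_lN a g b : vN_rmul a (lN g b) = lN g (vN_rmul a b).
Proof. by rewrite /vN_rmul /lN mulrA. Qed.

Definition vNind_map (a : vN) : {linear tens (@gact G P) lN -> tens (@gact G P) lN} :=
  @tmap rat G _ _ _ _ _ _ _ _ idfun (vN_rmul a) (fun _ _ => erefl) (vN_rmul_lN a).

Lemma vNind_map_ten a p b :
  vNind_map a (ten (@gact G P) lN p b) = ten (@gact G P) lN p (b * a).
Proof. exact: tmap_ten. Qed.

Definition vNind_scale (a : vN^c) (t : vNind) : vNind := vNind_map a t.

Lemma vNind_scaleA (a b : vN^c) t :
  vNind_scale a (vNind_scale b t) = vNind_scale (a * b) t.
Proof.
apply: (@tens_ext _ _ _ _ _ _ _ (vNind_map a \o vNind_map b)) => p c /=.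
by rewrite !vNind_map_ten -mulrA.
Qed.
Lemma vNind_scale1 : left_id 1 vNind_scale.
Proof.
move=> t; apply: (@tens_ext _ _ _ _ _ _ _ (vNind_map 1) idfun) => p c /=.
by rewrite !vNind_map_ten mulr1.
Qed.
Lemma vNind_scaleDr : right_distributive vNind_scale +%R.
Proof. by move=> a t u; apply: linearD. Qed.
Lemma vNind_scaleDl t : {morph vNind_scale^~ t : a b / a + b}.
Proof.
move=> a b; apply: (@tens_ext _ _ _ _ _ _ _ (vNind_map (a + b))
  (vNind_map a \+ vNind_map b)) => p c /=.
rewrite !vNind_map_ten mulrDr -[c * a]scale1r.
by rewrite tenPr !scale1r.
Qed.
HB.instance Definition _ := GRing.Zmodule_isLmodule.Build vN^c vNind
  vNind_scaleA vNind_scale1 vNind_scaleDr vNind_scaleDl.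
End Induction.

(* X is f.g. projective, isomorphic to the image of an idempotent matrix A over
   N(G), and d is the trace of A. *)
Definition vN_dim_is (X : lmodType vN^c) (d : R) :=
  exists n (A : 'M[vN^c]_n) (f : {linear X -> 'rV[vN^c]_n}),
    [/\ A *m A = A, injective f,
        forall v, (exists x, f x = v) <-> (exists w, v = w *m A) &
        \sum_i vN_trace (A i i) = d%:C%C].

Definition vN_dim (X : lmodType vN^c) : R := xget 0 (vN_dim_is X).
End EllTwo.


Section StructureMaps.
Variables (R : realType) (C : category) (rep : isoc C -> C).

Local Notation SK := (splitK0 rep).
Local Notation UQ := (tensZQ (freemod int (isoc C))).

(* In the predicates below, K0cl and vN_dim are total functions whose value on
   a module is only meaningful when the module is f.g. projective; this is why
   that property is asserted next to every formula that uses them. *)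

Definition is_S (S : {additive K0 C -> SK}) :=
  forall P : qmodule C, fgproj P -> forall x,
    fgproj (Smod P (rep x)) /\ S (K0cl P) x = K0cl (Smod P (rep x)).

Definition is_E (E : {additive SK -> K0 C}) :=
  forall x (Q : qmodule (BG (aut (rep x)))), fgproj Q ->
    fgproj (Emod Q) /\ E (Kin (K0cl Q)) = K0cl (Emod Q).

Definition is_Res (Res : {additive K0 C -> SK}) :=
  forall P : qmodule C, fgproj P -> forall x,
    fgproj (qres P (rep x)) /\ Res (K0cl P) x = K0cl (qres P (rep x)).

(* I_x Q need not be projective: its class is that of a finite resolution. *)
Definition is_I (EI : EI_category C) (I : {additive SK -> K0 C}) :=
  forall x (Q : qmodule (BG (aut (rep x)))), fgproj Q ->
    (exists k, resolution_class (Imod EI Q) k) /\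
    (forall k, resolution_class (Imod EI Q) k -> I (Kin (K0cl Q)) = k).

Definition is_omega (omega : {additive SK -> SK}) :=
  forall x (P : qmodule (BG (aut (rep x)))), fgproj P -> forall y,
    fgproj (tensb (bmor (rep y) (rep x)) P) /\
    omega (Kin (K0cl P)) y = K0cl (tensb (bmor (rep y) (rep x)) P).

(* The sums over l >= 0 and over ch_l(y, x) are written as one sum over pairs. *)
Definition all_chains (y x : isoc C) : set {classic {l & ichain l y x}} := setT.
Arguments all_chains : clear implicits.

Definition is_mu (mu : {additive SK -> SK}) :=
  forall x (P : qmodule (BG (aut (rep x)))), fgproj P -> forall y,
    [/\ finite_set (all_chains y x),
        forall l (c : ichain l y x), fgproj (tensb (chain_biset rep c) P) &
        mu (Kin (K0cl P)) y =
          \sum_(c \in all_chains y x)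
            (-1) ^+ tag c *: K0cl (tensb (chain_biset rep (tagged c)) P)].

Definition vN_dim_defined (G : groupType) (X : lmodType (vN R G)^c) :=
  exists d, vN_dim_is X d.

(* f is multiplication by the matrix whose entry from the x-summand to the
   y-summand is m y x; f is Q-linear because it is additive. The entries are
   real numbers, so that their rationality is part of the assertion. *)
Definition is_matrix (m : isoc C -> isoc C -> R) (f : {additive UQ -> UQ}) :=
  forall x, exists w : isoc C -> rat,
    [/\ forall y, ratr (w y) = m y x,
        finite_set [set y | w y != 0] &
        forall q : rat, f (tenQ (fbasis int x) q) =
          \sum_(y \in [set: isoc C]) tenQ (fbasis int y) (w y * q)].

Definition is_omega2 (omega2 : {additive UQ -> UQ}) :=
  (forall y x, vN_dim_defined (vNind R (blin (bmor (rep y) (rep x))))) /\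
  is_matrix (fun y x => vN_dim (vNind R (blin (bmor (rep y) (rep x))))) omega2.

Definition is_mu2 (mu2 : {additive UQ -> UQ}) :=
  [/\ forall y x, finite_set (all_chains y x),
      forall l y x (c : ichain l y x),
        vN_dim_defined (vNind R (blin (chain_biset rep c))) &
      is_matrix (fun y x => \sum_(c \in all_chains y x)
        (-1) ^+ tag c * vN_dim (vNind R (blin (chain_biset rep (tagged c))))) mu2].

Definition is_rk2 (rk : {additive SK -> UQ}) :=
  forall x (P : qmodule (BG (aut (rep x)))), fgproj P ->
    vN_dim_defined (vNind R P) /\
    exists2 q : rat, ratr q = vN_dim (vNind R P) &
      rk (Kin (K0cl P)) = tenQ (fbasis int x) q.
End StructureMaps.

Arguments all_chains {C} y x.

(* Main.v *)
Require Import Defs.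
From HB Require Import structures.
From mathcomp Require Import all_boot all_order all_algebra.
From mathcomp Require Import boolp classical_sets functions cardinality fsbigop.
From mathcomp Require Import reals ereal esum.
From mathcomp Require Import complex lra.
Import Defs.

Set Implicit Arguments.
Unset Strict Implicit.
Unset Printing Implicit Defensive.

Import Order.TTheory GRing.Theory Num.Theory.

Local Open Scope ring_scope.
Local Open Scope cat_scope.

(** Write c <= d for the order on isomorphism classes; it is antisymmetric since
    in an EI-category two opposite morphisms are isomorphisms.

    The map S o E is the identity summand by summand. Evaluated at x, E_x Q is Q
    itself and there is nothing to divide out, because a non-isomorphism x -> z
    excludes morphisms z -> x; for y not isomorphic to x every q (x) u with
    u : y -> x comes from q (x) id along the non-isomorphism u. So it remains to
    see that E is onto (K0_E_surj). For this, and for the resolutions of I_x Q,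
    consider modules M with f.g. projective values that vanish off a finite
    down-closed set D of classes (the predicate controlled). The counits give a
    surjection from F, the direct sum of the E_c M(c) with c in D, onto M; its
    kernel is again controlled, and it vanishes at a maximal element of D, where
    the counit is an isomorphism (kernel_controlled). Induction on the size of D
    expresses the class of a f.g. projective M by classes in the image of E, and
    it also yields a finite resolution of any controlled M.

    Since Res o E = omega by the definitions, Res = omega o S. The matrix of
    omega is triangular for <=, with identities on the diagonal. If N is its
    strict part, mu is the sum of the (-1)^l N^l, as the functor attached to a
    chain is the composite of the functors attached to its steps (tensb_bprod).
    Thus mu = 1 - N mu, which is omega mu = 1, and omega is injective: look at a
    maximal element of the support. Hence omega and mu are inverse to one
    another, and Res is inverted by E o mu. That E o mu is the map I follows by
    evaluating a resolution of I_x Q at all objects: Res of its class is the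
    class of Q at x.

    Ranks are computed with dual bases: if p = sum_j b_j a_j(p) on a module P over
    Q[G], then P (x) N(G) is the image of the idempotent matrix (a_k(b_j)), so its
    dimension is the sum of the coefficients of the a_j(b_j) at 1, a rational
    number. It depends on P only because the trace of N(G) satisfies
    tr(ab) = tr(ba) (vN_traceM, vN_dim_uniq). For a right H-set X with finite
    stabilizers L_i and finitely many orbits, with representatives x_i, the
    averages over the L_i provide a dual basis of Q[X]. If G acts freely on X from
    the left, an element other than 1 fixes no point and acts on Q[X] with trace
    0, so only coefficients at 1 contribute to the rank of P (x) Q[X], which is
    the product of the ranks of P and of Q[X] (grank_tensb). With
    X = mor(y, x) this says that the L^2-rank carries omega to its rational
    counterpart. The rational matrices are inverse to one another by the same
    inversion, and so the L^2-rank carries mu to its counterpart too. *)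

(** * Linear maps and tensor products with free modules *)

Definition mklin (R : pzRingType) (U V : lmodType R) (f : U -> V)
    (fl : linear f) : {linear U -> V} :=
  HB.pack f (GRing.isLinear.Build R U V _ f fl).

Section FreeSums.
Variables (R : comPzRingType) (T : Type) (N : lmodType R).

Lemma freemod_ind (P : freemod R T -> Prop) :
  (forall t, P (fbasis R t)) ->
  (forall a u v, P u -> P v -> P (a *: u + v)) -> P 0 -> forall u, P u.
Proof.
move=> Pb PD P0 u; rewrite (dsum_sum u).
have fin : finite_set [set t : {classic T} | u t != 0] by exact: dsum_finite.
rewrite fsbig_finite//=; elim/big_rec: _ => // t v _ Pv.
suff -> : din (fun _ : T => R^o : lmodType R) t (u t) = (u t) *: fbasis R t by exact: PD.
by rewrite -linearZ; congr din; rewrite /*:%R /= mulr1.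
Qed.

End FreeSums.

Section TensorFree.
Variables (R : comPzRingType) (S T : Type) (A N : lmodType R).
Variables (ra : A -> S -> A) (lt : S -> T -> T).
Local Notation lb := (fun s => freemap R (lt s)).

(** Tensors whose second factor is a basis element: they generate A (x) R[T], and
    all the tensor products with bisets are handled through them. *)
Definition bten (a : A) (t : T) : tens ra lb := ten ra lb a (fbasis R t).

Lemma bten_linear t : linear (bten^~ t).
Proof. by move=> r a a'; apply: tenP. Qed.

Lemma btenS a s t : bten (ra a s) t = bten a (lt s t).
Proof. by rewrite /bten tenS freemap_basis. Qed.

Lemma tenfree_ext (f g : {linear tens ra lb -> N}) :
  (forall a t, f (bten a t) = g (bten a t)) -> f =1 g.
Proof.
move=> fg; apply: tens_ext => a b.
have tl : linear (ten ra lb a) by move=> r b1 b2; apply: tenPr.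
exact: (@freemod_ext R T N (f \o mklin tl) (g \o mklin tl) (fg a)).
Qed.

Variable G : T -> {linear A -> N}.
Hypothesis GS : forall a s t, G t (ra a s) = G (lt s t) a.

Let f a (u : freemod R T) : N := flift (fun t => G t a) u.

Let fl r a a' u : f (r *: a + a') u = r *: f a u + f a' u.
Proof.
rewrite /f; have hl : linear (fun u => r *: f a u + f a' u).
  move=> c u1 u2; rewrite /f !(linearP (flift _)) !scalerDr !scalerA addrACA.
  by rewrite [r * c]mulrC.
apply: (@freemod_ext R T N _ (mklin hl)) => t.
by rewrite /mklin /= /f !flift_basis linearP.
Qed.

Let fr r a u u' : f a (r *: u + u') = r *: f a u + f a u'.
Proof. exact: linearP. Qed.

Let fS a s u : f (ra a s) u = f a (lb s u).
Proof.
rewrite /f -[RHS]/((flift (fun t => G t a) \o freemap R (lt s)) u).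
by apply: freemod_ext => t /=; rewrite freemap_basis !flift_basis GS.
Qed.

(** A map out of A (x) R[T] is a family of linear maps indexed by T; additivity in
    the second variable comes for free. *)
Definition tenfree_lift : {linear tens ra lb -> N} := tlift fl fr fS.

Lemma tenfree_lift_ten a u : tenfree_lift (ten ra lb a u) = flift (fun t => G t a) u.
Proof. exact: tlift_ten. Qed.

Lemma tenfree_liftE a t : tenfree_lift (bten a t) = G t a.
Proof. by rewrite tenfree_lift_ten flift_basis. Qed.
End TensorFree.

Arguments bten {R S T A} ra lt a t.

(** * Homomorphisms of modules over a category *)

Section Homs.
Variable C : category.
Implicit Types M N P Q : qmodule C.

Definition qid M : qhom M M := @QHom C M M (fun x => idfun) (fun _ _ _ _ => erefl).

Definition qcomp M N P (g : qhom N P) (f : qhom M N) : qhom M P.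
Proof.
exists (fun x => g x \o f x) => x y u m /=.
by rewrite !qnat.
Defined.

Definition qaddh M N (f g : qhom M N) : qhom M N.
Proof.
exists (fun x => f x \+ g x) => x y u m /=.
by rewrite !qnat linearD.
Defined.

Definition qsubh M N (f g : qhom M N) : qhom M N.
Proof.
exists (fun x => f x \- g x) => x y u m /=.
by rewrite !qnat linearB.
Defined.

Definition q0h M N : qhom M N.
Proof.
exists (fun x => \0) => x y u m /=.
by rewrite linear0.
Defined.

Lemma qsumh_linear (J : finType) M N (f : J -> qhom M N) x :
  linear (fun m => \sum_j f j x m).
Proof.
move=> a m n; rewrite scaler_sumr -big_split /=.
by apply: eq_bigr => j _; rewrite linearP.
Qed.

Definition qsumh (J : finType) M N (f : J -> qhom M N) : qhom M N.
Proof.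
exists (fun x => mklin (@qsumh_linear J M N f x)) => x y u m /=.
by rewrite linear_sum /=; apply: eq_bigr => j _; rewrite qnat.
Defined.

Definition qzero : qmodule C :=
  @QModule C (fun _ => 'rV[rat]_0) (fun _ _ _ => idfun)
    (fun _ _ => erefl) (fun _ _ _ _ _ _ => erefl).

Lemma qzero0 x (m : qzero x) : m = 0.
Proof. by apply/rowP => -[]. Qed.

Lemma qisoI M N (f : qhom M N) (g : qhom N M) :
  (forall x, cancel (f x) (g x)) -> (forall x, cancel (g x) (f x)) -> qiso M N.
Proof. by move=> fg gf; exists f => x; exists (g x); [apply: fg | apply: gf]. Qed.

(** The objectwise inverses of a natural bijection are linear and natural. *)
Lemma qbij_inv M N (f : qhom M N) : (forall x, bijective (f x)) ->
  exists g : qhom N M,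
    (forall x, cancel (f x) (g x)) /\ (forall x, cancel (g x) (f x)).
Proof.
move=> fb.
have h x : exists g : N x -> M x, cancel (f x) g /\ cancel g (f x).
  by case: (fb x) => g; exists g.
pose g x := projT1 (cid (h x)).
have fg x : cancel (f x) (g x) by rewrite /g; case: cid => ? [].
have gf x : cancel (g x) (f x) by rewrite /g; case: cid => ? [].
have gl x : linear (g x).
  by move=> a m n; apply: (can_inj (fg x)); rewrite linearP !gf.
have gn x y (u : hom x y) m : mklin (gl x) (qact N u m) = qact M u (mklin (gl y) m).
  by apply: (can_inj (fg x)); rewrite gf qnat gf.
by exists (QHom gn).
Qed.

Lemma qisoP M N : qiso M N -> exists (f : qhom M N) (g : qhom N M),
  (forall x, cancel (f x) (g x)) /\ (forall x, cancel (g x) (f x)).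
Proof. by move=> [f /qbij_inv [g fg]]; exists f, g. Qed.

Definition qfst M N : qhom (qpair M N) M :=
  @QHom C (qpair M N) M (fun x => fst : {linear (M x * N x)%type -> M x})
    (fun _ _ _ _ => erefl).
Definition qsnd M N : qhom (qpair M N) N :=
  @QHom C (qpair M N) N (fun x => snd : {linear (M x * N x)%type -> N x})
    (fun _ _ _ _ => erefl).

Lemma qinl_linear M N x : linear (fun m : M x => (m, 0) : (M x * N x)%type).
Proof. by move=> a m n; congr pair; rewrite /= scaler0 addr0. Qed.
Lemma qinr_linear M N x : linear (fun n : N x => (0, n) : (M x * N x)%type).
Proof. by move=> a m n; congr pair; rewrite /= scaler0 addr0. Qed.

Definition qinl M N : qhom M (qpair M N).
Proof.
exists (fun x => mklin (@qinl_linear M N x)) => x y u m.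
by rewrite /mklin /= /qpair_act /= linear0.
Defined.
Definition qinr M N : qhom N (qpair M N).
Proof.
exists (fun x => mklin (@qinr_linear M N x)) => x y u m.
by rewrite /mklin /= /qpair_act /= linear0.
Defined.

Definition qcopair M N P (f : qhom M P) (g : qhom N P) : qhom (qpair M N) P :=
  qaddh (qcomp f (qfst M N)) (qcomp g (qsnd M N)).

(** ** Kernels *)
Section Kernel.
Variables (M N : qmodule C) (f : qhom M N).
Section KerAt.
Variable x : C.
Definition ker_pred : {pred M x} := [pred m | f x m == 0].
Lemma ker_submod_closed : submod_closed ker_pred.
Proof.
split=> [|a u v]; rewrite !inE ?linear0// => /eqP fu /eqP fv.
by rewrite linearP fu fv scaler0 addr0.
Qed.
HB.instance Definition _ :=
  GRing.isSubmodClosed.Build rat (M x) ker_pred ker_submod_closed.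
Record ker_elt := KerElt { ker_val :> M x; _ : ker_val \in ker_pred }.
HB.instance Definition _ := [isSub for ker_val].
HB.instance Definition _ := [Choice of ker_elt by <:].
HB.instance Definition _ := [SubChoice_isSubLmodule of ker_elt by <:].
Lemma ker_eltP (k : ker_elt) : f x (ker_val k) = 0.
Proof. by case: k => k /= /eqP. Qed.
Lemma ker_val_linear : linear ker_val.
Proof. by move=> a u v; exact: (linearP (\val : {linear ker_elt -> M x})). Qed.
Lemma ker_inj (k l : ker_elt) : ker_val k = ker_val l -> k = l.
Proof. exact: val_inj. Qed.
End KerAt.

Lemma ker_act_subproof x y (u : hom x y) (k : ker_elt y) :
  qact M u (ker_val k) \in @ker_pred x.
Proof. by rewrite inE qnat ker_eltP linear0. Qed.
Definition ker_act x y (u : hom x y) (k : ker_elt y) : ker_elt x :=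
  KerElt (ker_act_subproof u k).
Lemma ker_act_linear x y (u : hom x y) : linear (ker_act u).
Proof.
move=> a k l; apply: ker_inj; rewrite -[LHS]/(qact M u (ker_val (a *: k + l))).
by rewrite !ker_val_linear linearP.
Qed.
Definition qker : qmodule C.
Proof.
exists (fun x => ker_elt x : lmodType rat) (fun x y u => mklin (@ker_act_linear x y u)).
- by move=> x k; apply: ker_inj; rewrite /= qact1.
- by move=> x y z u v k; apply: ker_inj; rewrite /= qactM.
Defined.
Definition qker_in : qhom qker M :=
  @QHom C qker M (fun x => mklin (@ker_val_linear x)) (fun _ _ _ _ => erefl).
Lemma qker_in_inj : qinjective qker_in.
Proof. by move=> x k l; apply: ker_inj. Qed.
Lemma qker0 x (k : qker x) : f x (qker_in x k) = 0.
Proof. exact: ker_eltP. Qed.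
Lemma qker_ex x m : f x m = 0 -> exists k : qker x, qker_in x k = m.
Proof.
move=> /eqP fm; have kp : m \in @ker_pred x by [].
by exists (KerElt kp).
Qed.
Lemma qker_exact : qexact qker_in f.
Proof.
move=> x m; split=> [/qker_ex//|[k <-]]; exact: qker0.
Qed.

Lemma qker_lift_sub P (g : qhom P M) : (forall x p, f x (g x p) = 0) ->
  forall x p, g x p \in @ker_pred x.
Proof. by move=> fg x p; rewrite inE fg. Qed.
Lemma qker_lift_lin P (g : qhom P M) (fg : forall x p, f x (g x p) = 0) (x : C) :
  linear (fun p : P x => KerElt (qker_lift_sub fg p)).
Proof. by move=> a p q; apply: ker_inj; rewrite ker_val_linear -linearP. Qed.
Definition qker_lift P (g : qhom P M) (fg : forall x p, f x (g x p) = 0) :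
  qhom P qker.
Proof.
exists (fun x => mklin (@qker_lift_lin P g fg x)) => x y u p.
by apply: ker_inj; rewrite /= qnat.
Defined.
Lemma qker_liftE P (g : qhom P M) (fg : forall x p, f x (g x p) = 0) x p :
  qker_in x (qker_lift fg x p) = g x p.
Proof. by []. Qed.
End Kernel.

(** ** Idempotents split *)
Section Image.
Variables (M : qmodule C) (e : qhom M M).
Hypothesis ee : forall x m, e x (e x m) = e x m.
Lemma qimage_sub x m : (qsubh (qid M) e) x (e x m) = 0.
Proof. by rewrite /= ee subrr. Qed.
(** The image of e is encoded as the kernel of 1 - e. *)
Lemma idem_split : exists P (i : qhom P M) (r : qhom M P),
  (forall x p, r x (i x p) = p) /\ (forall x m, i x (r x m) = e x m).
Proof.
exists (qker (qsubh (qid M) e)), (qker_in _), (qker_lift qimage_sub); split=> // x p.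
apply: qker_in_inj; rewrite qker_liftE.
by have /= /subr0_eq := qker0 p.
Qed.
End Image.
End Homs.

(** * Representable modules and dual bases *)
Section Yoneda.
Variable C : category.
Implicit Types M N P Q : qmodule C.

Section Yo.
Variables (M : qmodule C) (s : C) (m : M s).
Definition yo_fun x : {linear qrep s x -> M x} :=
  flift (fun f : hom x s => qact M f m).
Lemma yo_nat x y (u : hom x y) v :
  yo_fun x (qact (qrep s) u v) = qact M u (yo_fun y v).
Proof.
rewrite -[LHS]/((yo_fun x \o qact (qrep s) u) v) -[RHS]/((_ \o _) v).
apply: freemod_ext => f /=; rewrite /yo_fun /blin_act freemap_basis !flift_basis.
by rewrite qactM.
Qed.
(** The Yoneda correspondence: homomorphisms out of a representable module are
    elements. For a category with one object this is multiplication of m by an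
    element of the group ring. *)
Definition yo : qhom (qrep s) M := QHom yo_nat.
Lemma yoE x (f : hom x s) : yo x (fbasis rat f) = qact M f m.
Proof. exact: flift_basis. Qed.
End Yo.

Lemma qrep_ext s M (f g : qhom (qrep s) M) :
  f s (fbasis rat (idm s)) = g s (fbasis rat (idm s)) -> forall x v, f x v = g x v.
Proof.
move=> fg x; apply: freemod_ext => u.
have -> : fbasis rat u = qact (qrep s) u (fbasis rat (idm s)).
  by rewrite /= /blin_act freemap_basis /= comp1m.
by rewrite !qnat fg.
Qed.

Lemma yo_hom s M N (m : M s) (f : qhom M N) x v : f x (yo m x v) = yo (f s m) x v.
Proof.
apply: (@qrep_ext s N (qcomp f (yo m)) (yo (f s m))) => /=.
by rewrite /yo_fun !flift_basis !qact1.
Qed.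

Lemma yo_id s x v : yo (fbasis rat (idm s) : qrep s s) x v = v.
Proof.
apply: (@qrep_ext s (qrep s) (yo _) (qid _)) => /=.
by rewrite /yo_fun flift_basis /= /blin_act freemap_basis /= compm1.
Qed.

Section FreeIO.
Variables (n : nat) (s : 'I_n -> C).
Definition fg_in i : qhom (qrep (s i)) (fgfree s).
Proof.
exists (fun x => mklin (@din_is_linear _ _ (fun i => qrep (s i) x) i)) => x y u m.
by rewrite /= /qsum_act dmap_in.
Defined.
Definition fg_pr i : qhom (fgfree s) (qrep (s i)).
Proof.
exists (fun x => mklin (@dcoord_is_linear _ _ (fun i => qrep (s i) x) i)) => x y u m.
rewrite -[LHS]/((dcoord i \o qact (fgfree s) u) m).
rewrite -[RHS]/((qact (qrep (s i)) u \o dcoord i) m).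
apply: dsum_ext => j v.
rewrite -[LHS]/(dcoord i (qact (fgfree s) u (din _ j v))).
rewrite -[RHS]/(blin_act (brep (s i)) u (dcoord i (din (fun i => qrep (s i) y) j v))).
rewrite [qact _ _ _]dmap_in /dcoord.
have [ij|ij] := pselect (j = i); last by rewrite !dinN// linear0.
by case: i / ij; rewrite !dinE.
Defined.
Lemma fg_dec x (m : fgfree s x) : \sum_i fg_in i x (fg_pr i x m) = m.
Proof.
have -> : \sum_i fg_in i x (fg_pr i x m) =
    (qsumh (fun i => qcomp (fg_in i) (fg_pr i))) x m by [].
apply: (@dsum_ext _ _ _ _ ((qsumh (fun i => qcomp (fg_in i) (fg_pr i))) x) idfun) => j v.
pose D := din (fun i => qrep (s i) x).
rewrite -[LHS]/(\sum_i D i (D j v i)) -[RHS]/(D j v) (bigD1 j)// /D dinE.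
rewrite big1; first exact: addr0.
move=> i ij; rewrite dinN ?linear0// => ji.
by rewrite ji eqxx in ij.
Qed.
Lemma fg_in_pr i x v : fg_pr i x (fg_in i x v) = v.
Proof. by rewrite -[LHS]/(din (fun i => qrep (s i) x) i v i) dinE. Qed.
Lemma fg_in_prN i j x v : i <> j -> fg_pr j x (fg_in i x v) = 0.
Proof. by move=> ij; rewrite -[LHS]/(din (fun i => qrep (s i) x) i v j) dinN. Qed.
End FreeIO.
End Yoneda.

(** * Finitely generated projective modules *)
Section FgProj.
Variable C : category.
Implicit Types M N P Q : qmodule C.

(** A coordinate description of projectivity: the elements b_j and the coordinates
    a_j with p = sum_j b_j a_j(p). It composes well and determines the idempotent
    matrix from which ranks are read off. *)
Record dbasis P := DBasis {
  db_ix : finType;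
  db_s : db_ix -> C;
  db_b : forall j, P (db_s j);
  db_a : forall j, qhom P (qrep (db_s j));
  dbP : forall x p, \sum_j yo (db_b j) x (db_a j x p) = p }.

Section Compose.
Variables (P : qmodule C) (J : finType) (N : J -> qmodule C).
Variables (c : forall j, qhom (N j) P) (d : forall j, qhom P (N j)).
Hypothesis cd : forall x p, \sum_j c j x (d j x p) = p.
Variable B : forall j, dbasis (N j).

(** Coordinates with values in modules that have dual bases can be expanded once
    more. *)
Lemma compose_subproof x p :
  \sum_(t : {j & db_ix (B j)})
     yo (c (tag t) _ (db_b (tagged t))) x (db_a (tagged t) x (d (tag t) x p)) = p.
Proof.
rewrite -[RHS]cd.
rewrite -(sig_big_dep xpredT (fun _ => xpredT) (fun j k =>
   yo (c j _ (db_b k)) x (db_a (d:=B j) k x (d j x p)))) /=.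
apply: eq_bigr => j _; rewrite -[in RHS](dbP (B j) (d j x p)) linear_sum /=.
by apply: eq_bigr => k _; rewrite -yo_hom.
Qed.

Definition compose_dbasis : dbasis P :=
  @DBasis P {j & db_ix (B j)} (fun t => db_s (tagged t))
    (fun t => c (tag t) _ (db_b (tagged t)))
    (fun t => qcomp (db_a (tagged t)) (d (tag t))) compose_subproof.
End Compose.

Lemma qrep_dbasis_subproof (s x : C) (p : qrep s x) :
  \sum_(j : 'I_1) yo (fbasis rat (idm s) : qrep s s) x p = p.
Proof. by rewrite big_ord1 yo_id. Qed.
Definition qrep_dbasis (s : C) : dbasis (qrep s) :=
  @DBasis (qrep s) _ (fun _ : 'I_1 => s) (fun=> fbasis rat (idm s))
    (fun=> qid _) (@qrep_dbasis_subproof s).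

Definition fgfree_dbasis n (s : 'I_n -> C) : dbasis (fgfree s) :=
  compose_dbasis (@fg_dec C n s) (fun i => qrep_dbasis (s i)).

Definition retract_dbasis P M (i : qhom P M) (r : qhom M P)
  (ri : forall x p, r x (i x p) = p) (B : dbasis M) : dbasis P.
Proof.
apply: (@compose_dbasis P 'I_1 (fun=> M) (fun=> r) (fun=> i) _ (fun=> B)) => x p.
by rewrite big_ord1.
Defined.

(** The complement of P in M is the image of 1 - ir. *)
Lemma retract_complement P M (i : qhom P M) (r : qhom M P) :
  (forall x p, r x (i x p) = p) -> exists Q, qiso (qpair P Q) M.
Proof.
move=> ri; pose e := qsubh (qid M) (qcomp i r).
have ee x m : e x (e x m) = e x m by rewrite /= (linearB (r x)) ri subrr linear0 subr0.
have [Q [j [r' [r'j jr']]]] := idem_split ee.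
have ei x p : e x (i x p) = 0 by rewrite /= ri subrr.
have re x m : r x (e x m) = 0 by rewrite /= linearB /= ri subrr.
have r'i x p : r' x (i x p) = 0 by rewrite -[LHS]r'j jr' ei linear0.
have rj x q : r x (j x q) = 0 by rewrite -[q]r'j jr' re.
exists Q; apply: (@qisoI _ _ _ (qcopair i j)
  (qaddh (qcomp (qinl P Q) r) (qcomp (qinr P Q) r'))) => x.
  move=> [p q]; rewrite /mklin /=; congr pair => /=.
    by rewrite linearD ri rj !addr0.
  by rewrite linearD r'i r'j !add0r.
move=> m; rewrite /= addr0 add0r jr' /=.
by rewrite addrC subrK.
Qed.

Lemma retract_of_dbasis P (B : dbasis P) : exists n (s : 'I_n -> C)
  (i : qhom P (fgfree s)) (r : qhom (fgfree s) P), forall x p, r x (i x p) = p.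
Proof.
case: B => J s b a abP; exists #|J|, (s \o enum_val).
pose i := qsumh (fun j : 'I_#|J| => qcomp (fg_in (s \o enum_val) j) (a (enum_val j))).
pose r := qsumh (fun j : 'I_#|J| => qcomp (yo (b (enum_val j))) (fg_pr (s \o enum_val) j)).
exists i, r => x p; rewrite -[RHS]abP big_enum_val.
rewrite -[LHS]/(\sum_j yo (b (enum_val j)) x (fg_pr (s \o enum_val) j x (i x p))).
apply: eq_bigr => j _; congr (yo _ x _).
rewrite /i -[X in fg_pr _ _ _ X]/(\sum_j fg_in (s \o enum_val) j x (a (enum_val j) x p)).
rewrite linear_sum (bigD1 j)// fg_in_pr big1; first exact: addr0.
move=> k kj.
by rewrite fg_in_prN// => e; rewrite e eqxx in kj.
Qed.

Lemma fgprojP P : fgproj P <-> inhabited (dbasis P).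
Proof.
split=> [[n [s [Q /qisoP[f [g [fg gf]]]]]]|[B]].
  constructor; apply: (@retract_dbasis _ _ (qcomp f (qinl P Q)) (qcomp (qfst P Q) g) _
    (fgfree_dbasis s)) => x p.
  by rewrite /= fg.
have [n [s [i [r ri]]]] := retract_of_dbasis B.
by exists n, s; apply: (retract_complement ri).
Qed.

Lemma fgproj_sum P (J : finType) (N : J -> qmodule C)
    (c : forall j, qhom (N j) P) (d : forall j, qhom P (N j)) :
  (forall x p, \sum_j c j x (d j x p) = p) -> (forall j, fgproj (N j)) -> fgproj P.
Proof.
move=> cd pN; apply/fgprojP; constructor; apply: (compose_dbasis cd) => j.
have ex : exists B : dbasis (N j), True by have /fgprojP [B] := pN j; exists B.
exact: (projT1 (cid ex)).
Qed.

Lemma fgproj_retract P M (i : qhom P M) (r : qhom M P) :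
  (forall x p, r x (i x p) = p) -> fgproj M -> fgproj P.
Proof. by move=> ri /fgprojP[B]; apply/fgprojP; constructor; apply: retract_dbasis ri B. Qed.

Lemma fgproj_iso P M : qiso P M -> fgproj M -> fgproj P.
Proof. by move=> /qisoP[f [g [fg gf]]]; apply: fgproj_retract; exact: fg. Qed.

Lemma fgproj_qrep (s : C) : fgproj (qrep s).
Proof. by apply/fgprojP; constructor; apply: qrep_dbasis. Qed.

Lemma fgproj_zero P : (forall x (p : P x), p = 0) -> fgproj P.
Proof.
move=> P0; apply: (@fgproj_sum P 'I_0 (fun=> qzero C) (fun=> q0h _ _) (fun=> q0h _ _)).
  by move=> x p; rewrite [RHS]P0 big_ord0.
by case.
Qed.

Lemma fgproj_pair P Q : fgproj P -> fgproj Q -> fgproj (qpair P Q).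
Proof.
move=> fP fQ; apply: (@fgproj_sum _ bool (fun b => if b then P else Q)
  (fun b => if b return qhom (if b then P else Q) (qpair P Q) then qinl P Q else qinr P Q)
  (fun b => if b return qhom (qpair P Q) (if b then P else Q) then qfst P Q else qsnd P Q)).
  by move=> x [p q]; rewrite big_bool /mklin /=; congr pair; rewrite /= ?addr0 ?add0r.
by case.
Qed.

(** Lift the images of the elements of a dual basis and extend by coordinates. *)
Lemma fgproj_lift P M N (g : qhom M N) (f : qhom P N) : fgproj P ->
  qsurjective g -> exists h : qhom P M, forall x p, g x (h x p) = f x p.
Proof.
move=> /fgprojP[[J s b a abP]] gs.
pose l j := projT1 (cid (gs _ (f _ (b j)))).
have gl j : g _ (l j) = f _ (b j) by rewrite /l; case: cid.
exists (qsumh (fun j => qcomp (yo (l j)) (a j))) => x p.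
rewrite -[in RHS](abP x p) [RHS]linear_sum.
rewrite -[LHS]/(g x (\sum_j yo (l j) x (a j x p))) linear_sum.
by apply: eq_bigr => j _; rewrite yo_hom gl -yo_hom.
Qed.

Lemma split_exact P' P P'' (f : qhom P' P) (g : qhom P P'') :
  fgproj P'' -> short_exact f g ->
  exists (r : qhom P P') (s : qhom P'' P),
  [/\ forall x p, r x (f x p) = p, forall x p, g x (s x p) = p,
      forall x p, r x (s x p) = 0, forall x p, g x (f x p) = 0 &
      forall x p, f x (r x p) + s x (g x p) = p].
Proof.
move=> pP'' [fi ex gs]; have [s gsK] := fgproj_lift (qid P'') pP'' gs.
have gf x p : g x (f x p) = 0 by apply/ex; exists p.
have h x p : exists p', f x p' = p - s x (g x p).
  by apply/ex; rewrite linearB gsK /= subrr.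
pose r x p := projT1 (cid (h x p)).
have fr x p : f x (r x p) = p - s x (g x p) by rewrite /r; case: cid.
have rl x : linear (r x).
  move=> a p q; apply: (fi x); rewrite (linearP (f x)) !fr (linearP (g x)) (linearP (s x)).
  by rewrite scalerBr opprD addrACA.
have rn x y (u : hom x y) m : mklin (rl x) (qact P u m) = qact P' u (mklin (rl y) m).
  by apply: (fi x); rewrite qnat /mklin /= !fr qnat qnat linearB.
exists (QHom rn), s; split=> // x p; rewrite /mklin /=.
- by apply: (fi x); rewrite fr gf linear0 subr0.
- by apply: (fi x); rewrite fr gsK subrr linear0.
- by rewrite fr subrK.
Qed.
End FgProj.

(** * The Grothendieck group *)
Section KTheory.
Variable C : category.
Implicit Types M N P Q : qmodule C.
Implicit Types e : projector C.

Lemma fgproj_image P : fgproj P -> exists e, image_of e P.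
Proof.
move=> /fgprojP[B]; have [n [s [i [r ri]]]] := retract_of_dbasis B.
have ee x m : qcomp i r x (qcomp i r x m) = qcomp i r x m by rewrite /= ri.
by exists (Projector ee), i, r.
Qed.

Lemma image_fgproj e P : image_of e P -> fgproj P.
Proof.
move=> [i [r ir]]; apply: (@fgproj_retract _ _ _ i r) => [x p|]; first by case: (ir x).
by apply/fgprojP; constructor; apply: fgfree_dbasis.
Qed.

Lemma image_ex e : exists P, image_of e P.
Proof.
have [P [i [r [ri ir]]]] := idem_split (@pr_idem _ e).
by exists P, i, r.
Qed.

Lemma scalez_mulrz (A : lmodType int) (a : int) (w : A) : a *: w = w *~ a.
Proof. by rewrite -{1}[a]intz scaler_int. Qed.

Local Notation gen e := (lpi (@K0_rel C) (fbasis int e)).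

Lemma K0_rel0 e' e e'' P' P P'' (f : qhom P' P) (g : qhom P P'') :
  image_of e' P' -> image_of e P -> image_of e'' P'' -> short_exact f g ->
  gen e = gen e' + gen e''.
Proof.
move=> h' h h'' fg; apply/eqP; rewrite -subr_eq0 -linearD -linearB.
rewrite -(linear0 (lpi _)); apply/eqP/lpiP; rewrite subr0; apply: lspan_sub.
exact: K0Rel h' h h'' fg.
Qed.

Lemma qzero_exact P : short_exact (q0h (qzero C) P) (qid P).
Proof.
split=> [x p q _|x n|x n]; first by rewrite [p]qzero0 [q]qzero0.
  by split=> /= [->|[m <-]//]; exists 0.
by exists n.
Qed.

(** Two projectors with image P are compared by the exact sequences 0 -> P -> P,
    which also show that a projector with zero image has class 0. *)
Lemma gen_uniq e e' P : image_of e P -> image_of e' P -> gen e = gen e'.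
Proof.
move=> h h'; have [e0 h0] : exists e, image_of e (qzero C).
  by apply/fgproj_image/fgproj_zero/qzero0.
have gen0 : gen e0 = 0.
  by apply/eqP; rewrite -(subrr (gen e)) {1}(K0_rel0 h0 h h (qzero_exact P)) addrK.
by rewrite (K0_rel0 h0 h h' (qzero_exact P)) gen0 add0r.
Qed.

Lemma K0cl_image e P : image_of e P -> K0cl P = gen e.
Proof.
move=> h; rewrite /K0cl; set A := (X in xget _ X).
have : exists k, A k by exists (gen e); exists e.
by case/(xgetPex 0) => e' h' ->; exact: gen_uniq h' h.
Qed.

Lemma K0cl_exact P' P P'' (f : qhom P' P) (g : qhom P P'') :
  fgproj P' -> fgproj P -> fgproj P'' -> short_exact f g ->
  K0cl P = K0cl P' + K0cl P''.
Proof.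
move=> /fgproj_image[e' h'] /fgproj_image[e h] /fgproj_image[e'' h''] fg.
rewrite (K0cl_image h) (K0cl_image h') (K0cl_image h'').
exact: K0_rel0 h' h h'' fg.
Qed.

(** Only exact sequences of f.g. projective modules are tested, because the
    functions used below have no meaning on other modules. *)
Definition exact_additive (A : zmodType) (F : qmodule C -> A) :=
  forall P' P P'' (f : qhom P' P) (g : qhom P P''),
    fgproj P' -> fgproj P -> fgproj P'' -> short_exact f g -> F P = F P' + F P''.

Lemma K0cl_additive : exact_additive (@K0cl C).
Proof. exact: K0cl_exact. Qed.

Section Additive.
Variables (A : zmodType) (F : qmodule C -> A).
Hypothesis FD : exact_additive F.

Lemma exact_additive0 P : (forall x (p : P x), p = 0) -> F P = 0.
Proof.
move=> P0; have pP := fgproj_zero P0.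
have ex : short_exact (q0h P P) (qid P).
  split=> [x p q _|x n|x n]; first by rewrite [p]P0 [q]P0.
    by split=> /= [->|[m <-]//]; exists 0.
  by exists n.
by apply/eqP; rewrite -(subrr (F P)) {2}(FD pP pP pP ex) addrK.
Qed.

(** An isomorphism is a short exact sequence with first term 0. *)
Lemma exact_additive_iso P Q : fgproj Q -> qiso P Q -> F P = F Q.
Proof.
move=> pQ PQ; have pP := fgproj_iso PQ pQ.
have p0 := fgproj_zero (@qzero0 C).
have [f [g [fg gf]]] := qisoP PQ.
have ex : short_exact (q0h (qzero C) P) f.
  split=> [x p q _|x n|x n]; first by rewrite [p]qzero0 [q]qzero0.
    split=> /= [fn|[m <-]]; last by rewrite linear0.
    by exists 0; apply: (can_inj (fg x)); rewrite fn linear0.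
  by exists (g x n); rewrite gf.
by rewrite (FD p0 pP pQ ex) (exact_additive0 (@qzero0 C)) add0r.
Qed.

Lemma exact_additive_pair P Q : fgproj P -> fgproj Q -> F (qpair P Q) = F P + F Q.
Proof.
move=> pP pQ; apply: (FD pP (fgproj_pair pP pQ) pQ (f := qinl P Q) (g := qsnd P Q)).
split=> [x p q|x [p q]|x n]; first by case.
  by split=> /= [->|[m [_ ->]]//]; exists p.
by exists (0, n).
Qed.
End Additive.

(** The classes of the modules generate K0, since every projector has an image. *)
Lemma K0_ind (Pr : K0 C -> Prop) : Pr 0 ->
  (forall u v, Pr u -> Pr v -> Pr (u - v)) ->
  (forall P, fgproj P -> Pr (K0cl P)) -> forall k, Pr k.
Proof.
move=> Pr0 PrB PrP k; rewrite -[k]lpi_repr; move: (repr k) => {k}.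
have PrN u : Pr u -> Pr (- u) by move=> Pu; rewrite -sub0r; apply: PrB.
have PrD u v : Pr u -> Pr v -> Pr (u + v).
  by move=> Pu Pv; rewrite -[v]opprK; apply: PrB => //; apply: PrN.
apply: freemod_ind; last by rewrite linear0.
  by move=> e; have [P h] := image_ex e; rewrite -(K0cl_image h); apply/PrP/(image_fgproj h).
move=> a u v Pu Pv; pose w : K0 C := lpi (@K0_rel C) u.
have -> : lpi (@K0_rel C) (a *: u + v) = a *: w + lpi (@K0_rel C) v by exact: linearP.
apply: (PrD) => //; have {Pu}Pw : Pr w by []; rewrite scalez_mulrz.
have Pn n : Pr (w *+ n) by elim: n => [|n IH]; rewrite ?mulr0n// mulrS; apply: (PrD).
by case: a => n; [exact: Pn|exact: PrN (Pn n.+1)].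
Qed.

Lemma K0_ext (A : zmodType) (f g : {additive K0 C -> A}) :
  (forall P, fgproj P -> f (K0cl P) = g (K0cl P)) -> f =1 g.
Proof.
move=> fg; apply: K0_ind => [|u v fu fv|//]; first by rewrite !raddf0.
by rewrite !raddfB fu fv.
Qed.

Section Lift.
Variables (A : lmodType int) (F : qmodule C -> A).
Hypothesis FD : exact_additive F.

Let im e := projT1 (cid (image_ex e)).
Let imP e : image_of e (im e). Proof. by rewrite /im; case: cid. Qed.

Lemma image_iso e P Q : image_of e P -> image_of e Q -> qiso P Q.
Proof.
move=> [i [r h]] [i' [r' h']]; apply: (@qisoI _ _ _ (qcomp r' i) (qcomp r i')) => x p /=.
  have [[ri ir] [_ i'r']] := (h x, h' x).
  by rewrite i'r' -(ir (i x p)) ri ri.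
have [[_ ir] [r'i' i'r']] := (h x, h' x).
by rewrite ir -(i'r' (i' x p)) r'i' r'i'.
Qed.

Lemma F_image e P : image_of e P -> F P = F (im e).
Proof.
by move=> h; apply: exact_additive_iso => //;
  [apply: image_fgproj (imP e)|apply: image_iso h (imP e)].
Qed.

Lemma K0lift_subproof k : K0_rel k -> flift (fun e => F (im e)) k = 0.
Proof.
case=> e' e e'' P' P P'' f g h' h h'' fg.
rewrite linearB linearD !flift_basis -(F_image h) -(F_image h') -(F_image h'').
by rewrite (FD _ _ _ fg) ?subrr//; [apply: image_fgproj h'|apply: image_fgproj h
  |apply: image_fgproj h''].
Qed.
(** The universal property of K0. The value on a projector is the value of F on
    some image of it. *)
Definition K0lift : {linear K0 C -> A} := lqlift K0lift_subproof.

Lemma K0liftE P : fgproj P -> K0lift (K0cl P) = F P.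
Proof.
move=> /fgproj_image[e h]; rewrite (K0cl_image h) [LHS]lqlift_pi flift_basis.
by rewrite -(F_image h).
Qed.
End Lift.
End KTheory.

(** * Additive functors between module categories *)
(** The laws are stated for arbitrary homomorphisms that agree pointwise with the
    identity, a composite or a sum, which avoids extensionality of homomorphisms. *)
Record afunctor (C D : category) := AFunctor {
  aob :> qmodule C -> qmodule D;
  amap : forall M N, qhom M N -> qhom (aob M) (aob N);
  amap1 : forall M (f : qhom M M), (forall x m, f x m = m) ->
    forall x m, amap f x m = m;
  amapM : forall M N P (f : qhom M N) (g : qhom N P) (h : qhom M P),
    (forall x m, h x m = g x (f x m)) ->
    forall x m, amap h x m = amap g x (amap f x m);
  amapD : forall M N (f g h : qhom M N),
    (forall x m, h x m = f x m + g x m) ->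
    forall x m, amap h x m = amap f x m + amap g x m }.
Arguments amap {C D} a {M N} f.
Arguments amap1 {C D} a {M f}.
Arguments amapM {C D} a {M N P f g h}.
Arguments amapD {C D} a {M N f g h}.

Section AFunctorTheory.
Variables (C D : category) (T : afunctor C D).
Implicit Types M N P Q : qmodule C.

Lemma amap0 M N (f : qhom M N) : (forall x m, f x m = 0) ->
  forall x m, amap T f x m = 0.
Proof.
move=> f0 x m; have fff y p : f y p = f y p + f y p by rewrite f0 addr0.
have := amapD T fff x m; rewrite -[X in X = _]addr0 => /addrI /esym//.
Qed.

Lemma amap_sumr (J : Type) (r : seq J) M N (f : J -> qhom M N) (h : qhom M N) :
  (forall x m, h x m = \sum_(j <- r) f j x m) ->
  forall x m, amap T h x m = \sum_(j <- r) amap T (f j) x m.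
Proof.
elim: r h => [|j r IH] h hE x m.
  by rewrite big_nil (amap0 (f := h))// => y p; rewrite hE big_nil.
pose k := foldr (fun j h => qaddh (f j) h) (q0h M N) r.
have kE y p : k y p = \sum_(j <- r) f j y p.
  rewrite /k; elim: (r) => [|i s /= ->]; first by rewrite big_nil.
  by rewrite big_cons.
rewrite big_cons -(IH k kE); apply: amapD => y p.
by rewrite hE big_cons kE.
Qed.

Lemma afunctor_cancel M N (f : qhom M N) (g : qhom N M) :
  (forall x m, g x (f x m) = m) -> forall x m, amap T g x (amap T f x m) = m.
Proof.
move=> gf x m; rewrite -(amapM T (h := qcomp g f))//.
by apply: amap1 => y p; rewrite /= gf.
Qed.

Lemma afunctor_iso M N : qiso M N -> qiso (T M) (T N).
Proof.
move=> /qisoP[f [g [fg gf]]]; apply: (@qisoI _ _ _ (amap T f) (amap T g)) => x m;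
  apply: afunctor_cancel => y p; [exact: fg|exact: gf].
Qed.

Hypothesis Trep : forall s : C, fgproj (T (qrep s)).

(** A dual basis exhibits P as a retract of a finite sum of representable modules,
    and an additive functor preserves this situation. *)
Lemma afunctor_fgproj P : fgproj P -> fgproj (T P).
Proof.
move=> /fgprojP[[J s b a abP]].
apply: (@fgproj_sum _ _ J (fun j => T (qrep (s j))) (fun j => amap T (yo (b j)))
  (fun j => amap T (a j))) => [x p|j]; last exact: Trep.
rewrite -[RHS](amap1 T (f := qid P))//.
rewrite (amap_sumr (r := index_enum J) (f := fun j => qcomp (yo (b j)) (a j))).
  by apply: eq_bigr => j _; rewrite -(amapM T (h := qcomp (yo (b j)) (a j))).
by move=> y m; rewrite /= abP.
Qed.

(** Exact sequences of f.g. projective modules split, and additive functors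
    preserve split exact sequences. *)
Lemma afunctor_exact P' P P'' (f : qhom P' P) (g : qhom P P'') :
  fgproj P'' -> short_exact f g -> short_exact (amap T f) (amap T g).
Proof.
move=> pP'' /(split_exact pP'')[r [s [rf gs rs gf frsg]]]; split=> [x|x p|x p].
- exact: (can_inj (fun m => afunctor_cancel rf m)).
- split=> [gp|[m <-]]; last first.
    rewrite -(amapM T (h := qcomp g f))// (amap0 (f := qcomp g f))//.
  exists (amap T r x p); rewrite -[RHS](amap1 T (f := qid P))//.
  rewrite (amapD T (f := qcomp f r) (g := qcomp s g)); last by move=> y q; rewrite /= frsg.
  by rewrite (amapM T (f := g) (g := s) (h := qcomp s g))// gp linear0 addr0 -(amapM T (h := qcomp f r)).
- by exists (amap T s x p); apply: afunctor_cancel.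
Qed.

Lemma afunctor_additive : exact_additive (fun P => K0cl (T P)).
Proof.
move=> P' P P'' f g p' p p'' fg; apply: (K0cl_exact (f := amap T f) (g := amap T g));
  try exact: afunctor_fgproj; exact: afunctor_exact.
Qed.

Definition K0map : {linear K0 C -> K0 D} := K0lift afunctor_additive.
Lemma K0mapE P : fgproj P -> K0map (K0cl P) = K0cl (T P).
Proof. exact: K0liftE. Qed.
End AFunctorTheory.

Section FunctorFamily.
Variables (C : category) (I : Type) (D : I -> category) (T : forall i, afunctor C (D i)).
Hypothesis Trep : forall i (s : C), fgproj (T i (qrep s)).
Hypothesis Tfin : forall P, fgproj P ->
  exists2 A : set I, finite_set A & forall i, ~ A i -> forall x (p : T i P x), p = 0.

Local Notation DS := (dsum (fun i => K0 (D i))).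

Let F (P : qmodule C) : DS := xget 0 [set d : DS | forall i, d i = K0cl (T i P)].

Let FE P : fgproj P -> forall i, F P i = K0cl (T i P).
Proof.
move=> pP; rewrite /F; set A := (X in xget _ X).
suff : exists d, A d by move/(xgetPex 0).
have [B finB B0] := Tfin pP.
have fin : finite_set [set i | K0cl (T i P) != 0].
  apply: sub_finite_set finB => i /= Ti; apply: contrapT => /B0 Ti0.
  by move: Ti; rewrite (exact_additive0 (@K0cl_additive _) Ti0) eqxx.
by exists (DSum fin).
Qed.

Let F_additive : exact_additive F.
Proof.
move=> P' P P'' f g p' p p'' fg; apply: dsumP => i; rewrite dsumDE !FE//.
exact: afunctor_additive fg.
Qed.

(** The map with values in the direct sum needs that, for fixed P, almost all of
    the modules T_i P vanish. *)
Definition K0family : {linear K0 C -> DS} := K0lift F_additive.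
Lemma K0familyE P i : fgproj P -> K0family (K0cl P) i = K0cl (T i P).
Proof. by move=> pP; rewrite K0liftE ?FE. Qed.
End FunctorFamily.

(** * The functors Res, S and the tensor product with a biset *)
Section ResFunctor.
Variables (C : category) (x : C).
Definition res_map M N (f : qhom M N) : qhom (qres M x) (qres N x) :=
  @QHom (BG (aut x)) (qres M x) (qres N x) (fun=> f x) (fun _ _ a m => qnat f a m).
Definition res_functor : afunctor C (BG (aut x)).
Proof.
exists (fun M => qres M x) res_map => M.
- by move=> f f1 [] m; apply: f1.
- by move=> N P f g h hE [] m; apply: hE.
- by move=> N f g h hE [] m; apply: hE.
Defined.
End ResFunctor.

Section SFunctor.
Variables (C : category) (x : C).

Section Map.
Variables (M N : qmodule C) (f : qhom M N).
Lemma Smap_subproof m : Sgen m -> (lpi (@Sgen C N x) \o f x) m = 0.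
Proof.
move=> [y [u [m' [nu ->]]]] /=; rewrite qnat -(linear0 (lpi _)); apply/lpiP.
by rewrite subr0; apply: lspan_sub; exists y, u, (f y m').
Qed.
Definition Smap_fun : {linear lquot (@Sgen C M x) -> lquot (@Sgen C N x)} := lqlift Smap_subproof.
Lemma Smap_funE m : Smap_fun (lpi (@Sgen C M x) m) = lpi (@Sgen C N x) (f x m).
Proof. exact: lqlift_pi. Qed.
Lemma Smap_nat y z (a : @hom (BG (aut x)) y z) m :
  Smap_fun (qact (Smod M x) a m) = qact (Smod N x) a (Smap_fun m).
Proof.
have: Smap_fun \o Sact M (a : aut x) =1 Sact N (a : aut x) \o Smap_fun; last exact.
apply: lquot_ext => {}m.
rewrite -[LHS]/(Smap_fun (Sact M _ _)) -[RHS]/(Sact N _ (Smap_fun _)) Sact_pi.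
by rewrite !Smap_funE [RHS]Sact_pi qnat.
Qed.
Definition Smap : qhom (Smod M x) (Smod N x) :=
  @QHom (BG (aut x)) (Smod M x) (Smod N x) (fun=> Smap_fun) Smap_nat.
Lemma SmapE m : Smap tt (lpi (@Sgen C M x) m) = lpi (@Sgen C N x) (f x m).
Proof. exact: Smap_funE. Qed.
End Map.

Definition S_functor : afunctor C (BG (aut x)).
Proof.
exists (fun M => Smod M x) Smap => M.
- move=> f f1 [] m; apply: (@lquot_ext _ _ _ _ (Smap f tt) idfun) => {}m.
  by rewrite SmapE f1.
- move=> N P f g h hE [] m.
  apply: (@lquot_ext _ _ _ _ (Smap h tt) (Smap g tt \o Smap f tt)) => {}m.
  by rewrite -[RHS]/(Smap g tt (Smap f tt _)) !SmapE hE.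
- move=> N f g h hE [] m.
  apply: (@lquot_ext _ _ _ _ (Smap h tt) (Smap f tt \+ Smap g tt)) => {}m.
  by rewrite -[RHS]/(Smap f tt _ + Smap g tt _) !SmapE hE linearD.
Defined.

Lemma Smod0 (M : qmodule C) : (forall m : M x, lpi (@Sgen C M x) m = 0) ->
  forall y (m : Smod M x y), m = 0.
Proof. by move=> M0 [] m; rewrite -[m]lpi_repr M0. Qed.

Lemma Sgen0 (M : qmodule C) y (u : hom x y) (m : M y) : ~ is_iso u -> lpi (@Sgen C M x) (qact M u m) = 0.
Proof.
move=> nu; rewrite -(linear0 (lpi _)); apply/lpiP; rewrite subr0; apply: lspan_sub.
by exists y, u, m.
Qed.

(** If all modules at the targets of non-isomorphisms out of x vanish, nothing is
    divided out. *)
Lemma Smod_res (M : qmodule C) : (forall y (u : hom x y) (m : M y), ~ is_iso u -> m = 0) ->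
  qiso (qres M x) (Smod M x).
Proof.
move=> M0.
have nat (y z : BG (aut x)) (a : hom y z) (m : qres M x z) :
  lpi (@Sgen C M x) (qact (qres M x) a m) = qact (Smod M x) a (lpi (@Sgen C M x) m).
  by rewrite [RHS]Sact_pi.
have idK k : Sgen k -> (idfun : {linear M x -> M x}) k = 0.
  by move=> [y [u [m [nu ->]]]]; rewrite [m](M0 y u)// linear0.
pose f := @QHom (BG (aut x)) (qres M x) (Smod M x) (fun=> lpi (@Sgen C M x)) nat.
exists f => y; exists (lqlift idK) => m; first exact: lqlift_pi.
by rewrite -[m]lpi_repr; congr (lpi _ _); exact: lqlift_pi.
Qed.
End SFunctor.

Section TensorFunctor.
Variables (G : groupType) (C : category) (X : biset G C).

Local Notation BT N := (bten (@gact G N) (@blact G C X _)).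

Section Map.
Variables (M N : qmodule (BG G)) (f : qhom M N).
Lemma tensb_map_subproof m g : f tt (gact m g) = gact (f tt m) g.
Proof. exact: qnat. Qed.
Definition tensb_map_fun x : {linear tensb X M x -> tensb X N x} :=
  @tmap rat G (M tt) (freemod rat (X x)) (N tt) (freemod rat (X x))
    (@gact G M) (fun g => freemap rat (@blact G C X x g))
    (@gact G N) (fun g => freemap rat (@blact G C X x g))
    (f tt) idfun tensb_map_subproof (fun _ _ => erefl).
Lemma tensb_map_bten x m (t : X x) : tensb_map_fun x (BT M m t) = BT N (f tt m) t.
Proof. exact: tmap_ten. Qed.
Lemma tensb_act_bten x y (u : hom x y) m (t : X y) :
  qact (tensb X M) u (BT M m t) = BT M m (bract X u t).
Proof.
by rewrite -[LHS]/(btens_act X M u (BT M m t)) /btens_act tmap_ten /blin_act freemap_basis.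
Qed.
End Map.
Definition tensb_map M N (f : qhom M N) : qhom (tensb X M) (tensb X N).
Proof.
exists (tensb_map_fun f) => x y u m.
apply: (@tenfree_ext _ _ _ _ _ _ _ (tensb_map_fun f x \o btens_act X M u)
  (btens_act X N u \o tensb_map_fun f y)) => a t.
rewrite -[LHS]/(tensb_map_fun f x (qact (tensb X M) u _)).
rewrite -[RHS]/(qact (tensb X N) u (tensb_map_fun f y _)).
by rewrite tensb_act_bten !tensb_map_bten tensb_act_bten.
Defined.

Lemma tensb_ext (M : qmodule (BG G)) x (N : lmodType rat) (f g : {linear tensb X M x -> N}) :
  (forall m (t : X x), f (BT M m t) = g (BT M m t)) -> f =1 g.
Proof. exact: tenfree_ext. Qed.

Lemma tensb_mapE M N (f : qhom M N) x m (t : X x) : 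
  tensb_map f x (BT M m t) = BT N (f tt m) t.
Proof. exact: tensb_map_bten. Qed.

Definition tensb_functor : afunctor (BG G) C.
Proof.
exists (tensb X) tensb_map => M.
- move=> f f1 x m; apply: (@tensb_ext _ _ _ (tensb_map f x) idfun) => {}m t.
  by rewrite tensb_mapE f1.
- move=> N P f g h hE x m.
  apply: (@tensb_ext _ _ _ (tensb_map h x) (tensb_map g x \o tensb_map f x)) => {}m t.
  by rewrite -[RHS]/(tensb_map g x (tensb_map f x _)) !tensb_mapE hE.
- move=> N f g h hE x m.
  apply: (@tensb_ext _ _ _ (tensb_map h x) (tensb_map f x \+ tensb_map g x)) => {}m t.
  rewrite -[RHS]/(tensb_map f x _ + tensb_map g x _) !tensb_mapE hE.
  exact: (linearD (mklin (bten_linear _ _ t))).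
Defined.
Section Desc.
Variables (M : qmodule (BG G)) (N : qmodule C).
Variable F : forall x, X x -> {linear M tt -> N x}.
Hypothesis FG : forall x m g (t : X x), F t (gact m g) = F (blact X g t) m.
Hypothesis Fnat : forall x y (u : hom x y) m (t : X y), F (bract X u t) m = qact N u (F t m).
Let Ff x : {linear tensb X M x -> N x} := tenfree_lift (@FG x).
Let Ffnat x y (u : hom x y) m : Ff x (qact (tensb X M) u m) = qact N u (Ff y m).
Proof.
apply: (@tensb_ext _ _ _ (Ff x \o qact (tensb X M) u) (qact N u \o Ff y)) => {}m t.
rewrite -[LHS]/(Ff x (qact (tensb X M) u _)) -[RHS]/(qact N u (Ff y _)).
by rewrite tensb_act_bten /Ff !tenfree_liftE.
Qed.
(** The form in which all natural maps out of a tensor product with Q[X] are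
    defined below. *)
Definition tensb_desc : qhom (tensb X M) N := QHom Ffnat.
Lemma tensb_descE x m (t : X x) : tensb_desc x (BT M m t) = F t m.
Proof. exact: tenfree_liftE. Qed.
End Desc.

Lemma tensb_unit : qiso (tensb X (qrep (tt : BG G))) (blin X).
Proof.
pose F x (t : X x) : {linear qrep (tt : BG G) tt -> blin X x} :=
  flift (fun g : G => fbasis rat (blact X g t)).
have FG x m g (t : X x) : F x t (gact m g) = F x (blact X g t) m.
  apply: (@freemod_ext _ _ _ (F x t \o blin_act (brep (tt : BG G)) (g : @hom (BG G) tt tt))
    (F x (blact X g t))) => h.
  rewrite -[LHS]/(F x t (freemap rat (fun k : G => (k * g)%g) (fbasis rat (h : G)))).
  by rewrite freemap_basis /F !flift_basis -blactM.
have Fnat x y (u : hom x y) m (t : X y) :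
    F x (bract X u t) m = qact (blin X) u (F y t m).
  apply: (@freemod_ext _ _ _ (F x (bract X u t)) (qact (blin X) u \o F y t)) => h.
  rewrite -[RHS]/(freemap rat (bract X u) (F y t (fbasis rat (h : G)))).
  by rewrite /F !flift_basis blractC.
pose f := tensb_desc FG Fnat; pose e : qrep (tt : BG G) tt := fbasis rat (1%g : G).
pose g x : {linear freemod rat (X x) -> tensb X (qrep (tt : BG G)) x} :=
  flift (fun t : X x => BT (qrep (tt : BG G)) e t).
exists f => x; exists (g x) => m.
  apply: (@tensb_ext _ _ _ (g x \o f x) idfun) => {}m t.
  rewrite -[LHS]/(g x (f x _)) /f tensb_descE.
  have l1 : linear (fun m => BT (qrep (tt : BG G)) m t) by exact: bten_linear.
  apply: (@freemod_ext _ _ _ (g x \o F x t) (mklin l1)) => h.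
  rewrite -[LHS]/(g x (F x t _)) -[RHS]/(BT (qrep (tt : BG G)) _ t).
  rewrite /F flift_basis /g flift_basis -btenS; congr (BT _ _ t).
  rewrite -[LHS]/(freemap rat (fun k : G => (k * h)%g) (fbasis rat (1%g : G))).
  by rewrite freemap_basis mul1g.
apply: (@freemod_ext _ _ _ (f x \o g x) idfun) => t.
rewrite -[LHS]/(f x (g x _)) /g flift_basis /f tensb_descE.
by rewrite /F /e flift_basis blact1.
Qed.

Hypothesis pX : fgproj (blin X).
Lemma tensb_fgproj P : fgproj P -> fgproj (tensb X P).
Proof.
apply: (afunctor_fgproj (T := tensb_functor)) => -[].
exact: fgproj_iso tensb_unit pX.
Qed.
End TensorFunctor.

Lemma brep_fgproj (C : category) (x : C) : fgproj (blin (brep x)).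
Proof. exact: fgproj_qrep. Qed.

Section BprodAssoc.
Variables (A G : groupType) (C : category).
Variables (X : biset A (BG G)) (Y : biset G C) (P : qmodule (BG A)).

Local Notation B1 := (bten (@gact A P) (@blact A C (bprod X Y) _)).
Local Notation B2 := (bten (@gact A P) (@blact A (BG G) X tt)).
Local Notation B3 := (bten (@gact G (tensb X P)) (@blact G C Y _)).

Local Notation PR a b := (@bp_pair A G C X Y _ a b).

(** Both maps exchange p (x) [a, b] and (p (x) a) (x) b. The first one is well
    defined as the choice of the representative (a, b) does not matter in the
    second module. *)
Lemma tensb_bprod : qiso (tensb (bprod X Y) P) (tensb Y (tensb X P)).
Proof.
have l1 (z : C) (w : bprod X Y z) :
  linear (fun p : P tt => B3 (B2 p (repr w).1) (repr w).2).
  by move=> a p q; rewrite [B2 _ _]bten_linear bten_linear.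
have pairE (z : C) (p : P tt) (a : X tt) (b : Y z) :
   B3 (B2 p (repr (@bp_pair A G C X Y z a b)).1) (repr (@bp_pair A G C X Y z a b)).2
   = B3 (B2 p a) b.
  have /bp_pairP [g [e1 e2]] := esym (bp_repr (@bp_pair A G C X Y z a b)).
  rewrite e1 [X in _ = B3 _ X]e2 -btenS; congr (B3 _ _); apply/esym.
  exact: (@tensb_act_bten A (BG G) X P tt tt g).
pose F1 (z : C) (w : bprod X Y z) : {linear P tt -> tensb Y (tensb X P) z} := mklin (l1 z w).
have F1E (z : C) (p : P tt) (a : X tt) (b : Y z) : F1 z (PR a b) p = B3 (B2 p a) b.
  exact: pairE.
have F1G (z : C) (p : P tt) g (w : bprod X Y z) : F1 z w (gact p g) = F1 z (blact (bprod X Y) g w) p.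
  elim/bp_ind: w => a b; rewrite [blact _ _ _]bp_lactE !F1E.
  by congr (B3 _ _); apply: btenS.
have F1nat (x y : C) (u : hom x y) p (w : bprod X Y y) :
    F1 x (bract (bprod X Y) u w) p = qact (tensb Y (tensb X P)) u (F1 y w p).
  elim/bp_ind: w => a b; rewrite [bract _ _ _]bp_ractE !F1E.
  by rewrite tensb_act_bten.
have l2 (z : C) (a : X tt) (b : Y z) : linear (fun p : P tt => B1 p (PR a b)).
  exact: bten_linear.
have l2S (z : C) (b : Y z) p g (a : X tt) :
    mklin (l2 z a b) (gact p g) = mklin (l2 z (blact X g a) b) p.
  rewrite -[LHS]/(B1 (gact p g) (PR a b)) -[RHS]/(B1 p (PR (blact X g a) b)).
  by rewrite btenS [blact _ _ _]bp_lactE.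
pose F2 (z : C) (b : Y z) : {linear tensb X P tt -> tensb (bprod X Y) P z} :=
  tenfree_lift (l2S z b).
have F2E (z : C) (p : P tt) (a : X tt) (b : Y z) : F2 z b (B2 p a) = B1 p (PR a b).
  exact: tenfree_liftE.
have F2G (z : C) (m : tensb X P tt) g (b : Y z) : F2 z b (@gact G (tensb X P) m g) = F2 z (blact Y g b) m.
  have: F2 z b \o qact (tensb X P) (g : @hom (BG G) tt tt) =1 F2 z (blact Y g b); last exact.
  apply: tensb_ext => p a; rewrite -[LHS]/(F2 z b (qact (tensb X P) _ _)).
  rewrite tensb_act_bten !F2E; congr (B1 p _); apply/bp_pairP; exists g; split=> //.
have F2nat (x y : C) (u : hom x y) m (b : Y y) :
    F2 x (bract Y u b) m = qact (tensb (bprod X Y) P) u (F2 y b m).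
  have: F2 x (bract Y u b) =1 qact (tensb (bprod X Y) P) u \o F2 y b; last exact.
  apply: tensb_ext => p a; rewrite -[RHS]/(qact (tensb (bprod X Y) P) u (F2 y b _)).
  by rewrite !F2E tensb_act_bten [bract (bprod _ _) _ _]bp_ractE.
pose f := tensb_desc F1G F1nat; pose g := tensb_desc F2G F2nat.
have fE (z : C) (p : P tt) (a : X tt) (b : Y z) : f z (B1 p (PR a b)) = B3 (B2 p a) b.
  by rewrite /f tensb_descE F1E.
have gE (z : C) (p : P tt) (a : X tt) (b : Y z) : g z (B3 (B2 p a) b) = B1 p (PR a b).
  by rewrite /g tensb_descE F2E.
apply: (qisoI (f := f) (g := g)) => z m.
  have: g z \o f z =1 idfun; last exact.
  apply: tensb_ext => p w; elim/bp_ind: w => a b.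
  by rewrite -[LHS]/(g z (f z _)) fE gE.
have: f z \o g z =1 idfun; last exact.
apply: tensb_ext => t b.
have lb : linear (fun t => B3 t b) by exact: bten_linear.
have: (f z \o g z) \o mklin lb =1 mklin lb; last exact.
apply: tensb_ext => p a.
by rewrite -[LHS]/(f z (g z (B3 _ b))) gE fE.
Qed.
End BprodAssoc.

(** * Coordinates in free modules *)
Section FreeCoord.
Variables (R : comPzRingType) (T : Type).

Lemma freemod_ext_supp (N : lmodType R) (f g : {linear freemod R T -> N}) (u : freemod R T) :
  (forall t, u t != 0 -> f (fbasis R t) = g (fbasis R t)) -> f u = g u.
Proof.
move=> fg; rewrite (dsum_sum u).
have fin : finite_set [set t : {classic T} | u t != 0]%classic by exact: dsum_finite.
rewrite fsbig_finite//= !linear_sum big_seq [RHS]big_seq; apply: eq_bigr => t.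
rewrite in_fset_set// inE => /= ut.
have -> : din (fun _ : T => R^o : lmodType R) t (u t) = (u t) *: fbasis R t.
  by rewrite -linearZ; congr din; rewrite /*:%R /= mulr1.
by rewrite !linearZ fg.
Qed.

Lemma fbasisE (t t' : T) : (fbasis R t : freemod R T) t' = (`[< t = t' >])%:R.
Proof.
rewrite /fbasis; case: asboolP => [<-|tt']; first by rewrite dinE.
by rewrite dinN.
Qed.

(** For a bijection the pushforward of a function with finite support is its
    composite with the inverse. *)
Lemma freemap_coord (f g : T -> T) (u : freemod R T) t :
  cancel f g -> cancel g f -> freemap R f u t = u (g t).
Proof.
move=> fg gf; pose M := fun _ : T => R^o : lmodType R.
have: (dcoord (M := M) t \o freemap R f) =1 dcoord (M := M) (g t); last exact.
apply: (@freemod_ext R T (R^o) (dcoord (M := M) t \o freemap R f) (dcoord (M := M) (g t))) => s.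
rewrite -[LHS]/(freemap R f (fbasis R s) t) freemap_basis -[RHS]/(fbasis R s (g t)).
rewrite !fbasisE; congr (nat_of_bool _)%:R; apply/asboolP/asboolP => [<-|->//].
by rewrite fg.
Qed.
End FreeCoord.

(** * Traces and dual bases over group rings *)
Section GroupBasis.
Variable G : groupType.
Implicit Types P Q : qmodule (BG G).
Local Notation QG := (qrep (tt : BG G)).

Record gbasis P := GBasis {
  gb_ix : finType;
  gb_b : gb_ix -> P tt;
  gb_a : gb_ix -> qhom P QG;
  gbP : forall p, \sum_j yo (gb_b j) tt (gb_a j tt p) = p }.

Lemma fgproj_gbasis P : fgproj P <-> inhabited (gbasis P).
Proof.
split=> [/fgprojP[[J s b a abP]]|[[J b a abP]]]; last first.
  apply/fgprojP; constructor; apply: (@DBasis _ P J (fun=> tt) b a) => -[]; exact: abP.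
have es : (fun=> tt) = s by apply: funext => j; case: (s j).
by case: s / es b a abP => b a abP; constructor; exists J b a => p; apply: abP.
Qed.

(** The trace of an endomorphism read off at the unit of G; for the identity it is
    the L^2-dimension of P. *)
Definition gtrace P (B : gbasis P) (f : qhom P P) : rat :=
  \sum_(j : gb_ix B) (gb_a j tt (f tt (gb_b j)) : freemod rat G) 1%g.

End GroupBasis.

Section RightSet.
Variables (A H : groupType) (X : biset A (BG H)).
Local Notation QH := (qrep (tt : BG H)).
Local Notation ract := (@rgact A H X).

Hypothesis stab_fin : forall x, finite_set [set h : H | ract x h = x]%classic.
Hypothesis orb_fin : finite_set
  [set [set ract x h | h in [set: H]] | x in [set: X tt]]%classic.

Let ractM x g h : ract x (g * h)%g = ract (ract x g) h.
Proof. exact: (@bractM _ _ X tt tt tt). Qed.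
Let ract1 x : ract x 1%g = x.
Proof. exact: (@bract1 _ _ X tt). Qed.

Lemma transversal_ex : exists n (x : 'I_n -> X tt),
  forall y, exists i, (exists h, ract (x i) h = y) /\
    forall j h, ract (x j) h = y -> j = i.
Proof.
pose orb x := [set ract x h | h in [set: H]]%classic.
have [s sE] := (finite_seqP _).1 orb_fin.
have orbP x y : orb x = orb y -> exists h, ract x h = y.
  move=> e; have : orb y y by exists 1%g.
  by rewrite -e => -[h _ <-]; exists h.
have orbE x h : orb (ract x h) = orb x.
  apply/seteqP; split=> [y [k _ <-]|y [k _ <-]]; first by exists (h * k)%g; rewrite ?ractM.
  by exists (h^-1 * k)%g => //; rewrite -ractM mulgA mulgV mul1g.
pose t := undup s.
have rep (i : 'I_(size t)) : exists x, orb x = nth set0 t i.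
  have : nth set0 t i \in s by rewrite -mem_undup mem_nth.
  move=> h; have : [set` s]%classic (nth set0 t i) by [].
  by rewrite -sE => -[x _ <-]; exists x.
exists (size t), (fun i => projT1 (cid (rep i))) => y.
have ys : orb y \in t.
  rewrite mem_undup; have : [set` s]%classic (orb y) by rewrite -sE; exists y.
  by [].
have lt : (index (orb y) t < size t)%N by rewrite index_mem.
exists (Ordinal lt); split=> [|j h].
  by apply: orbP; case: cid => x /= ->; rewrite nth_index.
case: cid => x /= xj xy; apply: val_inj => /=.
by rewrite -xy orbE xj index_uniq// undup_uniq.
Qed.

Section VSum.
Variable x : X tt.

Lemma vsum_subproof y :
  finite_set [set h : H | (`[< ract x h = y >]%:R : rat) != 0]%classic.
Proof.
have sub : ([set h : H | (`[< ract x h = y >]%:R : rat) != 0] `<=`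
    [set h : H | ract x h = y])%classic.
  by move=> h /=; case: asboolP => //; rewrite eqxx.
apply: (sub_finite_set sub).
have [[h0 xh0]|nh] := pselect (exists h0, ract x h0 = y); last first.
  by apply: sub_finite_set (finite_set0 H) => h /= e; apply: nh; exists h.
have : finite_set [set (h * h0)%g | h in [set h : H | ract x h = x]]%classic.
  exact: finite_image.
apply: sub_finite_set => h /= xh; exists (h * h0^-1)%g; last by rewrite -mulgA mulVg mulg1.
by rewrite /= ractM xh -xh0 -ractM mulgV ract1.
Qed.

(** The sum of the group elements that carry x to y: up to the order of the
    stabilizer of x it is the coordinate of y along x in Q[X]. It is given by its
    coefficients, so that equivariance becomes a substitution. *)
Definition vsum y : freemod rat H := DSum (M := fun=> rat^o) (vsum_subproof y).

Lemma vsum_shift y h : vsum (ract y h) = freemap rat (fun k => (k * h)%g) (vsum y).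
Proof.
apply: dsumP => k; rewrite (@freemap_coord _ _ _ (fun k => (k * h^-1)%g)).
- rewrite /=; congr (nat_of_bool _)%:R; apply/asboolP/asboolP => [xk|xk].
    by rewrite ractM xk -ractM mulgV ract1.
  by rewrite -xk -ractM -mulgA mulVg mulg1.
- by move=> l; rewrite -mulgA mulgV mulg1.
- by move=> l; rewrite -mulgA mulVg mulg1.
Qed.

(** The augmentation counts the elements in the sums vsum; in particular it gives
    the order of the stabilizer of x at vsum x. *)
Definition aug : {linear freemod rat H -> rat^o} := flift (fun=> 1 : rat^o).

Lemma aug_vsum h : aug (vsum (ract x h)) = aug (vsum x).
Proof.
rewrite vsum_shift.
have: aug \o freemap rat (fun k => (k * h)%g) =1 aug; last exact.
by apply: freemod_ext => k; rewrite /= freemap_basis /aug !flift_basis.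
Qed.

Lemma aug_vsum_neq0 : aug (vsum x) != 0.
Proof.
rewrite (dsum_sum (vsum x)).
have fin := dsum_finite (vsum x : freemod rat H).
rewrite (fsbig_finite _ _ (fin : finite_set ([set i : {classic H} | vsum x i != 0]%classic))) linear_sum.
set s := finmap.enum_fset _.
have -> : \sum_(h <- s) aug (din (fun _ : H => rat^o : lmodType rat) h (vsum x h))
    = \sum_(h <- s) (1 : rat).
  rewrite big_seq [RHS]big_seq; apply: eq_bigr => h; rewrite in_fset_set// inE => /= xh.
  rewrite [LHS]dlift_in /fscale.
  by move: xh; case: asboolP => _; rewrite ?eqxx// scale1r.
rewrite big_const_seq count_predT iter_addr addr0 pnatr_eq0 -lt0n.
have : (1%g : {classic H}) \in s.
  by rewrite in_fset_set// inE /= ract1; case: asboolP.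
by case: (s : seq _).
Qed.

Lemma vsum_act y : freemap rat (ract x) (vsum y) = aug (vsum y) *: fbasis rat y.
Proof.
pose g := fscale (fbasis rat y : freemod rat (X tt)) : {linear rat^o -> freemod rat (X tt)}.
rewrite -[RHS]/((g \o aug) (vsum y)); apply: freemod_ext_supp => h /= xh.
rewrite freemap_basis /aug flift_basis /fscale scale1r.
by move: xh; case: asboolP => [->//|]; rewrite eqxx.
Qed.

(** The average over the stabilizer of x of the elements that carry x to y. The map
    is packed with its values on the basis to keep its definition opaque. *)
Lemma vcoef_sig : {f : {linear freemod rat (X tt) -> freemod rat H} |
  forall y, f (fbasis rat y) = (aug (vsum x))^-1 *: vsum y}.
Proof. by exists (flift (fun y => (aug (vsum x))^-1 *: vsum y)) => y; apply: flift_basis. Qed.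
Definition vcoef := sval vcoef_sig.
Lemma vcoefE y : vcoef (fbasis rat y) = (aug (vsum x))^-1 *: vsum y.
Proof. exact: (svalP vcoef_sig). Qed.
End VSum.

Definition vcoef_at x (u : BG H) : {linear blin X u -> QH u} :=
  match u with tt => vcoef x end.
Lemma vcoef_nat x (u v : BG H) (h : hom u v) m :
  vcoef_at x u (qact (blin X) h m) = qact QH h (vcoef_at x v m).
Proof.
case: u h; case: v m => m h.
have: vcoef x \o freemap rat (ract^~ h) =1 freemap rat (fun k : H => (k * h)%g) \o vcoef x; last exact.
apply: freemod_ext => y.
rewrite -[LHS]/(vcoef x (freemap rat (ract^~ h) (fbasis rat y))).
rewrite -[RHS]/(freemap rat (fun k : H => (k * h)%g) (vcoef x (fbasis rat y))).
rewrite freemap_basis.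
rewrite vcoefE.
rewrite vcoefE.
rewrite vsum_shift.
exact/esym/linearZ.
Qed.
Definition vcoef_hom x : qhom (blin X) QH := QHom (vcoef_nat x).

Definition lact_hom (g : A) : qhom (blin X) (blin X).
Proof.
exists (fun x => freemap rat (@blact A (BG H) X x g)) => x y u m.
exact/esym/btens_subproof.
Defined.

(** The dual basis consists of representatives of the orbits, with the averages
    over the stabilizers as coordinates. The trace of g is a weighted count of
    representatives that g fixes. *)
Lemma rset_gbasis : exists B : gbasis (blin X),
  forall g, (forall x : X tt, blact X g x <> x) -> gtrace B (lact_hom g) = 0.
Proof.
have [n [x xP]] := transversal_ex.
have dec p : \sum_j yo (fbasis rat (x j) : blin X tt) tt (vcoef_hom (x j) tt p) = p.
  have yoF j : yo (fbasis rat (x j) : blin X tt) tt =1 freemap rat (ract (x j)).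
    by apply: freemod_ext => h; rewrite yoE freemap_basis /= /blin_act freemap_basis.
  pose f := qsumh (fun j => qcomp (yo (fbasis rat (x j) : blin X tt)) (vcoef_hom (x j))).
  have: f tt =1 idfun; last exact.
  apply: freemod_ext => y.
  rewrite -[LHS]/(\sum_j yo (fbasis rat (x j) : blin X tt) tt (vcoef (x j) (fbasis rat y))).
  have [i [[h xh] ui]] := xP y.
  rewrite (bigD1 i)//= big1.
    rewrite [LHS]addr0 -[LHS]/(yo (fbasis rat (x _) : blin X tt) tt (vcoef (x i) _)) yoF vcoefE linearZ_LR.
    by rewrite vsum_act scalerA -xh aug_vsum mulVf ?scale1r// aug_vsum_neq0.
  move=> j ji; rewrite -[LHS]/(yo (fbasis rat (x _) : blin X tt) tt (vcoef (x j) _)) yoF vcoefE.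
  suff -> : vsum (x j) y = 0 by rewrite scaler0 linear0.
  apply: dsumP => k /=; case: asboolP => // /ui e.
  by rewrite e eqxx in ji.
exists (GBasis dec) => g gx; rewrite /gtrace big1// => j _ /=.
rewrite freemap_basis vcoefE dsumZE /= ract1.
by case: asboolP => [/esym/gx//|_]; rewrite [_ *: _]mulr0.
Qed.
End RightSet.

(** * The trace of the group von Neumann algebra *)
Section TraceProperty.
Variables (R : realType) (G : groupType).
Local Notation E2 := (ell2 R G).
Local Notation delta := (l2_unit R G).
Implicit Types (a b : vN R G) (u v : E2) (S : set G).

Lemma sqnorm_eq0 (z : R[i]) : sqnorm z = 0 -> z = 0.
Proof.
case: z => x y /eqP; rewrite /sqnorm /= paddr_eq0 ?sqr_ge0// !sqrf_eq0.
by move=> /andP[/eqP -> /eqP ->].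
Qed.

Lemma ell2DE (z : R[i]) u v g : (z *: u + v : E2) g = z * u g + v g.
Proof. by []. Qed.

Lemma ell2_sumE (I : Type) (r : seq I) (F : I -> E2) g :
  (\sum_(i <- r) F i) g = \sum_(i <- r) F i g.
Proof.
elim: r => [|i r IH]; first by rewrite !big_nil.
by rewrite !big_cons -IH -[X in (X + _ : E2) g]scale1r ell2DE mul1r.
Qed.

Lemma vN_sum a (I : Type) (r : seq I) (F : I -> E2) :
  a (\sum_(i <- r) F i) = \sum_(i <- r) a (F i).
Proof. exact: (linear_sum (mklin (vN_linear a))). Qed.

Lemma vN_opZ a (z : R[i]) u : a (z *: u) = z *: a u.
Proof.
have a0 : a 0 = 0 by have := vN_linear a (-1) 0 0; rewrite scaler0 addr0 scaleN1r addNr.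
by rewrite -[z *: u]addr0 vN_linear a0 addr0.
Qed.

(** The restriction of u to S, written as a finite combination of translates of
    delta, on which equivariant operators are easy to evaluate. *)
Definition truncl2 S u : E2 := \sum_(g \in S) u g *: ltrans g delta.

Lemma ltrans_delta g h : ltrans g delta h = (h == g)%:R.
Proof.
rewrite /= eq_sym; congr (nat_of_bool _)%:R; apply/eqP/eqP => [e|->]; last by rewrite mulVg.
by rewrite -(mulVKg g h) -e mulg1.
Qed.

Lemma truncl2E S u h : finite_set S -> truncl2 S u h = if `[< S h >] then u h else 0.
Proof.
move=> fS; rewrite /truncl2 fsbig_finite// ell2_sumE.
have zE (z : R[i]) (v : E2) g : (z *: v : E2) g = z * v g.
  by rewrite -[z *: v]addr0 ell2DE addr0.
under eq_bigr => g _ do rewrite zE ltrans_delta.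
rewrite -(fsbig_finite _ (fun g => u g * (h == g)%:R) fS).
case: asboolP => Sh; last first.
  rewrite fsbig1// => g Sg; case: eqP => [hg|_]; last by rewrite mulr0.
  by rewrite hg in Sh.
rewrite (fsbigD1 h)//= eqxx mulr1 fsbig1 ?addr0// => g [_ gh].
by case: eqP => [hg|_]; [case: gh|rewrite mulr0].
Qed.

Lemma truncl2_approx u (e : R) : 0 < e -> exists2 S0, finite_set S0 &
  forall S, finite_set S -> (S0 `<=` S)%classic -> (l2sq (u - truncl2 S u)%R <= e%:E)%E.
Proof.
move=> e0; pose f g := (sqnorm (u g))%:E.
have f0 g : (0 <= f g)%E by rewrite lee_fin sqnorm_ge0.
have fin : l2sq u \is a fin_num.
  by rewrite ge0_fin_numE ?l2sq_ge0//; have := valP u; rewrite inE.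
have [_ [X [fX _] <-]] := ub_ereal_sup_adherent e0 fin.
rewrite -/(esum [set: G] f) -/(l2sq u) => Xe.
exists X => // S fS XS.
have -> : l2sq (u - truncl2 S u)%R = (\esum_(g in ([set: G] `&` ~` S)%classic) f g)%E.
  rewrite setTI esum_mkcond; apply: eq_esum => g _.
  have -> : (u - truncl2 S u : E2) g = u g - truncl2 S u g.
    by rewrite -[u - _]addrC -scaleN1r ell2DE mulN1r addrC.
  rewrite truncl2E//; case: asboolP => Sg.
    by rewrite subrr /sqnorm /= expr0n addr0 memNset.
  by rewrite subr0 mem_set.
have := esumID S setT f (fun g _ => f0 g); rewrite -/(l2sq u) => lE.
have XleS : (\sum_(i \in X) f i <= \esum_(g in ([set: G] `&` S)%classic) f g)%E.
  by rewrite setTI; apply: esum_ge; exists X.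
have A0 : (0 <= \esum_(g in ([set: G] `&` ~` S)%classic) f g)%E by apply: esum_ge0.
have B0 : (0 <= \esum_(g in ([set: G] `&` S)%classic) f g)%E by apply: esum_ge0.
have sumfin : \esum_(g in ([set: G] `&` S)%classic) f g \is a fin_num.
  by rewrite ge0_fin_numE//; apply: le_lt_trans (ltry (fine (l2sq u))); rewrite fineK// lE leeDl.
have sumfin' : \esum_(g in ([set: G] `&` ~` S)%classic) f g \is a fin_num.
  by rewrite ge0_fin_numE//; apply: le_lt_trans (ltry (fine (l2sq u))); rewrite fineK// lE leeDr.
have := lt_le_trans Xe XleS; rewrite lE.
rewrite -(fineK sumfin) -(fineK sumfin') -EFinD -?EFinB lte_fin lee_fin.
lra.
Qed.

Lemma sqnorm_le_l2sq (v : E2) g : ((sqnorm (v g))%:E <= l2sq v)%E.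
Proof.
apply: esum_ge; exists [set g]%classic; last by rewrite fsbig_set1.
by split => //; exact: finite_set1.
Qed.

Lemma vN_trunc a u S : finite_set S ->
  a (truncl2 S u) 1%g = \sum_(g \in S) u g * a delta (g^-1)%g.
Proof.
move=> fS; rewrite /truncl2 fsbig_finite// vN_sum ell2_sumE fsbig_finite//.
apply: eq_bigr => g _.
have -> : a (u g *: ltrans g delta) = u g *: a (ltrans g delta).
  exact: vN_opZ.
rewrite vN_equivariant -[_ *: _]addr0 ell2DE addr0.
by rewrite /= mulg1.
Qed.

(** By boundedness the value of a u at 1 is approximated by its values on the
    restrictions of u to finite sets, which are finite sums of products of the
    coefficients of u and of a delta. *)
Lemma vN_approx a u (e : R) : 0 < e -> exists2 S0, finite_set S0 &
  forall S, finite_set S -> (S0 `<=` S)%classic ->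
  sqnorm (a u 1%g - \sum_(g \in S) u g * a delta (g^-1)%g) <= e.
Proof.
move=> e0; have [c c0 ac] := vN_bounded a.
(* The bound c may be 0, hence the denominator c + 1. *)
have [] := @truncl2_approx u (e / (c + 1)); first by rewrite divr_gt0// ltr_wpDl.
move=> S0 fS0 S0P; exists S0 => // S fS S0S; rewrite -vN_trunc//.
have -> : a u 1%g - a (truncl2 S u) 1%g = a (u - truncl2 S u) 1%g.
  by rewrite -[u - _]addrC -[- truncl2 S u]scaleN1r vN_linear ell2DE mulN1r addrC.
rewrite -lee_fin; apply: (le_trans (sqnorm_le_l2sq _ _)).
apply: (le_trans (ac _)); apply: (@le_trans _ _ (c%:E * (e / (c + 1))%:E)%E).
  by apply: lee_wpmul2l; [rewrite lee_fin|apply: S0P].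
rewrite -EFinM lee_fin mulrCA ler_piMr ?(ltW e0)// ler_pdivrMr ?mul1r ?ltr_wpDl//.
by rewrite lerDl.
Qed.

Lemma fsum_inv (S : set G) (F : G -> R[i]) : 
  \sum_(g \in [set g^-1%g | g in S]%classic) F g = \sum_(g \in S) F (g^-1)%g.
Proof.
apply: (@reindex_fsbig _ _ _ G G (fun g => g^-1%g)).
split=> [g Sg|x y _ _ /invg_inj//|g [h Sh <-]]; first by exists g.
by exists h.
Qed.

(** Both traces are approximated by the sum of b(g) a(g^-1) over large finite sets,
    where a(g) and b(g) are the coefficients of a delta and b delta: one sum
    becomes the other under g -> g^-1. *)
Lemma vN_traceM a b : vN_trace (a * b) = vN_trace (b * a).
Proof.
apply/eqP; rewrite -subr_eq0; apply/eqP/sqnorm_eq0.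
apply/eqP; rewrite eq_le sqnorm_ge0 andbT; apply/ler_addgt0Pr => e e0; rewrite add0r.
(* The square of a sum is at most twice the sum of the squares, and there are
   two approximations. *)
have e4 : 0 < e / 4 by rewrite divr_gt0.
have [S0 fS0 S0P] := vN_approx a (b delta) e4.
have [S1 fS1 S1P] := vN_approx b (a delta) e4.
pose inv (S : set G) := [set g^-1%g | g in S]%classic.
have finv S : finite_set S -> finite_set (inv S) by apply: finite_image.
have invK S : inv (inv S) = S.
  apply/seteqP; split=> [_ [_ [g Sg <-] <-]|g Sg]; first by rewrite invgK.
  by exists (g^-1)%g; [exists g|rewrite invgK].
have fS : finite_set (S0 `|` inv S1)%classic by rewrite finite_setU; split=> //; apply: finv.
have := S0P _ fS (@subsetUl _ _ _).
have := S1P (inv (S0 `|` inv S1)%classic) (finv _ fS).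
have s1 : (S1 `<=` inv (S0 `|` inv S1))%classic.
  by move=> g Sg; exists (g^-1)%g; [right; exists g|rewrite invgK].
move=> /(_ s1); rewrite fsum_inv.
have -> : \sum_(g \in (S0 `|` inv S1)%classic) a delta g^-1%g * b delta (g^-1)^-1%g =
  \sum_(g \in (S0 `|` inv S1)%classic) b delta g * a delta g^-1%g.
  by apply: eq_fsbigr => g _; rewrite invgK mulrC.
rewrite /vN_trace -![(_ * _ : vN R G) delta]/(vNM _ _ delta) !vNME.
set x := a (b delta) 1%g; set y := b (a delta) 1%g; set s := (\sum_(_ \in _) _).
move=> h1 h2; have -> : x - y = (x - s) + - (y - s) by rewrite opprB addrA subrK.
apply: (le_trans (sqnormD _ _)); rewrite sqnormN; move: h1 h2.
by move: (sqnorm _) (sqnorm _) => p q; lra.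
Qed.

(** An isomorphism of the images of A and B gives matrices U and V with UV = A and
    VU = B, so the trace property identifies the traces of A and B. *)
Lemma vN_dim_uniq (X : lmodType (vN R G)^c) (d d' : R) :
  vN_dim_is X d -> vN_dim_is X d' -> d = d'.
Proof.
move=> [n [A [f [AA fi fA fd]]]] [m [B [g [BB gi gB gd]]]].
have row_ex k (Z : 'M[(vN R G)^c]_k) (h : {linear X -> 'rV_k}) :
    (forall v : 'rV_k, (exists x, h x = v) <-> (exists w, v = w *m Z)) ->
    exists x : 'I_k -> X, forall i, h (x i) = row i Z.
  move=> hZ; have ex i : exists x, h x = row i Z.
    by apply/hZ; exists (delta_mx 0 i); rewrite rowE.
  by exists (fun i => projT1 (cid (ex i))) => i; case: cid.
have [x xA] := row_ex _ _ _ fA; have [y yB] := row_ex _ _ _ gB.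
have expand k (Z : 'M[(vN R G)^c]_k) (h : {linear X -> 'rV_k}) (z : 'I_k -> X) :
    Z *m Z = Z -> injective h ->
    (forall v : 'rV_k, (exists x, h x = v) <-> (exists w, v = w *m Z)) ->
    (forall i, h (z i) = row i Z) -> forall p, p = \sum_i h p 0 i *: z i.
  move=> ZZ hi hZ hz p; apply: hi; rewrite linear_sum.
  have [w hw] := (hZ _).1 (ex_intro _ p erefl).
  have e : h p = h p *m Z by rewrite hw -mulmxA ZZ.
  rewrite {1}e mulmx_sum_row; apply: eq_bigr => i _.
  by rewrite linearZ hz.
pose U : 'M[(vN R G)^c]_(n, m) := \matrix_i g (x i).
pose V : 'M[(vN R G)^c]_(m, n) := \matrix_j f (y j).
have gU p : g p = f p *m U.
  rewrite {1}(expand _ _ _ _ AA fi fA xA p) linear_sum mulmx_sum_row.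
  by apply: eq_bigr => i _; rewrite linearZ rowK.
have fV p : f p = g p *m V.
  rewrite {1}(expand _ _ _ _ BB gi gB yB p) linear_sum mulmx_sum_row.
  by apply: eq_bigr => i _; rewrite linearZ rowK.
have UV : U *m V = A by apply/row_matrixP => i; rewrite row_mul rowK -fV xA.
have VU : V *m U = B by apply/row_matrixP => i; rewrite row_mul rowK -gU yB.
suff : d%:C%C = d'%:C%C :> R[i] by move=> [].
rewrite -fd -gd -UV -VU.
have trD (I : finType) (F : I -> (vN R G)^c) :
    vN_trace (\sum_i F i) = \sum_i vN_trace (F i).
  apply: (big_morph (@vN_trace R G)) => [a b|].
    exact: (congr1 (fun u : E2 => u 1%g) (vNDE a b delta)).
  exact: (congr1 (fun u : E2 => u 1%g) (vN0E delta)).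
under eq_bigr => i _ do rewrite mxE trD.
under [RHS]eq_bigr => j _ do rewrite mxE trD.
rewrite exchange_big; apply: eq_bigr => j _; apply: eq_bigr => i _.
exact: vN_traceM.
Qed.

Lemma vN_dimE (X : lmodType (vN R G)^c) (d : R) : vN_dim_is X d -> vN_dim X = d.
Proof.
move=> h; apply: vN_dim_uniq (h); rewrite /vN_dim.
by apply: (xgetPex 0); exists d.
Qed.
End TraceProperty.

(** * Dimensions over the group von Neumann algebra *)
Section VNBasis.
Variables (R : realType) (G : groupType).
Local Notation QG := (qrep (tt : BG G)).

(** The embedding of Q[G] in N(G). *)
Lemma vN_emb_sig : {f : {linear freemod rat G -> vN R G} |
  forall g, f (fbasis rat g) = vN_of R g}.
Proof. by exists (flift (vN_of R (G := G))) => g; apply: flift_basis. Qed.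
Definition vN_emb := sval vN_emb_sig.
Lemma vN_embE g : vN_emb (fbasis rat g) = vN_of R g.
Proof. exact: (svalP vN_emb_sig). Qed.

Lemma vN_ofM (g h : G) : vN_of R (g * h)%g = vN_of R g * vN_of R h.
Proof.
apply: vNP => u; rewrite [RHS]vNME !vN_ofE; apply: ell2P => k.
by rewrite /= mulgA.
Qed.

Lemma vN_scaleAl (q : rat) (a b : vN R G) : (q *: a) * b = q *: (a * b).
Proof. by apply: vNP => u; rewrite [LHS]vNME [LHS]vNZE [RHS]vNZE [in RHS]vNME. Qed.
Lemma vN_scaleAr (q : rat) (a b : vN R G) : a * (q *: b) = q *: (a * b).
Proof. by apply: vNP => u; rewrite [LHS]vNME [RHS]vNZE vNZE [in RHS]vNME vN_opZ. Qed.

Lemma vN_emb_act g xi : vN_emb (freemap rat (fun k : G => (k * g)%g) xi) =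
  vN_emb xi * vN_of R g.
Proof.
have l : linear (fun xi => vN_emb xi * vN_of R g).
  by move=> r x y; rewrite linearP mulrDl vN_scaleAl.
have: vN_emb \o freemap rat (fun k : G => (k * g)%g) =1 mklin l; last exact.
apply: freemod_ext => k.
rewrite -[LHS]/(vN_emb (freemap rat _ (fbasis rat k))) freemap_basis.
by rewrite -[RHS]/(vN_emb (fbasis rat k) * vN_of R g) !vN_embE vN_ofM.
Qed.

Lemma vN_trace_emb (xi : freemod rat G) : vN_trace (vN_emb xi) = (ratr (xi 1%g))%:C%C.
Proof.
pose Pr (xi : freemod rat G) := vN_trace (vN_emb xi) = (ratr (xi 1%g : rat))%:C%C.
apply: (@freemod_ind rat G Pr) => [g|q x y Px Py|].
- rewrite /Pr vN_embE fbasisE /vN_trace vN_ofE /= mul1g.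
  have -> : `[< g = 1%g >] = (g == 1%g) by apply/asboolP/eqP.
  by case: (g == 1%g); rewrite ?rmorph1 ?rmorph0.
- rewrite /Pr linearP dsumDE dsumZE fmorph_rat -[q *: x 1%g]/(q * x 1%g) rmorphD rmorphM.
  have -> : vN_trace (q *: vN_emb x + vN_emb y) =
      ratr q * vN_trace (vN_emb x) + vN_trace (vN_emb y).
    have := congr1 (fun u : ell2 R G => u 1%g)
      (vNDE (q *: vN_emb x) (vN_emb y) (l2_unit R G)).
    by rewrite [X in _ = (X + _ : ell2 R G) _]vNZE.
  by rewrite Px Py !fmorph_rat.
- rewrite /Pr linear0 fmorph_rat rmorph0.
  exact: (congr1 (fun u : ell2 R G => u 1%g) (vN0E (l2_unit R G))).
Qed.

Variables (P : qmodule (BG G)) (B : gbasis P).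
Local Notation lN := (fun (g : G) (a : vN R G) => vN_of R g * a).
Local Notation vten := (ten (@gact G P) lN).
Local Notation T := (tens (@gact G P) lN).

Lemma gb_a_act j p g : gb_a (g := B) j tt (gact p g) =
  freemap rat (fun k : G => (k * g)%g) (gb_a j tt p).
Proof. exact: (@qnat _ _ _ (gb_a j) tt tt g). Qed.

(** A coordinate of a dual basis of P, extended to P (x) N(G). *)
Lemma vcoord_sig j : {f : {linear T -> vN R G} |
  forall p a, f (vten p a) = vN_emb (gb_a (g := B) j tt p) * a}.
Proof.
have fl r p p' b : vN_emb (gb_a (g := B) j tt (r *: p + p')) * b =
    r *: (vN_emb (gb_a j tt p) * b) + vN_emb (gb_a j tt p') * b.
  by rewrite (linearP (gb_a j tt)) linearP mulrDl vN_scaleAl.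
have fr r p b b' : vN_emb (gb_a (g := B) j tt p) * (r *: b + b') =
    r *: (vN_emb (gb_a j tt p) * b) + vN_emb (gb_a j tt p) * b'.
  by rewrite mulrDr vN_scaleAr.
have fS p g b : vN_emb (gb_a (g := B) j tt (gact p g)) * b =
    vN_emb (gb_a j tt p) * (vN_of R g * b).
  by rewrite gb_a_act vN_emb_act mulrA.
by exists (tlift fl fr fS) => p a; apply: tlift_ten.
Qed.
Definition vcoord j := sval (vcoord_sig j).
Lemma vcoordE j p a : vcoord j (vten p a) = vN_emb (gb_a j tt p) * a.
Proof. exact: (svalP (vcoord_sig j)). Qed.

Lemma vten_linl a : linear (vten^~ a).
Proof. by move=> r p q; apply: tenP. Qed.
Lemma vten_linr p : linear (vten p).
Proof. by move=> r a b; apply: tenPr. Qed.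

(** Elements of Q[G] move across the tensor sign. *)
Lemma vten_yo (p : P tt) (xi : QG tt) (a : vN R G) : vten (yo p tt xi) a = vten p (vN_emb xi * a).
Proof.
have l : linear (fun xi => vten p (vN_emb xi * a)).
  by move=> r x y; rewrite linearP mulrDl vN_scaleAl vten_linr.
have: mklin (vten_linl a) \o yo p tt =1 mklin l; last exact.
apply: freemod_ext => g.
rewrite -[LHS]/(vten (yo p tt (fbasis rat g)) a) yoE.
rewrite -[RHS]/(vten p (vN_emb (fbasis rat g) * a)) vN_embE.
exact: (tenS (@gact G P) lN p g a).
Qed.

Lemma vcoord_dec (t : T) : \sum_j vten (gb_b (g := B) j) (vcoord j t) = t.
Proof.
have l : linear (fun t : T => \sum_j vten (gb_b (g := B) j) (vcoord j t)).
  move=> r x y; rewrite scaler_sumr -big_split; apply: eq_bigr => j _.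
  by rewrite linearP vten_linr.
have: mklin l =1 idfun; last exact.
apply: tens_ext => p a.
rewrite -[LHS]/(\sum_j vten (gb_b (g := B) j) (vcoord j (vten p a))).
under eq_bigr => j _ do rewrite vcoordE -vten_yo.
by rewrite -[in RHS](gbP B p) -(linear_sum (mklin (vten_linl a))).
Qed.

Lemma vcoord_scale j (c : (vN R G)^c) (t : vNind R P) :
  vcoord j (c *: t) = c * (vcoord j t : (vN R G)^c).
Proof.
have l : linear (fun t : T => vcoord j t * (c : vN R G)).
  by move=> r x y; rewrite linearP mulrDl vN_scaleAl.
have: vcoord j \o vNind_map P c =1 mklin l; last exact.
apply: tens_ext => p a.
rewrite -[LHS]/(vcoord j (vNind_map P c (vten p a))) vNind_map_ten vcoordE.
by rewrite -[RHS]/(vcoord j (vten p a) * (c : vN R G)) vcoordE mulrA.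
Qed.

Local Notation n := #|gb_ix B|.
Lemma vrow_linear : linear (fun t : vNind R P => 
  \row_(k < n) (vcoord (enum_val k) t : (vN R G)^c)).
Proof.
move=> c t u; apply/rowP => k; rewrite !mxE.
by rewrite -vcoord_scale -[LHS]/(vcoord (enum_val k) ((c *: t : vNind R P) + u)) raddfD.
Qed.

(** The coordinates embed P (x) N(G) in rows as the image of the matrix
    (a_k(b_i)); the trace of that matrix is the sum of the coefficients of the
    a_i(b_i) at 1. *)
Lemma vN_dim_gbasis : vN_dim_is (vNind R P) (ratr (gtrace B (qid P)) : R).
Proof.
pose A : 'M[(vN R G)^c]_n :=
  \matrix_(i, k) (vN_emb (gb_a (enum_val k) tt (gb_b (g := B) (enum_val i)))).
pose f := mklin vrow_linear.
pose psi (w : 'rV[(vN R G)^c]_n) : vNind R P :=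
  \sum_k vten (gb_b (g := B) (enum_val k)) (w 0 k).
have psiK t : psi (f t) = t.
  rewrite -[RHS]vcoord_dec /psi [RHS]big_enum_val; apply: eq_bigr => k _.
  by rewrite mxE.
have fpsi w : f (psi w) = w *m A.
  apply/rowP => k; rewrite !mxE /psi.
  rewrite -[LHS]/(vcoord (enum_val k) (\sum_i vten _ (w 0 i))) linear_sum.
  by apply: eq_bigr => i _; rewrite vcoordE mxE.
exists n, A, f; split.
- apply/row_matrixP => i; rewrite row_mul.
  have -> : row i A = f (psi (delta_mx 0 i)) by rewrite fpsi -rowE.
  by rewrite -fpsi psiK.
- exact: can_inj psiK.
- move=> v; split=> [[x <-]|[w ->]]; first by exists (f x); rewrite -fpsi psiK.
  by exists (psi w); rewrite fpsi.
rewrite /gtrace fmorph_rat rmorph_sum [RHS]big_enum_val; apply: eq_bigr => i _.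
by rewrite mxE vN_trace_emb fmorph_rat.
Qed.
End VNBasis.

(** * The rank of a finitely generated projective module over QG *)
(** The L^2-dimension of P (x) N(G) as a rational number, in terms of Q[G] only. *)
Definition grank (G : groupType) (P : qmodule (BG G)) : rat :=
  xget 0 [set q | exists B : gbasis P, q = gtrace B (qid P)]%classic.

Section Rank.
Variables (R : realType) (G : groupType).
Implicit Types P Q : qmodule (BG G).

(** Independence of the dual basis: all of them compute the same dimension over the
    group von Neumann algebra. *)
Lemma grankE P (B : gbasis P) : grank P = gtrace B (qid P).
Proof.
rewrite /grank; set A := (X in xget _ X).
have : exists q, A q by exists (gtrace B (qid P)), B.
case/(xgetPex 0) => B' ->; apply: (fmorph_inj (ratr : {rmorphism rat -> R})).
exact: vN_dim_uniq (vN_dim_gbasis R B') (vN_dim_gbasis R B).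
Qed.

Lemma vN_dim_is_grank P : fgproj P -> vN_dim_is (vNind R P) (ratr (grank P) : R).
Proof. by move=> /fgproj_gbasis[B]; rewrite (grankE B); apply: vN_dim_gbasis. Qed.

Lemma vN_dim_grank P : fgproj P -> vN_dim (vNind R P) = ratr (grank P).
Proof. by move=> /vN_dim_is_grank; apply: vN_dimE. Qed.

(** Dual bases of the outer terms of a split exact sequence combine to one of the
    middle term, and the diagonal coefficients are unchanged. *)
Lemma grank_additive : exact_additive (@grank G).
Proof.
move=> P' P P'' f g /fgproj_gbasis[B'] _ p'' fg.
have [r [s [rf gs rs gf frsg]]] := split_exact p'' fg.
have /fgproj_gbasis[B''] := p''.
pose J : finType := (gb_ix B' + gb_ix B'')%type.
pose b (j : J) : P tt := match j with
  | inl i => f tt (gb_b i) | inr i => s tt (gb_b i) end.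
pose a (j : J) : qhom P (qrep (tt : BG G)) := match j with
  | inl i => qcomp (gb_a i) r | inr i => qcomp (gb_a i) g end.
have dec p : \sum_j yo (b j) tt (a j tt p) = p.
  rewrite big_sumType /=.
  under eq_bigr => i _ do rewrite -(yo_hom (gb_b i) f).
  under [X in _ + X]eq_bigr => i _ do rewrite -(yo_hom (gb_b i) s).
  by rewrite -!linear_sum !gbP frsg.
rewrite (grankE (GBasis dec)) (grankE B') (grankE B'') /gtrace big_sumType /=.
by congr (_ + _); apply: eq_bigr => i _; rewrite ?rf ?gs.
Qed.

Lemma grank_unit : grank (qrep (tt : BG G)) = 1.
Proof.
have dec (p : qrep (tt : BG G) tt) :
    \sum_(j : 'I_1) yo (fbasis rat (1%g : G) : qrep (tt : BG G) tt) tt (qid (qrep (tt : BG G)) tt p) = p.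
  by rewrite big_ord1 yo_id.
rewrite (grankE (GBasis dec)) /gtrace big_ord1.
rewrite -[LHS]/((fbasis rat (1%g : G) : freemod rat G) 1%g) fbasisE.
by case: asboolP.
Qed.
End Rank.

Section RankTensor.
Variables (R : realType) (G H : groupType) (X : biset G (BG H)) (P : qmodule (BG G)).
Local Notation QH := (qrep (tt : BG H)).
Hypothesis stab_fin : forall x : X tt, finite_set [set h : H | rgact x h = x]%classic.
Hypothesis orb_fin : finite_set
  [set [set rgact x h | h in [set: H]] | x in [set: X tt]]%classic.

Lemma rset_fgproj : fgproj (blin X).
Proof.
have [B _] := rset_gbasis stab_fin orb_fin.
by apply/fgproj_gbasis; constructor.
Qed.

Local Notation BT := (bten (@gact G P) (@blact G (BG H) X _)).

Lemma tens_at_lin (p : P tt) (u : BG H) :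
  linear ((fun v => ten (@gact G P) (fun g => freemap rat (@blact G (BG H) X u g)) p v)
    : blin X u -> tensb X P u).
Proof. by move=> r v w; apply: tenPr. Qed.
(** The map p (x) - from Q[X] to P (x) Q[X]. *)
Definition tens_at (p : P tt) : qhom (blin X) (tensb X P).
Proof.
exists (fun u => mklin (@tens_at_lin p u)) => u w h v.
by rewrite -[RHS]/(btens_act X P h (ten _ _ p v)) /btens_act tmap_ten.
Defined.

(** The orbit map of t, extended to Q[G]. *)
Lemma orbX_sig u (t : X u) : {f : {linear freemod rat G -> freemod rat (X u)} |
  forall g, f (fbasis rat g) = fbasis rat (blact X g t)}.
Proof. by exists (flift (fun g => fbasis rat (blact X g t))) => g; apply: flift_basis. Qed.
Definition orbX u (t : X u) := sval (orbX_sig t).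
Lemma orbXE u (t : X u) g : orbX t (fbasis rat g) = fbasis rat (blact X g t).
Proof. exact: (svalP (orbX_sig t)). Qed.

(** Left multiplication of Q[X] by an element of Q[G]. *)
Lemma lmulX_sig u (xi : freemod rat G) :
  {f : {linear freemod rat (X u) -> freemod rat (X u)} |
   forall t, f (fbasis rat t) = orbX t xi}.
Proof. by exists (flift (fun t : X u => orbX t xi)) => g; apply: flift_basis. Qed.
Definition lmulX u xi := sval (lmulX_sig u xi).
Lemma lmulXE u xi t : lmulX u xi (fbasis rat t) = orbX t xi.
Proof. exact: (svalP (lmulX_sig u xi)). Qed.

Lemma lmulX_lin u v : linear (fun xi => lmulX u xi v).
Proof.
move=> r x y; have hl : linear (fun v => r *: lmulX u x v + lmulX u y v).
  move=> c v1 v2; rewrite !(linearP (lmulX u _)) !scalerDr !scalerA addrACA.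
  by rewrite [r * c]mulrC.
have: lmulX u (r *: x + y) =1 mklin hl; last exact.
apply: freemod_ext => t.
rewrite -[RHS]/(r *: lmulX u x (fbasis rat t) + lmulX u y (fbasis rat t)).
by rewrite !lmulXE linearP.
Qed.

Lemma lmulX_basis g v : lmulX tt (fbasis rat g) v = lact_hom X g tt v.
Proof.
have: lmulX tt (fbasis rat g) =1 lact_hom X g tt; last exact.
apply: freemod_ext => t; rewrite -[RHS]/(freemap rat _ (fbasis rat t)).
by rewrite freemap_basis lmulXE orbXE.
Qed.

Section Coord.
Variables (B : gbasis P) (j : gb_ix B).
Definition coX_at u (t : X u) : {linear P tt -> blin X u} := orbX t \o gb_a j tt.
Lemma coX_G u p g (t : X u) : coX_at t (gact p g) = coX_at (blact X g t) p.
Proof.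
rewrite -[LHS]/(orbX t (gb_a j tt (gact p g))) -[RHS]/(orbX _ (gb_a j tt p)) gb_a_act.
have: orbX t \o freemap rat (fun k => (k * g)%g) =1 orbX (blact X g t); last exact.
apply: freemod_ext => k; rewrite -[LHS]/(orbX t (freemap rat _ (fbasis rat k))).
by rewrite freemap_basis !orbXE blactM.
Qed.
Lemma coX_nat u w (h : hom u w) p (t : X w) :
  coX_at (bract X h t) p = qact (blin X) h (coX_at t p).
Proof.
have: orbX (bract X h t) =1 freemap rat (bract X h) \o orbX t; last exact.
apply: freemod_ext => k; rewrite -[RHS]/(freemap rat _ (orbX t (fbasis rat k))).
by rewrite !orbXE freemap_basis blractC.
Qed.
(** A coordinate of a dual basis of P, applied to P (x) Q[X]: its value on
    p (x) t is a_j(p) t. *)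
Definition coX : qhom (tensb X P) (blin X) := tensb_desc coX_G coX_nat.
Lemma coXE u p v : coX u (tens_at p u v) = lmulX u (gb_a j tt p) v.
Proof.
have: coX u \o tens_at p u =1 lmulX u (gb_a j tt p); last exact.
apply: freemod_ext => t; rewrite lmulXE.
by rewrite -[LHS]/(coX u (BT p t)) tensb_descE.
Qed.
End Coord.

Lemma coX_dec (B : gbasis P) u (t : tensb X P u) :
  \sum_(j : gb_ix B) tens_at (gb_b j) u (coX j u t) = t.
Proof.
pose f := qsumh (fun j : gb_ix B => qcomp (tens_at (gb_b j)) (coX j)).
have: f u =1 idfun; last exact.
apply: tensb_ext => p x.
rewrite -[LHS]/(\sum_j tens_at (gb_b j) u (coX j u (BT p x))) -[in RHS](gbP B p).
have lx : linear (fun p : P tt => BT p x) by exact: bten_linear.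
rewrite [RHS](linear_sum (mklin lx)); apply: eq_bigr => j _.
rewrite [coX j u _]tensb_descE.
have: tens_at (gb_b j) u \o orbX x =1 mklin lx \o yo (gb_b j) tt; last exact.
apply: freemod_ext => g.
rewrite -[LHS]/(tens_at (gb_b j) u (orbX x (fbasis rat g))) orbXE.
rewrite -[RHS]/(BT (yo (gb_b j) tt (fbasis rat g)) x) yoE; apply/esym.
exact: (btenS (@gact G P) (@blact G (BG H) X u) (gb_b j) g x).
Qed.

(** The elements of G other than 1 act on Q[X] with trace 0, as they act freely on
    X; hence only the coefficients at 1 of a dual basis of P contribute. *)
Lemma grank_tensb : (forall g (x : X tt), blact X g x = x -> g = 1%g) -> fgproj P ->
  grank (tensb X P) = grank P * grank (blin X).
Proof.
move=> freeX /fgproj_gbasis[B]; have [BX BX0] := rset_gbasis stab_fin orb_fin.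
pose J : finType := (gb_ix B * gb_ix BX)%type.
have dec p : \sum_(j : J) yo (tens_at (gb_b j.1) tt (gb_b j.2)) tt
    (qcomp (gb_a j.2) (coX j.1) tt p) = p.
  rewrite -[RHS](coX_dec B) -(pair_bigA _ (fun j k =>
    yo (tens_at (gb_b j) tt (gb_b k)) tt (gb_a k tt (coX j tt p)))) /=.
  apply: eq_bigr => j _.
  under eq_bigr => k _ do rewrite -(yo_hom (gb_b k) (tens_at (gb_b j))).
  by rewrite -linear_sum gbP.
rewrite (grankE R (GBasis dec)) (grankE R B) (grankE R BX) /gtrace.
rewrite -(pair_bigA _ (fun j k => (gb_a (g := BX) k tt
  (coX j tt (tens_at (gb_b j) tt (gb_b k))) : freemod rat H) 1%g)) mulr_suml.
apply: eq_bigr => j _.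
pose phi xi : rat := \sum_(k : gb_ix BX)
  (gb_a k tt (lmulX tt xi (gb_b k)) : freemod rat H) 1%g.
have phil : linear (phi : freemod rat G -> rat^o).
  move=> r x y; rewrite /phi scaler_sumr -big_split; apply: eq_bigr => k _.
  by rewrite lmulX_lin linearP.
have phiE xi : phi xi = xi 1%g * gtrace BX (qid _).
  pose c := gtrace BX (qid (blin X)).
  have cl : linear (fun xi : freemod rat G => (xi 1%g * c : rat^o)).
    by move=> r x y; rewrite mulrDl -mulrA.
  have: mklin phil =1 mklin cl; last exact.
  apply: freemod_ext => g.
  rewrite -[LHS]/(phi (fbasis rat g)) -[RHS]/((fbasis rat g : freemod rat G) 1%g * c) fbasisE.
  have -> : phi (fbasis rat g) = gtrace BX (lact_hom X g).
    by apply: eq_bigr => k _; rewrite lmulX_basis.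
  case: asboolP => [->|g1]; last by rewrite BX0 ?mul0r// => x /freeX.
  rewrite mul1r; apply: eq_bigr => k _; congr (gb_a k tt _ _).
  by apply: freemap_id => x; rewrite blact1.
rewrite -phiE; apply: eq_bigr => k _.
by rewrite coXE.
Qed.
End RankTensor.

(** * Isomorphisms and classes in K0 *)
Section IsoTools.
Variable C : category.
Implicit Types M N P : qmodule C.

Lemma qiso_sym M N : qiso M N -> qiso N M.
Proof. by move=> /qisoP[f [g [fg gf]]]; apply: (qisoI (f := g) (g := f)). Qed.

Lemma qiso_trans M N P : qiso M N -> qiso N P -> qiso M P.
Proof.
move=> /qisoP[f [g [fg gf]]] /qisoP[f' [g' [fg' gf']]].
by apply: (qisoI (f := qcomp f' f) (g := qcomp g g')) => x m /=; rewrite ?fg' ?fg ?gf ?gf'.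
Qed.

Lemma qrep_iso (s x : C) : isomorphic s x -> qiso (qrep s) (qrep x).
Proof.
move=> [f [g [gf fg]]].
have cancel_yo (a b : C) (u : hom a b) (v : hom b a) : v \oc u = idm a ->
  forall y m, yo (fbasis rat v : qrep a b) y (yo (fbasis rat u : qrep b a) y m) = m.
  move=> vu; apply: (@qrep_ext _ a _ (qcomp (yo (fbasis rat v : qrep a b))
    (yo (fbasis rat u : qrep b a))) (qid _)).
  rewrite -[LHS]/(yo (fbasis rat v : qrep a b) a (yo (fbasis rat u : qrep b a) a
    (fbasis rat (idm a)))) yoE qact1 yoE -[RHS]/(fbasis rat (idm a)) -vu.
  exact: freemap_basis.
by apply: (qisoI (f := yo (fbasis rat f : qrep x s)) (g := yo (fbasis rat g : qrep s x)))
  => y m; apply: cancel_yo.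
Qed.

Lemma freemod_empty (R : comPzRingType) (T : Type) (u : freemod R T) :
  (T -> False) -> u = 0.
Proof. by move=> nT; apply: dsumP => t; case: (nT t). Qed.

Lemma K0cl0 P : (forall x (p : P x), p = 0) -> K0cl P = 0.
Proof. by move=> P0; apply: (exact_additive0 (@K0cl_additive C) P0). Qed.

Lemma K0cl_iso P Q : fgproj Q -> qiso P Q -> K0cl P = K0cl Q.
Proof. by move=> pQ PQ; apply: (exact_additive_iso (@K0cl_additive C) pQ PQ). Qed.
End IsoTools.

Section BGTools.
Variables (G : groupType) (M N : qmodule (BG G)) (f : {linear M tt -> N tt}).
Hypothesis fG : forall (g : G) m, f (gact m g) = gact (f m) g.

Definition bg_fun (u : BG G) : {linear M u -> N u} := match u with tt => f end.
Lemma bg_nat (u v : BG G) (g : hom u v) m : bg_fun u (qact M g m) = qact N g (bg_fun v m).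
Proof. by case: u g; case: v m => m g; apply: fG. Qed.
Definition bg_hom : qhom M N := QHom bg_nat.
Lemma bg_iso : bijective f -> qiso M N.
Proof. by move=> fb; exists bg_hom => -[]. Qed.
End BGTools.

Section TensorEmpty.
Variables (G : groupType) (C : category) (X : biset G C) (M : qmodule (BG G)).
Lemma tensb_empty x : (X x -> False) -> forall m : tensb X M x, m = 0.
Proof.
move=> X0; have: idfun =1 (\0 : {linear tensb X M x -> tensb X M x}); last exact.
by apply: tensb_ext => m t; case: (X0 t).
Qed.
End TensorEmpty.

(** * The poset of isomorphism classes of an EI-category *)
Section EI.
Variable C : category.
Hypothesis EI : EI_category C.
Implicit Types x y z : C.

(** The idempotent f o h is an isomorphism, hence the identity. *)
Lemma left_inv_iso x y (f : hom x y) (h : hom y x) : h \oc f = idm x -> is_iso f.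
Proof.
move=> hf; have [k [kfh fhk]] := EI (f \oc h).
exists h; split=> //.
(* An invertible idempotent is an identity. *)
have idem : (f \oc h) \oc (f \oc h) = f \oc h.
  by rewrite compA -[(f \oc h) \oc f]compA hf compm1.
by rewrite -[LHS]comp1m -{1}kfh -compA idem.
Qed.

Lemma loop_iso x y (f : hom x y) (g : hom y x) : is_iso f.
Proof.
have [k [kgf _]] := EI (g \oc f).
by apply: (@left_inv_iso _ _ f (k \oc g)); rewrite -compA.
Qed.

Lemma le_isoc_hom x y : le_isoc (iclass x) (iclass y) <-> inhabited (hom x y).
Proof.
split=> [[x' [y' [/esym/iclassP[f _] /iclassP[g _] [h]]]]|[h]]; last first.
  by exists x, y; split=> //; constructor.
by constructor; exact: (g \oc (h \oc f)).
Qed.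

Lemma iclass_ex (c : isoc C) : exists x, iclass x = c.
Proof. by exists (repr c); rewrite /iclass reprK. Qed.

Lemma le_isoc_refl (c : isoc C) : le_isoc c c.
Proof. by have [x <-] := iclass_ex c; apply/le_isoc_hom; constructor; apply: idm. Qed.

Lemma le_isoc_trans (d c e : isoc C) : le_isoc c d -> le_isoc d e -> le_isoc c e.
Proof.
have [x <-] := iclass_ex c; have [y <-] := iclass_ex d; have [z <-] := iclass_ex e.
move=> /le_isoc_hom[f] /le_isoc_hom[g]; apply/le_isoc_hom; constructor.
exact: (g \oc f).
Qed.

Lemma le_isoc_anti (c d : isoc C) : le_isoc c d -> le_isoc d c -> c = d.
Proof.
have [x <-] := iclass_ex c; have [y <-] := iclass_ex d.
move=> /le_isoc_hom[f] /le_isoc_hom[g]; apply/iclassP; exists f.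
exact: loop_iso g.
Qed.

(** ** E and Res, E and S *)
Section Unit.
Variables (x : C) (Q : qmodule (BG (aut x))).
Local Notation BT := (bten (@gact (aut x) Q) (@blact (aut x) C (brep x) _)).

Let e_at (f : hom x x) : {linear Q tt -> Q tt} := @qact _ Q tt tt (AutElt (EI f)).

Lemma e_atG m g (f : hom x x) : e_at f (gact m g) = e_at (blact (brep x) g f) m.
Proof.
rewrite /e_at -[LHS]/(qact Q _ (qact Q _ _)) -qactM; congr (qact Q _ _).
exact: aut_inj.
Qed.
Lemma Emod_ev_sig : {f : {linear Emod Q x -> Q tt} |
  forall m u, f (BT m u) = e_at u m}.
Proof. by exists (tenfree_lift e_atG) => m u; apply: tenfree_liftE. Qed.

(** All endomorphisms of x are automorphisms, so q (x) u is qu (x) id. *)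
Lemma Emod_res : qiso (qres (Emod Q) x) Q.
Proof.
have [f fE] := Emod_ev_sig.
apply: (@bg_iso _ (qres (Emod Q) x) Q f) => [g m|].
  have: f \o qact (Emod Q) g =1 @qact _ Q tt tt g \o f; last exact.
  apply: tensb_ext => {}m u; rewrite -[LHS]/(f (qact (Emod Q) g (BT m u))).
  rewrite -[RHS]/(@qact _ Q tt tt g (f (BT m u))) tensb_act_bten !fE /e_at -qactM.
  by congr (qact Q _ _); apply: aut_inj.
have lin : linear (fun m : Q tt => BT m (idm x)) by exact: bten_linear.
have e1 m : @qact _ Q tt tt (AutElt (EI (idm x))) m = m.
  rewrite (_ : AutElt _ = 1%g); last exact: aut_inj.
  exact: (@qact1 _ Q tt).
exists (mklin lin) => m; last by rewrite -[LHS]/(f (BT m (idm x))) fE /e_at e1.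
have: mklin lin \o f =1 idfun; last exact.
apply: tensb_ext => {}m u; rewrite -[LHS]/(BT (f (BT m u)) (idm x)) fE /e_at.
rewrite -[LHS]/(BT (gact m (AutElt (EI u))) (idm x)) btenS; congr (BT m _).
exact: compm1.
Qed.

(** A non-isomorphism x -> y excludes morphisms y -> x, so E_x Q vanishes at y and
    nothing is divided out at x. *)
Lemma Smod_Emod : qiso (Smod (Emod Q) x) Q.
Proof.
apply: qiso_trans Emod_res; apply/qiso_sym/Smod_res => y u m nu.
apply: tensb_empty => v; apply: nu; exact: loop_iso v.
Qed.

(** The element m (x) u is the image of m (x) id under u, which is not an
    isomorphism. *)
Lemma Smod_Emod0 z : ~ isomorphic z x -> forall (v : BG (aut z)) (m : Smod (Emod Q) z v), m = 0.
Proof.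
move=> zx; apply: Smod0 => m.
have: lpi (@Sgen C (Emod Q) z) =1 (\0 : {linear Emod Q z -> lquot (@Sgen C (Emod Q) z)}); last exact.
apply: tensb_ext => {}m u.
have -> : BT m u = qact (Emod Q) (u : hom z x) (BT m (idm x)).
  by rewrite tensb_act_bten; congr (BT m _); apply/esym/comp1m.
by apply: Sgen0 => iu; apply: zx; exists u.
Qed.

Lemma Emod0 z : ~ inhabited (hom z x) -> forall (m : Emod Q z), m = 0.
Proof. by move=> zx; apply: tensb_empty => u; apply: zx; constructor. Qed.
End Unit.

Lemma S_rep_fgproj (x s : C) : fgproj (Smod (qrep s) x).
Proof.
have u1 z : qiso (Emod (qrep (tt : BG (aut z)))) (qrep z) by exact: tensb_unit.
have [xs|xs] := pselect (isomorphic x s); last first.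
  apply: (fgproj_iso (M := Smod (Emod (qrep (tt : BG (aut s)))) x)).
    exact/(afunctor_iso (S_functor x))/qiso_sym.
  by apply: fgproj_zero; apply: Smod_Emod0.
apply: (fgproj_iso (M := Smod (Emod (qrep (tt : BG (aut x)))) x)).
  apply/(afunctor_iso (S_functor x)); apply: (qiso_trans (N := qrep x)).
    exact/qrep_iso/isomorphic_sym.
  exact/qiso_sym.
exact: fgproj_iso (Smod_Emod _) (fgproj_qrep _).
Qed.

Lemma support P (B : dbasis P) x : (forall j, ~ inhabited (hom x (db_s (d := B) j))) ->
  forall p : P x, p = 0.
Proof.
move=> nx p; rewrite -(dbP B p) big1// => j _.
rewrite [db_a j x p]freemod_empty ?linear0// => u.
by apply: (nx j); constructor.
Qed.

Hypothesis qf : quasi_finite C.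

Lemma bmor_fgproj x y : fgproj (blin (bmor y x)).
Proof. by case: qf => _ st orb; apply: rset_fgproj; [exact: st|exact: orb]. Qed.

Lemma qres_rep (s x : C) : qiso (qres (qrep s) x) (blin (bmor x s)).
Proof.
by apply: (@bg_iso _ (qres (qrep s) x) (blin (bmor x s)) idfun).
Qed.

Lemma Res_rep_fgproj (x s : C) : fgproj (qres (qrep s) x).
Proof. exact: fgproj_iso (qres_rep s x) (bmor_fgproj s x). Qed.

Lemma qres_fgproj P x : fgproj P -> fgproj (qres P x).
Proof. by apply: (afunctor_fgproj (T := res_functor x)) => s; apply: Res_rep_fgproj. Qed.

Lemma Smod_fgproj P x : fgproj P -> fgproj (Smod P x).
Proof. by apply: (afunctor_fgproj (T := S_functor x)) => s; apply: S_rep_fgproj. Qed.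

Lemma Emod_fgproj x (Q : qmodule (BG (aut x))) : fgproj Q -> fgproj (Emod Q).
Proof. by move=> pQ; apply: (tensb_fgproj (X := brep x) (brep_fgproj x) pQ). Qed.

Lemma finite_support (P : qmodule C) : fgproj P ->
  exists D : seq (isoc C), (forall c d, le_isoc c d -> d \in D -> c \in D) /\
    forall y, iclass y \notin D -> forall m : P y, m = 0.
Proof.
move=> /fgprojP[B]; have [fin _ _] := qf.
(* P is generated at the objects of a dual basis. *)
pose A := (\bigcup_(j in [set: db_ix B]) [set c | le_isoc c (iclass (db_s j))])%classic.
have finA : finite_set A.
  by apply: bigcup_finite => // j _; apply: fin.
have [D DE] := (finite_seqP A).1 finA.
have DP c : c \in D <-> A c by rewrite DE.
exists D; split=> [c d cd|y yD]; last first.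
  apply: (support (B := B)) => j hy; move/negP: yD; apply; apply/DP.
  by exists j => //; apply/le_isoc_hom.
by move=> /DP[j _ dj]; apply/DP; exists j => //; apply: le_isoc_trans dj.
Qed.
End EI.

(** * Resolutions *)
Section AlternatingSum.
Variable C : category.
Implicit Types M N P : qmodule C.

Lemma exact_kernel M N (f : qhom M N) : qsurjective f -> short_exact (qker_in f) f.
Proof. by move=> fs; split=> //; [exact: qker_in_inj|exact: qker_exact]. Qed.

Lemma kernel_fgproj M N (f : qhom M N) : fgproj M -> fgproj N -> qsurjective f ->
  fgproj (qker f).
Proof.
move=> pM pN fs; have [r [s [ri _ _ _ _]]] := split_exact pN (exact_kernel fs).
exact: fgproj_retract ri pM.
Qed.

(** The kernel of the augmentation is a direct summand of P_0, so it is f.g.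
    projective, and it is resolved by the shifted complex. *)
Lemma K0cl_resolution d : forall (M : qmodule C) (P : nat -> qmodule C)
  (del : forall n, qhom (P n.+1) (P n)) (eps : qhom (P 0%N) M),
  fgproj M -> (forall n, fgproj (P n)) ->
  (forall n, (d <= n)%N -> forall x (p : P n x), p = 0) ->
  qsurjective eps -> qexact (del 0%N) eps ->
  (forall n, qexact (del n.+1) (del n)) ->
  K0cl M = \sum_(n < d) (-1) ^+ n *: K0cl (P n).
Proof.
elim: d => [|d IH] M P del eps pM pP P0 es e0 ex.
  rewrite big_ord0 K0cl0// => x m; have [p <-] := es x m.
  by rewrite [p]P0// linear0.
have edel x p : eps x (del 0%N x p) = 0 by apply/e0; exists p.
have pK := kernel_fgproj (pP 0%N) pM es.
pose eps' := qker_lift edel.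
have eps's : qsurjective eps'.
  move=> x k; have [q qk] := (e0 x (qker_in eps x k)).1 (qker0 k).
  by exists q; apply: qker_in_inj; rewrite qker_liftE.
have ex0 : qexact (del 1%N) eps'.
  move=> x q; split=> [q0|[m <-]].
    by apply/(ex 0%N); rewrite -(qker_liftE edel) -/eps' q0 linear0.
  apply: qker_in_inj; rewrite qker_liftE linear0; apply/(ex 0%N).
  by exists m.
have e2 := IH _ (fun n => P n.+1) (fun n => del n.+1) eps' pK (fun n => pP n.+1)
  (fun n h x p => P0 n.+1 h x p) eps's ex0 (fun n => ex n.+1).
have e1 := K0cl_exact pK (pP 0%N) pM (exact_kernel es).
rewrite big_ord_recl expr0 scale1r e1.
have -> : \sum_(i < d) (-1) ^+ lift ord0 i *: K0cl (P (lift ord0 i)) = - K0cl (qker eps).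
  rewrite e2 -sumrN; apply: eq_bigr => i _.
  by rewrite /bump /= ?add1n exprS mulN1r scaleNr.
by rewrite addrAC subrr add0r.
Qed.
End AlternatingSum.

(** * The maps S, E and Res on K0 *)
Section SplitMaps.
Variables (C : category) (rep : isoc C -> C) (repP : forall c, iclass (rep c) = c).
Hypothesis EI : EI_category C.
Hypothesis qf : quasi_finite C.

Local Notation SK := (splitK0 rep).

Lemma tensb_rep_fgproj (G : groupType) (D : category) (X : biset G D) :
  fgproj (blin X) -> forall s : BG G, fgproj (tensb_functor X (qrep s)).
Proof. by move=> pX s; apply: (tensb_fgproj pX); apply: fgproj_qrep. Qed.

Definition K0_E : {linear SK -> K0 C} :=
  dlift (fun c => K0map (tensb_rep_fgproj (brep_fgproj (rep c)))).

Lemma K0_E_cl x (Q : qmodule (BG (aut (rep x)))) : fgproj Q ->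
  K0_E (Kin (K0cl Q)) = K0cl (Emod Q).
Proof. by move=> pQ; rewrite [LHS]dlift_in K0mapE. Qed.

Lemma rep_zero (P : qmodule C) (D : seq (isoc C)) :
  (forall y, iclass y \notin D -> forall m : P y, m = 0) ->
  forall c, c \notin D -> forall m : P (rep c), m = 0.
Proof. by move=> P0 c cD; apply: P0; rewrite repP. Qed.

Lemma S_support (P : qmodule C) : fgproj P ->
  exists2 A : set (isoc C), finite_set A &
    forall c, ~ A c -> forall u (p : S_functor (rep c) P u), p = 0.
Proof.
move=> pP; have [D [_ D0]] := finite_support qf pP.
exists [set` D]%classic; first exact: finite_seq.
move=> c /negP cD; apply: Smod0 => m.
by rewrite [m](rep_zero D0 cD) linear0.
Qed.

Lemma Res_support (P : qmodule C) : fgproj P ->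
  exists2 A : set (isoc C), finite_set A &
    forall c, ~ A c -> forall u (p : res_functor (rep c) P u), p = 0.
Proof.
move=> pP; have [D [_ D0]] := finite_support qf pP.
exists [set` D]%classic; first exact: finite_seq.
by move=> c /negP cD u; apply: rep_zero D0 c cD.
Qed.

Definition K0_S : {linear K0 C -> SK} :=
  K0family (T := fun c => S_functor (rep c)) (fun c s => S_rep_fgproj EI (rep c) s) S_support.
Lemma K0_S_cl P c : fgproj P -> K0_S (K0cl P) c = K0cl (Smod P (rep c)).
Proof. by move=> pP; rewrite [LHS]K0familyE. Qed.

Definition K0_Res : {linear K0 C -> SK} :=
  K0family (T := fun c => res_functor (rep c)) (fun c s => Res_rep_fgproj qf (rep c) s) Res_support.
Lemma K0_Res_cl P c : fgproj P -> K0_Res (K0cl P) c = K0cl (qres P (rep c)).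
Proof. by move=> pP; rewrite [LHS]K0familyE. Qed.

Lemma SK_ext (A : lmodType int) (f g : {linear SK -> A}) :
  (forall x (Q : qmodule (BG (aut (rep x)))), fgproj Q ->
    f (Kin (K0cl Q)) = g (Kin (K0cl Q))) -> f =1 g.
Proof.
move=> fg; apply: dsum_ext => x k.
pose i := mklin (@din_is_linear _ _ (fun x : isoc C => K0 (BG (aut (rep x)))) x).
have: f \o i =1 g \o i; last exact.
by apply: K0_ext => Q pQ; apply: fg.
Qed.

(** The summand at y of S_y E_x Q is Q if y = x and 0 otherwise. *)
Lemma K0_EK : cancel K0_E K0_S.
Proof.
have: K0_S \o K0_E =1 idfun; last exact.
apply: SK_ext => x Q pQ; rewrite -[LHS]/(K0_S (K0_E _)) K0_E_cl// -[RHS]/(Kin _).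
apply: dsumP => y; rewrite K0_S_cl; last exact: Emod_fgproj.
have [xy|xy] := pselect (x = y).
  by case: y / xy; rewrite /Kin dinE; apply: K0cl_iso pQ (Smod_Emod EI Q).
rewrite /Kin dinN// K0cl0//; apply: Smod_Emod0 => h.
by apply: xy; rewrite -(repP x) -(repP y); apply/iclassP/isomorphic_sym.
Qed.

(** ** The resolution step *)
Section Step.
Variable M : qmodule C.

Section Counit.
Variable x : C.
Definition cu_at y (f : brep x y) : {linear qres M x tt -> M y} := qact M f.
Lemma cu_atG y m g (f : brep x y) : cu_at f (@gact _ (qres M x) m g) = cu_at (blact (brep x) g f) m.
Proof. by rewrite -[RHS]/(qact M (aut_hom g \oc f) m) qactM. Qed.
Lemma cu_nat y z (u : hom y z) m (f : brep x z) :
  cu_at (bract (brep x) u f) m = qact M u (cu_at f m).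
Proof. exact: qactM. Qed.
(** The counit of the adjunction between E_x and evaluation at x: m (x) f goes to
    the restriction of m along f. *)
Definition counit : qhom (Emod (qres M x)) M := tensb_desc cu_atG cu_nat.

Local Notation BT := (bten (@gact (aut x) (qres M x)) (@blact (aut x) C (brep x) _)).
Lemma counitE y m (f : hom y x) : counit y (BT m f) = qact M f m.
Proof. exact: tensb_descE. Qed.

Lemma counit_inj p : counit x p = 0 -> p = 0.
Proof.
have l : linear (fun m : M x => BT m (idm x)) by exact: bten_linear.
have h q : BT (counit x q) (idm x) = q.
  have: mklin l \o counit x =1 idfun; last exact.
  apply: tensb_ext => m u; rewrite -[LHS]/(BT (counit x (BT m u)) (idm x)) counitE.
  rewrite -[LHS]/(BT (@gact _ (qres M x) m (AutElt (EI u))) (idm x)) btenS.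
  by congr (BT m _); apply: compm1.
by move=> p0; rewrite -[p]h p0 -[LHS]/(mklin l 0) linear0.
Qed.
End Counit.

Definition FD (D : seq (isoc C)) : qmodule C :=
  foldr (fun c Q => qpair (Emod (qres M (rep c))) Q) (qzero C) D.

(** The direct sum FD is an iterated sum of pairs, so that its class in K0 and the
    maps out of it are found by induction on the list D. *)
Fixpoint FDmap (D : seq (isoc C)) : qhom (FD D) M :=
  match D return qhom (FD D) M with
  | [::] => q0h _ _
  | c :: D' => qcopair (counit (rep c)) (FDmap D')
  end.

Lemma FDmapE c D y (p : Emod (qres M (rep c)) y) (q : FD D y) :
  FDmap (c :: D) y (p, q) = counit (rep c) y p + FDmap D y q.
Proof. by []. Qed.

Lemma FDmap_surj D y : iclass y \in D -> forall m, exists p, FDmap D y p = m.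
Proof.
elim: D => // c D IH; rewrite in_cons => /orP[/eqP yc|yD] m; last first.
  by have [p <-] := IH yD m; exists (0, p); rewrite FDmapE linear0 add0r.
have [f [g [gf _]]] : isomorphic y (rep c) by apply/iclassP; rewrite yc repP.
exists (bten (@gact _ (qres M (rep c))) (@blact _ C (brep (rep c)) _) (qact M g m) f, 0).
by rewrite FDmapE linear0 addr0 [LHS]counitE -qactM gf qact1.
Qed.

Lemma FD0 D x : (forall d, d \in D -> ~ inhabited (hom x (rep d))) -> forall p : FD D x, p = 0.
Proof.
elim: D => [|d D IH] nx; first by move=> p; apply/rowP => -[].
move=> [p q]; have -> : p = 0 by apply: Emod0; apply: nx; rewrite mem_head.
have -> : q = 0 by apply: IH => e eD; apply: nx; rewrite in_cons eD orbT.
by [].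
Qed.

(** At a maximal c the summands of classes other than c vanish, and the counit at c
    is an isomorphism. *)
Lemma FDmap_inj D c : uniq D -> c \in D ->
  (forall d, d \in D -> le_isoc c d -> d = c) ->
  forall p, FDmap D (rep c) p = 0 -> p = 0.
Proof.
have nohom d : (le_isoc c d -> d = c) -> d <> c -> ~ inhabited (hom (rep c) (rep d)).
  by move=> cd dc /(le_isoc_hom (rep c)); rewrite !repP => /cd.
elim: D => // d D IH; rewrite cons_uniq => /andP[dD uD]; rewrite in_cons => /orP[/eqP cd|cD] mx [p q]; rewrite FDmapE.
  have q0 : q = 0.
    apply: FD0 => e eD; apply: nohom; first by apply: mx; rewrite in_cons eD orbT.
    by move=> ec; rewrite -cd -ec eD in dD.
  rewrite q0 linear0 addr0 => p0; congr pair.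
  by case: d / cd p p0 {mx dD IH} => p /counit_inj.
have p0 : p = 0.
  apply: Emod0; apply: nohom; first by apply: mx; rewrite mem_head.
  by move=> dc; rewrite dc cD in dD.
rewrite p0 linear0 add0r => /(IH uD cD) ->//.
by move=> e eD; apply: mx; rewrite in_cons eD orbT.
Qed.
End Step.

(** The modules to which the resolution step applies. The step reduces the list D,
    so induction on its size terminates. *)
Record controlled (M : qmodule C) (D : seq (isoc C)) : Prop := Controlled {
  ctl_uniq : uniq D;
  ctl_down : forall c d, le_isoc c d -> d \in D -> c \in D;
  ctl_proj : forall c, fgproj (qres M (rep c));
  ctl_zero : forall y, iclass y \notin D -> forall m : M y, m = 0 }.

Lemma maximal_ex (D : seq (isoc C)) : D != [::] ->
  exists2 c, c \in D & forall d, d \in D -> le_isoc c d -> d = c.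
Proof.
elim: D => // c D IH _; have [->|/IH [d dD dmax]] := eqVneq D [::].
  by exists c; rewrite ?mem_head// => d; rewrite mem_seq1 => /eqP.
have [dc|dc] := pselect (le_isoc d c).
  exists c; first by rewrite mem_head.
  move=> e; rewrite in_cons => /orP[/eqP //|eD] ce.
  have ed := dmax _ eD (le_isoc_trans dc ce).
  by apply/(le_isoc_anti EI) => //; rewrite ed.
exists d; first by rewrite in_cons dD orbT.
by move=> e; rewrite in_cons => /orP[/eqP ->//|]; apply: dmax.
Qed.

Lemma FD_fgproj M D : (forall c, fgproj (qres M (rep c))) -> fgproj (FD M D).
Proof.
move=> pM; elim: D => [|c D IH] /=; first exact/fgproj_zero/qzero0.
by apply: fgproj_pair => //; apply: Emod_fgproj.
Qed.

Lemma FD_surj M D : controlled M D -> qsurjective (FDmap M D).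
Proof.
move=> ctl y m; have [yD|yD] := boolP (iclass y \in D); first exact: FDmap_surj.
by exists 0; rewrite linear0 [m](ctl_zero ctl).
Qed.

(** The values of M are projective, so those of the kernel are direct summands of
    those of FD; and the kernel vanishes at a maximal element of D. *)
Lemma kernel_controlled M D : controlled M D -> D != [::] ->
  exists2 D', controlled (qker (FDmap M D)) D' & (size D' < size D)%N.
Proof.
move=> ctl D0; have [c cD cmax] := maximal_ex D0.
have [uD dD pM M0] := ctl; have pF := FD_fgproj D pM; have sF := FD_surj ctl.
exists (rem c D); last by rewrite size_rem// prednK// -has_predT; case: (D) D0.
split.
- exact: rem_uniq.
- move=> d e de; rewrite !mem_rem_uniq// !inE => /andP[ec eD].
  rewrite (dD _ _ de eD) andbT; apply: contraNneq ec => dc.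
  by apply/eqP/cmax => //; rewrite -dc.
- move=> d.
  have ex : short_exact (res_map (rep d) (qker_in (FDmap M D))) (res_map (rep d) (FDmap M D)).
    split=> [u k l|u p|u m]; first exact: (@qker_in_inj _ _ _ (FDmap M D) (rep d) k l).
      exact: (@qker_exact _ _ _ (FDmap M D) (rep d) p).
    exact: (sF (rep d) m).
  have [r [s [ri _ _ _ _]]] := split_exact (pM d) ex.
  exact: fgproj_retract ri (qres_fgproj qf (rep d) pF).
move=> y yD k; apply: qker_in_inj; rewrite linear0.
move: yD; rewrite mem_rem_uniq// !inE negb_and negbK => /orP[/eqP yc|yD].
  have [f [g [gf fg]]] : isomorphic y (rep c) by apply/iclassP; rewrite yc repP.
  rewrite -[LHS](qact1) -gf qactM.
  have -> : qact (FD M D) g (qker_in (FDmap M D) y k) = 0; last by rewrite linear0.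
  by apply: FDmap_inj uD cD cmax _ _; rewrite qnat qker0 linear0.
apply: FD0 => d dD' yd; move/negP: yD; apply; apply: dD dD'.
by have := (le_isoc_hom y (rep d)).2 yd; rewrite repP.
Qed.

Lemma FD_K0_E M D : (forall c, fgproj (qres M (rep c))) -> exists v, K0_E v = K0cl (FD M D).
Proof.
move=> pM; elim: D => [|c D [v vE]] /=.
  by exists 0; rewrite linear0 K0cl0//; apply: qzero0.
exists (Kin (K0cl (qres M (rep c))) + v); rewrite linearD vE K0_E_cl//.
rewrite (exact_additive_pair (@K0cl_additive C))//; first exact: Emod_fgproj.
exact: FD_fgproj.
Qed.

Lemma controlled_K0_E n : forall M D, (size D <= n)%N -> controlled M D -> fgproj M ->
  exists v, K0_E v = K0cl M.
Proof.
elim: n => [|n IH] M D sD ctl pM; have [D0|D0] := eqVneq D [::].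
- exists 0; rewrite linear0 K0cl0// => x m; apply: (ctl_zero ctl).
  by rewrite D0.
- by move: sD D0; rewrite leqn0 size_eq0 => ->.
- exists 0; rewrite linear0 K0cl0// => x m; apply: (ctl_zero ctl).
  by rewrite D0.
have [D' ctl' sD'] := kernel_controlled ctl D0.
have pF := FD_fgproj D (ctl_proj ctl); have sF := FD_surj ctl.
have pK := kernel_fgproj pF pM sF.
have [v vE] := IH _ _ (leq_trans sD' sD) ctl' pK.
have [w wE] := FD_K0_E D (ctl_proj ctl).
exists (w - v); rewrite linearB vE wE.
by rewrite (K0cl_exact pK pF pM (exact_kernel sF)) addrAC subrr add0r.
Qed.

Lemma fgproj_controlled P : fgproj P -> exists D, controlled P D.
Proof.
move=> pP; have [D [dD D0]] := finite_support qf pP.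
exists (undup D); split.
- exact: undup_uniq.
- by move=> c d cd; rewrite !mem_undup; apply: dD.
- by move=> c; apply: qres_fgproj.
- by move=> y; rewrite mem_undup; apply: D0.
Qed.

Lemma K0_E_surj k : exists v, K0_E v = k.
Proof.
move: k; apply: K0_ind => [|u v [u' <-] [v' <-]|P pP].
- by exists 0; rewrite linear0.
- by exists (u' - v'); rewrite linearB.
have [D ctl] := fgproj_controlled pP.
exact: controlled_K0_E (leqnn _) ctl pP.
Qed.

Lemma K0_SK : cancel K0_S K0_E.
Proof. by move=> k; have [v <-] := K0_E_surj k; rewrite K0_EK. Qed.

(** Splice the resolution of the kernel to the surjection from FD. *)
Lemma controlled_resolution n : forall M D, (size D <= n)%N -> controlled M D ->
  exists k, resolution_class M k.
Proof.
have res0 (M : qmodule C) : (forall x (m : M x), m = 0) -> exists k, resolution_class M k.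
  move=> M0; eexists; exists 0%N, (fun=> qzero C), (fun=> q0h _ _), (q0h _ M).
  split; last reflexivity; split=> //.
  - by move=> _; apply/fgproj_zero/qzero0.
  - by move=> i _ x p; apply: qzero0.
  - by move=> x m; exists 0; rewrite [m]M0 linear0.
  - by move=> x p; split=> _; [exists 0; rewrite [RHS]qzero0 linear0|].
  - by move=> i x p; split=> _; [exists 0; rewrite [RHS]qzero0 linear0|rewrite [LHS]qzero0].
elim: n => [|n IH] M D sD ctl; have [D0|D0] := eqVneq D [::].
- by apply: res0 => x; apply: (ctl_zero ctl); rewrite D0.
- by move: sD D0; rewrite leqn0 size_eq0 => ->.
- by apply: res0 => x; apply: (ctl_zero ctl); rewrite D0.
have [D' ctl' sD'] := kernel_controlled ctl D0.
have pF := FD_fgproj D (ctl_proj ctl); have sF := FD_surj ctl.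
have [k [d [P [del [eps [[pP P0 es e0 ex] _]]]]]] := IH _ _ (leq_trans sD' sD) ctl'.
pose P' (i : nat) := if i is j.+1 then P j else FD M D.
pose del' (i : nat) : qhom (P' i.+1) (P' i) :=
  match i return qhom (P' i.+1) (P' i) with
  | 0%N => qcomp (qker_in (FDmap M D)) eps
  | j.+1 => del j end.
eexists; exists d.+1, P', del', (FDmap M D).
split; last reflexivity; split=> //.
- by case.
- by case=> // i di x; apply: P0.
- move=> x p; split=> [/qker_ex[k' <-]|[q <-]]; last exact: qker0.
  by have [q <-] := es x k'; exists q.
case=> [|i] //; last exact: ex.
move=> x q; split=> [q0|/(e0 x q).2 q0]; last by rewrite /= q0.
by apply/e0; apply: qker_in_inj; rewrite linear0.
Qed.
End SplitMaps.

(** * Chains and Moebius inversion *)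
Section Chains.
Variable C : category.
Hypothesis EI : EI_category C.
Hypothesis fin_down : forall d : isoc C, finite_set [set c | le_isoc c d]%classic.
Local Notation I := (isoc C).
Implicit Types x y z : I.
Local Notation chain y x := {classic {l & @ichain C l y x}}.

Lemma down_sig x : {s : seq I | uniq s & forall c, (c \in s) <-> le_isoc c x}.
Proof.
have ex : exists s : seq I, uniq s /\ forall c, (c \in s) <-> le_isoc c x.
  have [s sE] := (finite_seqP _).1 (fin_down x).
  exists (undup s); split=> [|c]; first exact: undup_uniq.
  rewrite mem_undup; have -> : (c \in s) = [set` s]%classic c :> Prop by [].
  by rewrite -sE.
by have [s [us sP]] := cid ex; exists s.
Qed.
Definition down x : seq I := s2val (down_sig x).
Lemma down_uniq x : uniq (down x). Proof. exact: (s2valP (down_sig x)). Qed.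
Lemma downP x c : (c \in down x) <-> le_isoc c x.
Proof. exact: (s2valP' (down_sig x)). Qed.

Lemma lt_isoc_irr y z : lt_isoc y z -> le_isoc z y -> False.
Proof. by move=> [yz ne] zy; apply: ne; apply: le_isoc_anti. Qed.

Lemma ichain_le l y x : ichain l y x -> le_isoc y x.
Proof.
elim=> [z|{}l {}y z {}x [yz _] _ zx]; first exact: le_isoc_refl.
exact: le_isoc_trans yz zx.
Qed.

Fixpoint vertices l y x (c : @ichain C l y x) : seq I :=
  match c with ChainNil x => [:: x] | ChainCons _ y _ _ _ c' => y :: vertices c' end.

Lemma vertices_size l y x (c : ichain l y x) : size (vertices c) = l.+1.
Proof. by elim: c => //= *; congr _.+1. Qed.

Lemma vertices_le l y x (c : ichain l y x) z : z \in vertices c -> le_isoc y z /\ le_isoc z x.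
Proof.
elim: c => [w|{}l {}y w {}x yw c IH] /=.
  by rewrite mem_seq1 => /eqP ->; split; apply: le_isoc_refl.
rewrite in_cons => /orP[/eqP ->|/IH[wz zx]].
  split; first exact: le_isoc_refl.
  exact: le_isoc_trans yw.1 (ichain_le c).
by split=> //; apply: le_isoc_trans yw.1 wz.
Qed.

Lemma vertices_uniq l y x (c : ichain l y x) : uniq (vertices c).
Proof.
elim: c => //= {}l {}y w {}x yw c ->; rewrite andbT; apply/negP => /vertices_le[wy _].
exact: lt_isoc_irr yw wy.
Qed.

(** A chain has distinct vertices, all below its end. *)
Lemma ichain_bound l y x : ichain l y x -> (l < size (down x))%N.
Proof.
move=> c; rewrite -(vertices_size c); apply: uniq_leq_size; first exact: vertices_uniq.
by move=> z /vertices_le[_ zx]; apply/downP.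
Qed.

Definition consC y z x (h : lt_isoc y z) (c : chain z x) : chain y x :=
  existT _ (tag c).+1 (ChainCons h (tagged c)).
Definition nilC x : chain x x := existT _ 0%N (ChainNil x).

(** The chain without its first vertex. It recovers z and c from consC h c, which
    replaces inversion of the indexed family of chains. *)
Definition next y x (c : chain y x) : option {z : I & chain z x} :=
  let: existT _ c' := c in
  match c' in ichain _ y x return option {z : I & chain z x} with
  | ChainNil _ => None
  | ChainCons l _ z x _ c'' => Some (existT (fun z => chain z x) z (existT _ l c''))
  end.

Lemma next_cons y z x (h : lt_isoc y z) (c : chain z x) :
  next (consC h c) = Some (existT (fun z => chain z x) z c).
Proof. by case: c. Qed.

Lemma consC_inj y z x (h : lt_isoc y z) : injective (@consC y z x h).
Proof.
move=> c c' /(congr1 (@next y x)); rewrite !next_cons => -[].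
by move=> /(congr1 (tagged_as (existT (fun z => chain z x) z c))); rewrite !tagged_asE.
Qed.

Definition nils y x : seq (chain y x) :=
  if pselect (x = y) is left e then [:: match e in _ = y0 return chain y0 x with erefl => nilC x end] else [::].

(** The chains of length less than n, listed by their second vertex. *)
Fixpoint chains n y x : seq (chain y x) :=
  if n is n'.+1 then
    nils y x ++ flatten [seq (if pselect (lt_isoc y z) is left h
      then [seq consC h c | c <- chains n' z x] else [::]) | z <- down x]
  else [::].

Lemma mem_chains n y x (c : chain y x) : (tag c < n)%N -> c \in chains n y x.
Proof.
elim: n y c => // n IH y [l c] /=; rewrite ltnS mem_cat => ln.
case: c ln IH => {l y x} [x|l y z x yz c] ln IH.
  rewrite /nils; case: pselect => // e.
  by rewrite (Prop_irrelevance e erefl) mem_seq1 eqxx.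
apply/orP; right; apply/flattenP.
exists [seq consC yz c | c <- chains n z x].
  apply/mapP; exists z; first exact/downP/ichain_le/c.
  by case: pselect => // h; rewrite (Prop_irrelevance h yz).
by apply/mapP; exists (existT _ l c : chain z x) => //; apply: IH.
Qed.

Lemma uniq_flatten_key (T U : eqType) (f : T -> seq U) (key : U -> option T) s :
  (forall t u, u \in f t -> key u = Some t) -> (forall t, uniq (f t)) -> uniq s ->
  uniq (flatten [seq f t | t <- s]).
Proof.
move=> fk fu; elim: s => //= z s IH /andP[zs us]; rewrite cat_uniq fu IH// andbT /=.
apply/hasPn => u /flattenP[_ /mapP[w ws ->] uw]; apply/negP => uz.
have := fk _ _ uw; rewrite (fk _ _ uz) => -[zw].
by rewrite zw ws in zs.
Qed.

Lemma chains_uniq n y x : uniq (chains n y x).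
Proof.
elim: n y => //= n IH y; rewrite cat_uniq; apply/and3P; split.
- by rewrite /nils; case: pselect.
- apply/hasPn => c /flattenP[_ /mapP[z _ ->]]; case: pselect => // h /mapP[c' _ ->] {c}.
  rewrite /nils; case: pselect => // e.
  case: y / e h => h; rewrite mem_seq1; apply/negP => /eqP /(congr1 (@next x x)).
  by rewrite next_cons.
apply: (@uniq_flatten_key _ _ _ (fun c => omap (fun p => tag p) (next c))).
- by move=> z c; case: pselect => // h /mapP[c' _ ->]; rewrite next_cons.
- by move=> z; case: pselect => // h; rewrite map_inj_uniq//; apply: consC_inj.
exact: down_uniq.
Qed.

Lemma all_chains_fin y x : finite_set (@all_chains C y x).
Proof.
apply/finite_seqP; exists (chains (size (down x)) y x).
apply/seteqP; split=> // c _ /=; apply: mem_chains.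
by case: c => l c; apply: ichain_bound c.
Qed.

Lemma sum_all_chains (V : nmodType) n y x (F : chain y x -> V) : (size (down x) <= n)%N ->
  \sum_(c \in @all_chains C y x) F c = \sum_(c <- chains n y x) F c.
Proof.
move=> xn; rewrite (fsbig_seq _ _ (chains_uniq n y x)).
congr (\sum_(c \in _) F c); apply/seteqP; split=> // c _ /=; apply: mem_chains.
by case: c => l c; apply: leq_trans (ichain_bound c) xn.
Qed.

(** ** Upper triangular unipotent matrices *)
Section Incidence.
Variables (A : I -> lmodType int) (T : forall y x, {linear A x -> A y}).
Hypothesis T1 : forall x a, T x x a = a.
Hypothesis T0 : forall y x a, ~ le_isoc y x -> T y x a = 0.
Local Notation W := (dsum A).

(** The composite of the matrix entries along the steps of a chain. *)
Fixpoint chain_op l y x (c : ichain l y x) : {linear A x -> A y} :=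
  match c in ichain _ y x return {linear A x -> A y} with
  | ChainNil x => idfun
  | ChainCons _ y z x _ c' => T y z \o chain_op c'
  end.

Definition mu_val y x (a : A x) : A y :=
  \sum_(c \in @all_chains C y x) (-1) ^+ tag c *: chain_op (tagged c) a.

(** A chain from y to x is trivial or consists of a step from y to some z and a
    chain from z to x. With N the strict part of the matrix, this is mu = 1 - N mu. *)
Lemma mu_val_rec y x (a : A x) : mu_val y a =
  din A x a y - \sum_(z <- down x | `[< lt_isoc y z >]) T y z (mu_val z a).
Proof.
rewrite /mu_val (sum_all_chains _ (leqnSn _)) [chains _ _ _]/= big_cat big_flatten big_map.
congr (_ + _).
  rewrite /nils; case: pselect => [e|ne]; last by rewrite big_nil dinN.
  by case: y / e; rewrite dinE big_seq1 /= expr0 scale1r.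
rewrite -sumrN [RHS]big_mkcond; apply: eq_bigr => z _.
rewrite (sum_all_chains _ (leqnn _)).
case: pselect => [h|h]; case: asboolP => // _; last by rewrite big_nil.
rewrite big_map linear_sum -sumrN; apply: eq_bigr => c _ /=.
rewrite exprS mulN1r scaleNr; congr (- _); exact/esym/linearZ_LR.
Qed.

Lemma mu_val0 y x (a : A x) : ~ le_isoc y x -> mu_val y a = 0.
Proof. by move=> yx; rewrite /mu_val fsbig1// => -[l c] _; case: yx; apply: ichain_le c. Qed.

Lemma mu_val_linear y x : linear (@mu_val y x).
Proof.
move=> r a b; rewrite /mu_val !(sum_all_chains _ (leqnn _)) scaler_sumr -big_split.
apply: eq_bigr => c _ /=; rewrite linearP scalerDr !scalerA.
by rewrite mulrC.
Qed.

Lemma mu_in_fin x (a : A x) : finite_set [set y | mu_val y a != 0]%classic.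
Proof.
apply: sub_finite_set (fin_down x) => y /= ya; apply: contrapT => /(@mu_val0 y x a).
by move=> e; rewrite e eqxx in ya.
Qed.
Definition mu_in x (a : A x) : W := DSum (mu_in_fin a).
Lemma mu_in_linear x : linear (@mu_in x).
Proof. by move=> r a b; apply: dsumP => y; apply: mu_val_linear. Qed.
Definition mu : {linear W -> W} := dlift (fun x => mklin (@mu_in_linear x)).
Lemma muE x (a : A x) y : mu (din A x a) y = mu_val y a.
Proof. exact: (congr1 (fun w : W => w y) (dlift_in (fun x => mklin (@mu_in_linear x)) a)). Qed.

Lemma omega_in_fin x (a : A x) : finite_set [set y | T y x a != 0]%classic.
Proof.
apply: sub_finite_set (fin_down x) => y /= ya; apply: contrapT => yx.
by rewrite T0 ?eqxx in ya.
Qed.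
Definition omega_in x (a : A x) : W := DSum (omega_in_fin a).
Lemma omega_in_linear x : linear (@omega_in x).
Proof. by move=> r a b; apply: dsumP => y; apply: linearP. Qed.
Definition omega : {linear W -> W} := dlift (fun x => mklin (@omega_in_linear x)).
Lemma omegaE x (a : A x) y : omega (din A x a) y = T y x a.
Proof. exact: (congr1 (fun w : W => w y) (dlift_in (fun x => mklin (@omega_in_linear x)) a)). Qed.

Lemma omega_sum (v : W) (s : seq I) y : uniq s -> (forall z, z \notin s -> v z = 0) ->
  omega v y = \sum_(z <- s) T y z (v z).
Proof.
move=> us v0.
have vE : v = \sum_(z <- s) din A z (v z).
  apply: dsumP => z; rewrite -[RHS]/(dcoord z _) linear_sum.
  have [zs|zs] := boolP (z \in s); last first.
    rewrite v0// big_seq big1// => w ws; rewrite -[LHS]/(din A w (v w) z) dinN// => wz.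
    by rewrite -wz ws in zs.
  rewrite (bigD1_seq z)// -[X in _ = X + _]/(din A z (v z) z) dinE big1 ?addr0// => w wz.
  by rewrite -[LHS]/(din A w (v w) z) dinN// => e; rewrite e eqxx in wz.
rewrite {1}vE linear_sum -[LHS]/(dcoord y _) linear_sum.
by apply: eq_bigr => z _; apply: omegaE.
Qed.

(** The recursion for mu, read with the diagonal entry of omega moved to the other
    side. *)
Lemma omega_muK : cancel mu omega.
Proof.
have: omega \o mu =1 idfun; last exact.
apply: dsum_ext => x a; rewrite -[LHS]/(omega (mu (din A x a))) -[RHS]/(din A x a).
apply: dsumP => y; rewrite (omega_sum y (down_uniq x)); last first.
  by move=> z /negP zx; rewrite muE mu_val0// => /downP.
under eq_bigr => z _ do rewrite muE.
rewrite (bigID (fun z => `[< lt_isoc y z >])).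
have -> : din A x a y = mu_val y a + \sum_(z <- down x | `[< lt_isoc y z >]) T y z (mu_val z a).
  by rewrite mu_val_rec subrK.
rewrite addrC; congr (_ + _).
(* What remains is the diagonal term, which occurs only if y <= x. *)
have [yx|yx] := boolP (y \in down x); last first.
  rewrite mu_val0; last by move=> /downP; exact/negP.
  rewrite big_seq_cond big1// => z /andP[zx /asboolP yz]; apply: T0 => le_yz.
  move/negP: yx; apply; apply/downP; apply: le_isoc_trans le_yz _.
  exact/downP.
rewrite -big_filter (bigD1_seq y) ?filter_uniq ?down_uniq//=; last first.
  by rewrite mem_filter yx andbT; apply/asboolP => -[].
rewrite T1 big_filter_cond big1 ?addr0// => z /andP[/asboolP yz zy].
apply: T0 => le_yz; apply: yz; split=> // e.
by rewrite e eqxx in zy.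
Qed.

(** At a maximal class c of the support of v, all terms of the coordinate of
    omega v vanish except v c. *)
Lemma omega_inj (v : W) : omega v = 0 -> v = 0.
Proof.
move=> ov; have [s us sP] : exists2 s : seq I, uniq s & forall z, (z \in s) <-> v z != 0.
  have [s sE] := (finite_seqP _).1 (dsum_finite v : finite_set ([set i : I | v i != 0]%classic)).
  exists (undup s); first exact: undup_uniq.
  move=> z; rewrite mem_undup; have -> : (z \in s) = [set` s]%classic z :> Prop by [].
  by rewrite -sE.
have [s0|s0] := eqVneq s [::].
  by apply: dsum_eq0 => z; apply/eqP/negPn/negP => /sP; rewrite s0.
have [c cs cmax] := maximal_ex EI s0.
have vc : v c = 0.
  have := congr1 (fun w : W => w c) ov.
  rewrite (omega_sum c us); last by move=> z /negP zs; apply/eqP/negPn/negP => /sP.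
  rewrite (bigD1_seq c)//= T1 big_seq_cond big1 ?addr0// => z /andP[zs zc].
  by apply: T0 => /(cmax _ zs) e; rewrite e eqxx in zc.
by move/sP: cs; rewrite vc eqxx.
Qed.

Lemma mu_omegaK : cancel omega mu.
Proof.
move=> v; apply/eqP; rewrite -subr_eq0; apply/eqP/omega_inj.
by rewrite linearB omega_muK subrr.
Qed.
End Incidence.
End Chains.

(** * The values of I_x Q *)
Section ImodValues.
Variables (C : category) (EI : EI_category C) (x : C) (Q : qmodule (BG (aut x))).

Lemma Imod0 y : ~ isomorphic y x -> forall m : Imod EI Q y, m = 0.
Proof.
move=> yx; have: forall m : Iob Q y, m = 0; last exact.
rewrite /Iob; case: (pselect (isomorphic y x)) => // nyx m.
by apply/rowP => -[].
Qed.

(** At the objects isomorphic to x, the modules I_x Q and E_x Q agree. *)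
Definition Iproj y : {linear Iob Q y -> Emod Q y} :=
  match pselect (isomorphic y x) as b
    return {linear (if b then Emod Q y else 'rV[rat]_0 : lmodType rat) -> Emod Q y}
  with left _ => idfun | right _ => \0 end.

Lemma Iproj_act y (u : hom y y) m : Iproj y (Iact Q u m) = qact (Emod Q) u (Iproj y m).
Proof.
by rewrite /Iact /Iproj; move: m; rewrite /Iob; case: pselect => yx m //=; rewrite linear0.
Qed.

Lemma Iproj_bij y : isomorphic y x -> bijective (Iproj y).
Proof.
by rewrite /Iproj /Iob; case: pselect => // yx yx'; exists idfun.
Qed.

Lemma Imod_res : qiso (qres (Imod EI Q) x) Q.
Proof.
apply: qiso_trans (Emod_res EI Q).
apply: (@bg_iso _ (qres (Imod EI Q) x) (qres (Emod Q) x) (Iproj x)) => [g m|].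
  exact: Iproj_act.
exact/Iproj_bij/isomorphic_refl.
Qed.
End ImodValues.

(** * Rational coefficients *)
Section TensorQ.
Variable I : Type.
Local Notation ZQ := (zmodule rat : lmodType int).
Local Notation V := (dsum (fun _ : I => ZQ)).
Local Notation UQ := (tensZQ (freemod int I)).

Lemma tenQ_linr x : linear (fun q : ZQ => tenQ (fbasis int (x : I)) q).
Proof. by move=> r q q'; apply: tenPr. Qed.

(** Together with fromUQ, the identification of U (x) Q with the finitely supported
    rational functions, on which the matrices act by coordinates. *)
Definition toUQ : {linear V -> UQ} := dlift (fun x => mklin (tenQ_linr x)).
Lemma toUQ_in x (q : ZQ) : toUQ (din (fun=> ZQ) x q) = tenQ (fbasis int x) q.
Proof. exact: (dlift_in (fun x => mklin (tenQ_linr x)) q). Qed.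

Lemma fromUQ_fin (u : freemod int I) (q : ZQ) :
  finite_set [set x | (u x : int) *: q != 0]%classic.
Proof.
apply: sub_finite_set (dsum_finite u) => x /=; apply: contraNN => /eqP ->.
by rewrite scale0r.
Qed.
Definition fromUQ_fun (u : freemod int I) (q : ZQ) : V :=
  DSum (M := fun=> ZQ) (fromUQ_fin u q).
Lemma fromUQ_l r u u' q : fromUQ_fun (r *: u + u') q = r *: fromUQ_fun u q + fromUQ_fun u' q.
Proof. by apply: dsumP => x; rewrite dsumDE dsumZE /= scalerDl scalerA. Qed.
Lemma fromUQ_r r u q q' : fromUQ_fun u (r *: q + q') = r *: fromUQ_fun u q + fromUQ_fun u q'.
Proof. by apply: dsumP => x; rewrite dsumDE dsumZE /= scalerDr !scalerA mulrC. Qed.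
Definition fromUQ : {linear UQ -> V} :=
  tlift (S := void) (ra := fun a _ => a) (lb := fun _ q => q) fromUQ_l fromUQ_r
    (fun _ _ _ => erefl).
Lemma fromUQ_ten u q : fromUQ (tenQ u q) = fromUQ_fun u q.
Proof. exact: tlift_ten. Qed.
Lemma fromUQ_basis x (q : ZQ) : fromUQ (tenQ (fbasis int x) q) = din (fun=> ZQ) x q.
Proof.
rewrite fromUQ_ten; apply: dsumP => y; rewrite [LHS]/= -[X in X *: _]/((fbasis int x : freemod int I) y).
rewrite fbasisE; case: asboolP => [<-|xy]; first by rewrite dinE scale1r.
by rewrite dinN// scale0r.
Qed.

Lemma toUQK : cancel toUQ fromUQ.
Proof.
have: fromUQ \o toUQ =1 idfun; last exact.
apply: dsum_ext => x q; rewrite -[LHS]/(fromUQ (toUQ (din _ x q))) toUQ_in.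
exact: fromUQ_basis.
Qed.

Lemma fromUQK : cancel fromUQ toUQ.
Proof.
have: toUQ \o fromUQ =1 idfun; last exact.
apply: tens_ext => u q.
have l : linear (fun u : freemod int I => tenQ u (q : ZQ)) by move=> r v w; apply: tenP.
have: (toUQ \o fromUQ) \o mklin l =1 mklin l; last exact.
apply: freemod_ext => x; rewrite -[LHS]/(toUQ (fromUQ (tenQ (fbasis int x) q))).
by rewrite fromUQ_basis toUQ_in.
Qed.
End TensorQ.
Arguments toUQ {I}.
Arguments fromUQ {I}.

Lemma dmap_coord (R : pzRingType) (I : Type) (M N : I -> lmodType R)
    (f : forall i, {linear M i -> N i}) (v : dsum M) i : dmap f v i = f i (v i).
Proof.
have: dcoord i \o dmap f =1 f i \o dcoord i; last exact.
apply: dsum_ext => j m; rewrite -[LHS]/(dmap f (din M j m) i) dmap_in.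
rewrite -[RHS]/(f i (din M j m i)).
have [ji|ji] := pselect (j = i); last by rewrite !dinN// linear0.
by case: i / ji; rewrite !dinE.
Qed.

Lemma toUQ_sum (C : category) (v : dsum (fun _ : isoc C => (zmodule rat : lmodType int))) :
  toUQ v = \sum_(y \in [set: isoc C]%classic) tenQ (fbasis int y) (v y).
Proof.
rewrite -[LHS]/(\sum_(y \in [set: {classic isoc C}]%classic) tenQ (fbasis int (y : isoc C)) (v y)).
by rewrite (@reindex_fsbigT _ _ _ (isoc C) {classic isoc C} id)//; exists id.
Qed.

(** * Inverse pairs of maps and their ranks *)
Section Final.
Variables (R : realType) (C : category) (rep : isoc C -> C).
Hypothesis repP : forall c, iclass (rep c) = c.
Hypothesis EI : EI_category C.
Hypothesis qf : quasi_finite C.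
Hypothesis free : free_category C.
Local Notation I := (isoc C).
Local Notation SK := (splitK0 rep).
Local Notation K x := (K0 (BG (aut (rep x)))).
Local Notation ZQ := (zmodule rat : lmodType int).
Local Notation V := (dsum (fun _ : I => ZQ)).
Local Notation UQ := (tensZQ (freemod int I)).

Lemma fin_down : forall d : I, finite_set [set c | le_isoc c d]%classic.
Proof. by case: qf. Qed.

Lemma mor_le (y x : I) : hom (rep y) (rep x) -> le_isoc y x.
Proof. by move=> f; rewrite -(repP y) -(repP x); apply/le_isoc_hom. Qed.

Lemma tensb_bmor_fgproj (x y : C) P : fgproj P -> fgproj (tensb (bmor y x) P).
Proof. by move=> pP; apply: (tensb_fgproj (X := bmor y x) (bmor_fgproj qf x y) pP). Qed.

Definition TK (y x : I) : {linear K x -> K y} :=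
  K0map (tensb_rep_fgproj (bmor_fgproj qf (rep x) (rep y))).
Lemma TKE y x P : fgproj P -> TK y x (K0cl P) = K0cl (tensb (bmor (rep y) (rep x)) P).
Proof. exact: K0mapE. Qed.

Lemma res_Emod (y x : C) (Q : qmodule (BG (aut x))) :
  qiso (qres (Emod Q) y) (tensb (bmor y x) Q).
Proof.
apply: (@bg_iso _ (qres (Emod Q) y) (tensb (bmor y x) Q) idfun) => [g m|].
  have: qact (Emod Q) (aut_hom g) =1
    @qact _ (tensb (bmor y x) Q) tt tt (g : @hom (BG (aut y)) tt tt); last exact.
  apply: tensb_ext => {}m f; rewrite [LHS]tensb_act_bten.
  exact/esym/(@tensb_act_bten _ _ (bmor y x) Q tt tt g).
by exists idfun.
Qed.

Lemma tensb_bmor1 (x : C) (Q : qmodule (BG (aut x))) : qiso (tensb (bmor x x) Q) Q.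
Proof. exact: qiso_trans (qiso_sym (res_Emod x Q)) (Emod_res EI Q). Qed.

Lemma TK1 x k : TK x x k = k.
Proof.
have: TK x x =1 idfun; last exact.
apply: K0_ext => P pP; rewrite -[LHS]/(TK x x (K0cl P)) TKE//; apply: K0cl_iso pP _.
exact: tensb_bmor1.
Qed.

Lemma TK0 y x k : ~ le_isoc y x -> TK y x k = 0.
Proof.
move=> yx; have: TK y x =1 (\0 : {linear K x -> K y}); last exact.
apply: K0_ext => P pP; rewrite -[LHS]/(TK y x (K0cl P)) TKE// K0cl0// => u; apply: tensb_empty => f.
by apply: yx; apply: mor_le.
Qed.

Local Notation omegaK := (omega fin_down TK0).
Local Notation muK := (mu EI fin_down TK).

Lemma K0_Res_E v : K0_Res repP qf (K0_E rep v) = omegaK v.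
Proof.
have: K0_Res repP qf \o K0_E rep =1 omegaK; last exact.
apply: SK_ext => x Q pQ; rewrite -[LHS]/(K0_Res repP qf (K0_E rep _)) K0_E_cl//.
apply: dsumP => y; rewrite K0_Res_cl; last exact: Emod_fgproj.
rewrite omegaE TKE//; apply: K0cl_iso; first exact: tensb_bmor_fgproj.
exact: res_Emod.
Qed.

Lemma K0_Res_omega k : K0_Res repP qf k = omegaK (K0_S repP EI qf k).
Proof. by rewrite -K0_Res_E (K0_SK repP EI qf). Qed.

(** ** Chains of bisets *)
Lemma tensb_chain_cons l (y z x : I) (yz : lt_isoc y z) (c : ichain l z x) P :
  qiso (tensb (chain_biset rep (ChainCons yz c)) P)
    (tensb (bmor (rep y) (rep z)) (tensb (chain_biset rep c) P)).
Proof.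
case: l z x / c yz P => [z|l z w x zw c] yz P /=; last exact: tensb_bprod.
exact/(afunctor_iso (tensb_functor (bmor (rep y) (rep z))))/qiso_sym/tensb_bmor1.
Qed.

(** A step at the start of a chain tensors with one more morphism biset. *)
Lemma tensb_chain l (y x : I) (c : ichain l y x) P : fgproj P ->
  fgproj (tensb (chain_biset rep c) P) /\
  chain_op TK c (K0cl P) = K0cl (tensb (chain_biset rep c) P).
Proof.
elim: c P => [{}x|{}l {}y z {}x yz c IH] P pP.
  by split; [apply: tensb_bmor_fgproj|rewrite [LHS]/=; apply/esym/(K0cl_iso pP)/tensb_bmor1].
have [pc cE] := IH P pP; have iso := tensb_chain_cons yz c P.
have pt := tensb_bmor_fgproj (rep y) pc.
split; first exact: fgproj_iso iso pt.
by rewrite (K0cl_iso pt iso) -TKE// -cE.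
Qed.

(** ** Ranks *)
Definition tq (y x : I) : rat := grank (blin (bmor (rep y) (rep x))).
Lemma TQ_linear y x : linear (fun q : ZQ => ((q : rat) * tq y x : ZQ)).
Proof.
move=> a q q'; rewrite !scalez_mulrz -[LHS]/(((q : rat) *~ a + (q' : rat)) * tq y x).
by rewrite mulrDl mulrzAl.
Qed.
Definition TQ y x : {linear ZQ -> ZQ} := mklin (TQ_linear y x).

Definition rkx (x : I) : {linear K x -> ZQ} :=
  K0lift (A := ZQ) (@grank_additive R (aut (rep x))).
Lemma rkxE x P : fgproj P -> rkx x (K0cl P) = grank P.
Proof. exact: K0liftE. Qed.

(** This is the one place where freeness of the category enters. *)
Lemma rkx_TK y x k : rkx y (TK y x k) = TQ y x (rkx x k).
Proof.
have: rkx y \o TK y x =1 TQ y x \o rkx x; last exact.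
apply: K0_ext => P pP; rewrite -[LHS]/(rkx y (TK y x (K0cl P))) TKE//.
rewrite -[RHS]/((rkx x (K0cl P) : rat) * tq y x) !rkxE//; last exact: tensb_bmor_fgproj.
have [_ st orb] := qf.
have h := @grank_tensb R _ _ (bmor (rep y) (rep x)) P (st (rep y) (rep x)) (orb (rep y) (rep x)).
exact: (h (fun g f => @free (rep y) (rep x) g f) pP).
Qed.

Lemma rkx_unit x : rkx x (K0cl (qrep (tt : BG (aut (rep x))))) = 1.
Proof. by rewrite rkxE ?(grank_unit R)//; apply: fgproj_qrep. Qed.

(** The entry of the rational matrix is the rank of the entry of omega at the class
    of Q[x]; this carries the properties of the entries of omega over. *)
Lemma TQ_TK y x q : TQ y x q = q * rkx y (TK y x (K0cl (qrep (tt : BG (aut (rep x)))))).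
Proof. by rewrite rkx_TK rkx_unit -[RHS]/((q : rat) * ((1 : rat) * tq y x)) mul1r. Qed.

Lemma TQ1 x q : TQ x x q = q.
Proof. by rewrite TQ_TK TK1 rkx_unit mulr1. Qed.

Lemma TQ0 y x q : ~ le_isoc y x -> TQ y x q = 0.
Proof. by move=> yx; rewrite TQ_TK TK0// linear0 mulr0. Qed.

Local Notation omegaQ := (omega fin_down TQ0).
Local Notation muQ := (mu EI fin_down TQ).
Definition rkV : {linear SK -> V} := dmap rkx.

Lemma rkV_omega v : rkV (omegaK v) = omegaQ (rkV v).
Proof.
have: rkV \o omegaK =1 omegaQ \o rkV; last exact.
apply: SK_ext => x P pP; apply: dsumP => y.
rewrite -[LHS]/(dmap rkx (omegaK (Kin (K0cl P))) y) dmap_coord omegaE rkx_TK.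
by rewrite -[RHS]/(omegaQ (dmap rkx (din _ x (K0cl P))) y) dmap_in omegaE.
Qed.

Lemma rkx_chain l (y x : I) (c : ichain l y x) k :
  rkx y (chain_op TK c k) = chain_op TQ c (rkx x k).
Proof.
elim: c k => // {}l {}y z {}x yz c IH k.
by rewrite -[LHS]/(rkx y (TK y z (chain_op TK c k))) rkx_TK IH.
Qed.

Lemma blin_chain_fgproj l (y x : I) (c : ichain l y x) : fgproj (blin (chain_biset rep c)).
Proof.
apply: (fgproj_iso (qiso_sym (tensb_unit _))).
by have [] := tensb_chain c (fgproj_qrep (tt : BG (aut (rep x)))).
Qed.

(** Tensoring Q[x], of rank 1, with the biset of the chain gives Q S(c), and the
    rank carries one composite to the other. *)
Lemma grank_chain l (y x : I) (c : ichain l y x) :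
  grank (blin (chain_biset rep c)) = chain_op TQ c 1.
Proof.
have [pc cE] := tensb_chain c (fgproj_qrep (tt : BG (aut (rep x)))).
rewrite -(rkx_unit x) -rkx_chain cE rkxE//.
have pb := blin_chain_fgproj c.
exact/esym/(exact_additive_iso (@grank_additive R _) pb)/tensb_unit.
Qed.

Lemma TQ_scale y x q : TQ y x q = (TQ y x 1 : rat) * q.
Proof. by rewrite -[LHS]/((q : rat) * tq y x) -[TQ y x 1]/(1 * tq y x) mul1r mulrC. Qed.

Lemma chain_op_scale l (y x : I) (c : ichain l y x) q :
  chain_op TQ c q = (chain_op TQ c 1 : rat) * q.
Proof.
elim: c q => [{}x|{}l {}y z {}x yz c IH] q; first by rewrite /= mul1r.
rewrite -[LHS]/(TQ y z (chain_op TQ c q)) -[X in _ = X * _]/(TQ y z (chain_op TQ c 1)).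
by rewrite IH TQ_scale [in RHS]TQ_scale mulrA.
Qed.

Lemma signz_scale n (q : ZQ) : (-1) ^+ n *: q = (-1) ^+ n * (q : rat) :> rat.
Proof. by rewrite scalez_mulrz -mulrzl rmorphXn rmorphN1. Qed.

Lemma mu_val_scale (y x : I) q :
  mu_val TQ (x := x) y (q : ZQ) = (mu_val TQ (x := x) y (1 : ZQ) : rat) * q :> rat.
Proof.
rewrite /mu_val !(sum_all_chains EI _ (leqnn (size (down fin_down x)))).
rewrite [X in _ = X * _](_ : _ =
  \sum_(c <- chains fin_down (size (down fin_down x)) y x)
    ((-1) ^+ tag c * (chain_op TQ (tagged c) 1 : rat))); last first.
  by apply: eq_bigr => c _; apply: signz_scale.
rewrite mulr_suml; apply: eq_bigr => c _.
by rewrite [LHS]signz_scale chain_op_scale mulrA.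
Qed.

Lemma mu_val_vN (y x : I) : ratr (mu_val TQ (x := x) y (1 : ZQ) : rat) =
  \sum_(c \in @all_chains C y x)
    (-1) ^+ tag c * vN_dim (vNind R (blin (chain_biset rep (tagged c)))).
Proof.
rewrite /mu_val !(sum_all_chains EI _ (leqnn (size (down fin_down x)))).
rewrite (rmorph_sum (ratr : {rmorphism rat -> R})); apply: eq_bigr => c _.
rewrite (vN_dim_grank R (blin_chain_fgproj _)) grank_chain.
by rewrite signz_scale rmorphM rmorphXn rmorphN1.
Qed.

Lemma matrix_toUQ (F : {linear V -> V}) (M : I -> I -> rat) (m : I -> I -> R) :
  (forall x (q : ZQ) y, F (din (fun=> ZQ) x q) y = M y x * (q : rat) :> rat) ->
  (forall y x, ratr (M y x) = m y x) ->
  is_matrix m (@toUQ I \o F \o @fromUQ I).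
Proof.
move=> FM Mm x; exists (M^~ x); split=> [y||q]; first exact: Mm.
  apply: sub_finite_set (dsum_finite (F (din (fun=> ZQ) x (1 : ZQ)))) => y /=.
  by rewrite FM mulr1.
rewrite -[LHS]/(toUQ (F (fromUQ (tenQ (fbasis int x) q)))) fromUQ_basis toUQ_sum.
by apply: eq_fsbigr => y _; rewrite FM.
Qed.

Lemma Imod_controlled x (Q : qmodule (BG (aut (rep x)))) : fgproj Q ->
  controlled rep (Imod EI Q) (down fin_down x).
Proof.
move=> pQ; split.
- exact: down_uniq.
- by move=> c d cd /downP dx; apply/downP; apply: le_isoc_trans cd dx.
- move=> c; have [xc|xc] := pselect (x = c).
    by case: c / xc; apply: fgproj_iso (Imod_res EI Q) pQ.
  apply: fgproj_zero => u; apply: Imod0 => /iclassP.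
  by rewrite !repP => /esym.
move=> y yx; apply: Imod0 => yrx; move/negP: yx; apply; apply/downP.
by have := (iclassP _ _).2 yrx; rewrite repP => ->; apply: le_isoc_refl.
Qed.

(** Evaluation is exact, so Res of the class of a resolution at y is the class of
    the value of I_x Q at y. *)
Lemma K0_Res_resolution x (Q : qmodule (BG (aut (rep x)))) k : fgproj Q ->
  resolution_class (Imod EI Q) k -> K0_Res repP qf k = Kin (K0cl Q).
Proof.
move=> pQ [d [P [del [eps [[pP P0 es e0 ex] ->]]]]]; apply: dsumP => y.
rewrite linear_sum -[LHS]/(dcoord y _) linear_sum.
have pM : fgproj (qres (Imod EI Q) (rep y)) := ctl_proj (Imod_controlled pQ) y.
have := @K0cl_resolution _ d.+1 (qres (Imod EI Q) (rep y)) (fun n => qres (P n) (rep y))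
  (fun n => res_map (rep y) (del n)) (res_map (rep y) eps) pM
  (fun n => qres_fgproj qf (rep y) (pP n)) (fun n h u => P0 n h (rep y))
  (fun u => es (rep y)) (fun u => e0 (rep y)) (fun n u => ex n (rep y)).
rewrite (_ : \sum_(i < d.+1) _ = \sum_(i < d.+1) dcoord y (K0_Res repP qf ((-1) ^+ i *: K0cl (P i)))).
  move=> <-; have [xy|xy] := pselect (x = y).
    by case: y / xy pM => pM; rewrite /Kin dinE; apply: K0cl_iso pQ (Imod_res EI Q).
  rewrite /Kin dinN// K0cl0// => u; apply: Imod0 => /iclassP.
  by rewrite !repP => /esym.
apply: eq_bigr => i _; rewrite linearZ_LR -[RHS]/((-1) ^+ i *: K0_Res repP qf (K0cl (P i)) y).
by rewrite K0_Res_cl.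
Qed.

(** ** The maps of the theorem *)
Definition omega_map : {linear SK -> SK} := omegaK.
Definition mu_map : {linear SK -> SK} := muK.
Definition K0_I : {linear SK -> K0 C} := K0_E rep \o muK.
Definition omega2_map : {linear UQ -> UQ} := toUQ \o omegaQ \o fromUQ.
Definition mu2_map : {linear UQ -> UQ} := toUQ \o muQ \o fromUQ.
Definition rk2_map : {linear SK -> UQ} := toUQ \o rkV.

Lemma omega_mapK : cancel omega_map mu_map.
Proof. exact: (mu_omegaK EI fin_down TK1 TK0). Qed.
Lemma mu_mapK : cancel mu_map omega_map.
Proof. exact: (omega_muK EI fin_down TK1 TK0). Qed.

Lemma K0_ResK : cancel (K0_Res repP qf) K0_I.
Proof.
move=> k; rewrite -[LHS]/(K0_E rep (mu_map (K0_Res repP qf k))) K0_Res_omega.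
by rewrite omega_mapK (K0_SK repP EI qf).
Qed.
Lemma K0_IK : cancel K0_I (K0_Res repP qf).
Proof. by move=> v; rewrite [LHS]K0_Res_E mu_mapK. Qed.

Lemma omega2_mapK : cancel omega2_map mu2_map.
Proof.
move=> u; rewrite -[LHS]/(toUQ (muQ (fromUQ (toUQ (omegaQ (fromUQ u)))))) toUQK.
by rewrite (mu_omegaK EI fin_down TQ1 TQ0) fromUQK.
Qed.
Lemma mu2_mapK : cancel mu2_map omega2_map.
Proof.
move=> u; rewrite -[LHS]/(toUQ (omegaQ (fromUQ (toUQ (muQ (fromUQ u)))))) toUQK.
by rewrite (omega_muK EI fin_down TQ1 TQ0) fromUQK.
Qed.

Lemma rk2_omega v : rk2_map (omega_map v) = omega2_map (rk2_map v).
Proof.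
rewrite -[RHS]/(toUQ (omegaQ (fromUQ (toUQ (rkV v))))) toUQK.
by rewrite -rkV_omega.
Qed.
Lemma rk2_mu v : rk2_map (mu_map v) = mu2_map (rk2_map v).
Proof. by rewrite -[in RHS](mu_mapK v) rk2_omega omega2_mapK. Qed.

Lemma K0_S_is_S : is_S (K0_S repP EI qf).
Proof. by move=> P pP x; split; [apply: Smod_fgproj|apply: K0_S_cl]. Qed.

Lemma K0_E_is_E : is_E (K0_E rep).
Proof. by move=> x Q pQ; split; [apply: Emod_fgproj|apply: K0_E_cl]. Qed.

Lemma K0_Res_is_Res : is_Res (K0_Res repP qf).
Proof. by move=> P pP x; split; [apply: qres_fgproj|apply: K0_Res_cl]. Qed.

Lemma K0_I_is_I : is_I EI K0_I.
Proof.
move=> x Q pQ; split=> [|k rk].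
  exact: controlled_resolution (leqnn _) (Imod_controlled pQ).
by rewrite -(K0_Res_resolution pQ rk); apply: K0_ResK.
Qed.

Lemma omega_map_is_omega : is_omega omega_map.
Proof. by move=> x P pP y; split; [apply: tensb_bmor_fgproj|rewrite [LHS]omegaE TKE]. Qed.

Lemma mu_map_is_mu : is_mu mu_map.
Proof.
move=> x P pP y; split; first exact: (all_chains_fin EI fin_down).
  by move=> l c; have [] := tensb_chain c pP.
rewrite [LHS]muE /mu_val; apply: eq_fsbigr => c _; congr (_ *: _).
by have [] := tensb_chain (tagged c) pP.
Qed.

Lemma omega2_map_is_omega2 : is_omega2 R rep omega2_map.
Proof.
split=> [y x|]; first by eexists; apply/vN_dim_is_grank/bmor_fgproj.
apply: (matrix_toUQ (F := omegaQ) (M := tq)) => [x q y|y x].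
  by rewrite omegaE -[LHS]/((q : rat) * tq y x) mulrC.
by rewrite vN_dim_grank//; apply: bmor_fgproj.
Qed.

Lemma mu2_map_is_mu2 : is_mu2 R rep mu2_map.
Proof.
split=> [y x|l y x c|]; first exact: (all_chains_fin EI fin_down).
  by eexists; apply/vN_dim_is_grank/blin_chain_fgproj.
apply: (matrix_toUQ (F := muQ) (M := fun y x => mu_val TQ (x := x) y (1 : ZQ))) => [x q y|y x].
  by rewrite muE mu_val_scale.
exact: mu_val_vN.
Qed.

Lemma rk2_map_is_rk2 : @is_rk2 R C rep rk2_map.
Proof.
move=> x P pP; split; first by eexists; apply/vN_dim_is_grank.
exists (grank P); first by rewrite vN_dim_grank.
rewrite -[LHS]/(toUQ (dmap rkx (din _ x (K0cl P)))) dmap_in rkxE//.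
exact: toUQ_in.
Qed.
End Final.

Theorem theorem6p34 (R : realType) (C : category)
    (rep : isoc C -> C) (repP : forall c, iclass (rep c) = c)
    (EI : EI_category C) (qf : quasi_finite C) (free : free_category C)
    (condI : category_condition_I C) :
  exists (S : {additive K0 C -> splitK0 rep}) (E : {additive splitK0 rep -> K0 C})
      (Res : {additive K0 C -> splitK0 rep}) (I : {additive splitK0 rep -> K0 C})
      (omega mu : {additive splitK0 rep -> splitK0 rep})
      (omega2 mu2 : {additive tensZQ (freemod int (isoc C)) ->
                              tensZQ (freemod int (isoc C))})
      (rk2 : {additive splitK0 rep -> tensZQ (freemod int (isoc C))}),
    [/\ [/\ is_S S, is_E E, is_Res Res & is_I EI I] /\
        [/\ is_omega omega, is_mu mu, is_omega2 R rep omega2,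
            is_mu2 R rep mu2 & is_rk2 R rk2],
        (cancel S E /\ cancel E S) /\ (cancel Res I /\ cancel I Res),
        (cancel omega mu /\ cancel mu omega) /\
        (cancel omega2 mu2 /\ cancel mu2 omega2) &
        [/\ omega \o S =1 Res,
            mu \o Res =1 S,
            rk2 \o omega =1 omega2 \o rk2 &
            rk2 \o mu =1 mu2 \o rk2]].
Proof.
exists (K0_S repP EI qf), (K0_E rep), (K0_Res repP qf), (K0_I rep EI qf).
exists (omega_map repP qf), (mu_map rep EI qf).
exists (omega2_map R repP qf free), (mu2_map rep EI qf), (rk2_map R rep).
split.
- split; split.
  + exact: K0_S_is_S.
  + exact: K0_E_is_E.
  + exact: K0_Res_is_Res.
  + exact: K0_I_is_I.
  + exact: omega_map_is_omega.
  + exact: mu_map_is_mu.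
  + exact: omega2_map_is_omega2.
  + exact: mu2_map_is_mu2.
  + exact: rk2_map_is_rk2.
- split; split; [exact: K0_SK|exact: K0_EK|exact: K0_ResK|exact: K0_IK].
- split; split; [exact: omega_mapK|exact: mu_mapK|exact: omega2_mapK|].
  exact: mu2_mapK.
split=> v.
- exact: (esym (K0_Res_omega repP EI qf v)).
- by rewrite -[LHS]/(mu_map _ _ _ (K0_Res repP qf v)) (K0_Res_omega repP EI) omega_mapK.
- exact: rk2_omega.
- exact: rk2_mu.
Qed.
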